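(* Let $\mathcal{M}_L=\{T\in\mathcal{S}'_2 : T\times f\in\mathcal{S}_2\text{ for all }f\in\mathcal{S}_2\}$, where $\times$ is the twisted product. Let $\mathcal{T}_1$ be the locally convex topology on $\mathcal{M}_L$ for which the bijection $ZW:\mathcal{M}_L\to\mathcal{L}_b(\mathcal{S}_1)$ is a homeomorphism, and let $\mathcal{T}_2$ be the locally convex topology on $\mathcal{M}_L$ for which the injection $S\mapsto L_S$, $L_S(f):=S\times f$, is a homeomorphism of $\mathcal{M}_L$ onto its image in $\mathcal{L}_b(\mathcal{S}_2)$. Then the topologies $\mathcal{T}_1$ and $\mathcal{T}_2$ on $\mathcal{M}_L$ coincide.
   Context: Notation. $\mathcal{S}_1=\mathcal{S}(\mathbb{R})$, $\mathcal{S}_2=\mathcal{S}(\mathbb{R}^2)$ are the Schwartz spaces (complex-valued functions) and $\mathcal{S}'_1,\mathcal{S}'_2$ their duals. $\mathcal{L}(E,F)$ is the space of continuous linear maps $E\to F$, $\mathcal{L}(E)=\mathcal{L}(E,E)$, and $\mathcal{L}_b(E)$ denotes $\mathcal{L}(E)$ with the topology of uniform convergence on bounded subsets of $E$. For $\phi,\psi\in\mathcal{S}_1$, $(\phi\otimes\psi)(q,p):=\phi(q)\psi(p)$. Pairings are bilinear and use normalized Lebesgue measures: functions are embedded in distributions by $\langle\phi,\psi\rangle=(2\pi)^{-1/2}\int_{\mathbb{R}}\phi\psi\,dx$ on $\mathbb{R}$ and $\langle f,g\rangle=(2\pi)^{-1}\int_{\mathbb{R}^2}fg\,dq\,dp$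 on $\mathbb{R}^2$. Twisted product: for $f,g\in\mathcal{S}_2$, $$(f\times g)(u)=\frac{1}{4\pi^2}\int_{\mathbb{R}^2}\int_{\mathbb{R}^2}f(v)g(w)\,e^{i(u'Jv+v'Jw+w'Ju)}\,dv\,dw,\qquad J=\begin{pmatrix}0&1\\-1&0\end{pmatrix},$$ where $u'Jv$ denotes transpose$(u)Jv$; $\times$ is an associative continuous product on $\mathcal{S}_2$. For $T\in\mathcal{S}'_2$, $f\in\mathcal{S}_2$, define $T\times f\in\mathcal{S}'_2$ by $\langle T\times f,h\rangle:=\langle T,f\times h\rangle$ for $h\in\mathcal{S}_2$. For $S\in\mathcal{M}_L$, the map $L_S:f\mapsto S\times f$ belongs to $\mathcal{L}(\mathcal{S}_2)$. Wigner transformation: for $f\in\mathcal{S}_2$, $$(Wf)(x,y)=\frac{1}{\sqrt{2\pi}}\int_{\mathbb{R}}f\Bigl(\frac{x+y}{\sqrt2},z\Bigr)e^{i(x-y)z/\sqrt2}\,dz,$$ an isomorphism of $\mathcal{S}_2$ onto itself; it is extended to $\mathcal{S}'_2$ by transposition: $\langle WT,h\rangle:=\langle T,\overline{W}^{-1}h\rangle$, where $(\overline{W}^{-1}h)(x,y)=\frac{1}{\sqrt{2\pi}}\int_{\mathbb{R}}h\bigl(\frac{x+z}{\sqrt2},\frac{x-z}{\sqrt2}\bigr)e^{iyz}\,dz$. Kernel map: for $T\in\mathcal{S}'_2$, $\phi\in\mathcal{S}_1$, $T\cdot\phi\in\mathcal{S}'_1$ is defined by $\langle T\cdot\phi,\psi\rangle:=\frac{1}{\sqrt2}\langle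 T,\psi\otimes\phi\rangle$ for $\psi\in\mathcal{S}_1$, and $(ZT)(\phi):=T\cdot\phi$, so $Z:\mathcal{S}'_2\to\mathcal{L}(\mathcal{S}_1,\mathcal{S}'_1)$ is an isomorphism by the kernel theorem. The composition $ZW$ restricts to an algebra isomorphism of $\mathcal{M}_L$ onto $\mathcal{L}(\mathcal{S}_1)$ (regarded as a subspace of $\mathcal{L}(\mathcal{S}_1,\mathcal{S}'_1)$). *)

(* Defs.v *)
From HB Require Import structures.
From mathcomp Require Import all_boot all_order all_algebra.
From mathcomp Require Import complex.
From mathcomp Require Import all_classical all_reals all_analysis.

Set Implicit Arguments.
Unset Strict Implicit.
Unset Printing Implicit Defensive.
Import Order.TTheory GRing.Theory Num.Theory.
Import numFieldNormedType.Exports.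
Import ComplexField.Normc.

Local Open Scope classical_set_scope.
Local Open Scope ring_scope.

Lemma normc_ge0 (R : realType) (a : R[i]) : 0 <= normc a.
Proof. by rewrite -lecR; exact: (normr_ge0 a). Qed.

(* The locally convex topology generated by a family of seminorms: a
   neighborhood of x contains a set of all y such that p_i (y - x) < e for
   finitely many indices i. *)
HB.factory Record Lmodule_hasSeminorms (R : realType) E & GRing.Lmodule R[i] E
    := {
  sn_index : eqType ;
  seminorm : sn_index -> E -> R ;
  seminormD : forall i x y, seminorm i (x + y) <= seminorm i x + seminorm i y ;
  seminormZ : forall i (a : R[i]) x,
    seminorm i (a *: x) = normc a * seminorm i x
}.

HB.builders Context (R : realType) E & Lmodule_hasSeminorms R E.

Local Notation p := seminorm.

Let p0 i : p i 0 = 0.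
Proof. by rewrite -[0](scale0r 0) seminormZ normc0 mul0r. Qed.

Let pN i x : p i (- x) = p i x.
Proof. by rewrite -scaleN1r seminormZ normcN normc1 mul1r. Qed.

Let p_ge0 i x : 0 <= p i x.
Proof.
have := seminormD i x (- x); rewrite subrr p0 pN -mulr2n.
by rewrite pmulrn_lge0.
Qed.

Let small (s : seq sn_index) (e : R) (x : E) := forall i, i \in s -> p i x < e.

Let ent : set_system (E * E) := [set A | exists (s : seq sn_index) (e : R),
  0 < e /\ forall x y, small s e (y - x) -> A (x, y)].

Let ent_filter : Filter ent.
Proof.
split; first by exists [::], 1.
- move=> A B [s [e [e0 sA]]] [t [d [d0 tB]]].
  exists (s ++ t), (Order.min e d); split; first by rewrite lt_min e0 d0.
  move=> x y H; split.
    by apply: sA => i si; have := H i; rewrite mem_cat si lt_min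
      => /(_ isT)/andP[].
  by apply: tB => i ti; have := H i; rewrite mem_cat ti orbT lt_min
    => /(_ isT)/andP[].
- by move=> A B AB [s [e [e0 sA]]]; exists s, e; split=> // x y /sA/AB.
Qed.

Let ent_refl A : ent A -> diagonal `<=` A.
Proof.
move=> [s [e [e0 sA]]] [x y]/diagonalP ->; apply: sA => i _.
by rewrite subrr p0.
Qed.

Let ent_inv A : ent A -> ent A^-1%relation.
Proof.
move=> [s [e [e0 sA]]]; exists s, e; split=> // x y H; apply: sA => i si.
by rewrite -opprB pN; exact: H.
Qed.

Let ent_split A : ent A -> exists2 B, ent B & (B \; B)%relation `<=` A.
Proof.
move=> [s [e [e0 sA]]].
exists [set xy | small s (e / 2) (xy.2 - xy.1)].
  by exists s, (e / 2); rewrite divr_gt0.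
move=> [x y] [z /= xz zy]; apply: sA => i si.
rewrite -(subrKA z) (le_lt_trans (seminormD _ _ _))//.
by rewrite [ltRHS](splitr e) ltrD// ?xz ?zy.
Qed.

HB.instance Definition _ :=
  isUniform.Build E ent_filter ent_refl ent_inv ent_split.

Let nbhs_small (x : E) (U : set E) : nbhs x U <->
  exists s e, 0 < e /\ forall y, small s e (y - x) -> U y.
Proof.
rewrite -nbhs_entourageE; split=> [[A [s [e [e0 sA]]] AU]|[s [e [e0 sU]]]].
  by exists s, e; split=> // y H; apply: AU; apply/xsectionP; exact: sA.
exists [set xy | small s e (xy.2 - xy.1)]; first by exists s, e.
by move=> y /xsectionP; exact: sU.
Qed.

Let add_cont : continuous (fun x : E * E => x.1 + x.2).
Proof.
move=> [x y] U /nbhs_small[s [e [e0 sU]]].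
have e20 : 0 < e / 2 by rewrite divr_gt0.
exists ([set x' | small s (e / 2) (x' - x)],
        [set y' | small s (e / 2) (y' - y)]).
  by split; apply/nbhs_small; exists s, (e / 2).
move=> [x' y'] [/= xx yy]; apply: sU => i si /=.
rewrite opprD addrACA (le_lt_trans (seminormD _ _ _))//.
by rewrite [ltRHS](splitr e) ltrD// ?xx ?yy.
Qed.

Let scale_cont : continuous (fun z : R[i]^o * E => z.1 *: z.2).
Proof.
move=> [a x] U /nbhs_small[s [e [e0 sU]]] /=.
pose M := \sum_(i <- s) p i x + 1.
have M0 : 0 < M by rewrite ltr_wpDl// sumr_ge0.
have pM i : i \in s -> p i x <= M.
  move=> si; rewrite /M (big_rem i si)/= -addrA lerDl addr_ge0// sumr_ge0//.
pose N := normc a + 1.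
have na0 : 0 <= normc a by exact: normc_ge0.
have N0 : 0 < N by rewrite ltr_wpDl.
pose d := Order.min 1 (e / 2 / M).
have d0 : 0 < d by rewrite lt_min ltr01 !divr_gt0.
exists ([set b | normc (b - a) < d], [set y | small s (e / 2 / N) (y - x)]).
  split; last first.
    by apply/nbhs_small; exists s, (e / 2 / N); split; rewrite ?divr_gt0.
  apply/nbhs_ballP; exists (d%:C)%C => /=; first by rewrite ltcR.
  move=> b; rewrite -ball_normE /= distrC => H; rewrite -ltcR; exact: H.
move=> [b y] [/= ba yx]; apply: sU => i si /=.
have -> : b *: y - a *: x = b *: (y - x) + (b - a) *: x.
  by rewrite scalerBr scalerBl addrA subrK.
rewrite (le_lt_trans (seminormD _ _ _))// !seminormZ [ltRHS](splitr e).
have nb : normc b <= N.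
  rewrite -(subrK a b) (le_trans (le_normcD _ _))// addrC lerD2l.
  by rewrite (le_trans (ltW ba))// ge_min lexx.
apply: ltr_leD.
  apply: (@le_lt_trans _ _ (N * p i (y - x))); first by rewrite ler_wpM2r.
  by rewrite -ltr_pdivlMl// mulrC yx.
apply: (@le_trans _ _ (e / 2 / M * M)); last by rewrite divfK// gt_eqF.
apply: ler_pM => //; first exact: normc_ge0.
  by rewrite (le_trans (ltW ba))// ge_min lexx orbT.
exact: pM.
Qed.

Let open_small s e x : open [set y | small s e (y - x)].
Proof.
elim: s => [|j s IHs].
  rewrite (_ : [set _ | _] = setT); first exact: openT.
  by apply/seteqP; split.
rewrite (_ : [set _ | _] =
    [set y | p j (y - x) < e] `&` [set y | small s e (y - x)]).
  apply: openI => //; rewrite openE => y /= yx; apply/nbhs_small.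
  exists [:: j], (e - p j (y - x)); split; first by rewrite subr_gt0.
  move=> z /(_ j (mem_head _ _)) zy.
  by rewrite /= -(subrKA y) (le_lt_trans (seminormD _ _ _))// -ltrBrDr.
apply/seteqP; split=> y /=.
  move=> H; split; first exact/H/mem_head.
  by move=> i si; apply: H; rewrite inE si orbT.
by move=> [yj ys] i; rewrite inE => /predU1P[->//|]; exact: ys.
Qed.

Let loc_convex :
  exists2 B : set_system E, (forall b, b \in B -> convex_set b) & basis B.
Proof.
exists [set U | exists x s e, U = [set y | small s e (y - x)]].
  move=> U; rewrite inE => -[x [s [e ->]]].
  apply/convex_setW => y z; rewrite !inE => yx zx l l0 l1.
  rewrite inE/= => i si.
  rewrite [X in p i X](_ : _ = l%:num *: (y - x) + (1 - l%:num) *: (z - x)).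
    rewrite (le_lt_trans (seminormD _ _ _))// !seminormZ.
    have nl : normc l%:num + normc (1 - l%:num) = 1.
      apply: complexI; rewrite rmorphD/= -[_%:C%C]/`|l%:num|.
      rewrite -[X in _ + X]/`|1 - l%:num| !gtr0_norm ?subr_gt0//.
      by rewrite addrC subrK.
    have l_gt0 : 0 < normc l%:num.
      by rewrite -ltcR -[X in _ < X]/`|l%:num| normr_gt0 gt_eqF.
    rewrite -[ltRHS]mul1r -nl mulrDl ltr_leD//.
      by rewrite ltr_pM2l// yx.
    by rewrite ler_wpM2l ?normc_ge0// ltW// zx.
  rewrite -[LHS]/(l%:num *: y + (1 - l%:num) *: z - x) !scalerBr addrACA.
  by rewrite -opprD -scalerDl [l%:num + _]addrC subrK scale1r.
split; first by move=> U [x [s [e ->]]]; exact: open_small.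
move=> x U /nbhs_small[s [e [e0 sU]]].
exists [set y | small s e (y - x)] => //; split; first by exists x, s, e.
by move=> i _; rewrite subrr p0.
Qed.

HB.instance Definition _ :=
  PreTopologicalNmodule_isTopologicalNmodule.Build E add_cont.
HB.instance Definition _ :=
  TopologicalNmodule_isTopologicalLmodule.Build R[i] E scale_cont.
HB.instance Definition _ := Uniform_isTvs.Build R[i] E loc_convex.

HB.end.

Section bounded_convergence.
Context {K : numFieldType}.

Definition tvs_bounded {E : tvsType K} : set (set E) :=
  [set B | forall U, nbhs (0 : E) U ->
    exists2 r : K, 0 < r & forall s, r <= `|s| -> B `<=` [set s *: x | x in U]].

(* As a subset of a space of functions, Lb E F (coerced to a type) carries the
   topology of uniform convergence on the bounded subsets of E. *)
Definition Lb (E F : tvsType K) : set {family tvs_bounded, E -> F} :=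
  [set A | linear (A : E -> F) /\ continuous (A : E -> F)].
Arguments Lb : clear implicits.

Fact zero_Lb (E F : tvsType K) : (fun=> 0 : F) \in Lb E F.
Proof.
rewrite inE; split; first by move=> a x y; rewrite scaler0 addr0.
by move=> x; exact: cvg_cst.
Qed.

Definition Lb0 (E F : tvsType K) : Lb E F := SigSub (zero_Lb E F).

End bounded_convergence.
Arguments Lb {K} E F.
Arguments Lb0 {K} E F.

Section complex_calculus.
Context {R : realType}.
Local Notation C := R[i].

Definition expi (t : R) : C := Complex (cos t) (sin t).

Definition cintegral d (T : measurableType d) (mu : {measure set T -> \bar R})
    (f : T -> C) : C :=
  Complex (\int[mu]_x complex.Re (f x)) (\int[mu]_x complex.Im (f x)).

Definition ccontinuous (T : topologicalType) (f : T -> C) : Prop :=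
  continuous (@complex.Re R \o f : T -> R) /\
  continuous (@complex.Im R \o f : T -> R).

Definition cderivable (f : R -> C) (x : R) : Prop :=
  derivable (@complex.Re R \o f : R -> R) x 1 /\
  derivable (@complex.Im R \o f : R -> R) x 1.

Definition cderive (f : R -> C) (x : R) : C :=
  Complex (derive1 (@complex.Re R \o f) x)
          (derive1 (@complex.Im R \o f) x).

Definition supnorm (T : Type) (f : T -> C) : R :=
  sup (range (fun x => normc (f x))).

Definition supbounded (T : Type) (f : T -> C) : Prop :=
  has_ubound (range (fun x => normc (f x))).

Lemma ReD (a x y : C) : complex.Re (a * x + y) =
  complex.Re a * complex.Re x - complex.Im a * complex.Im x + complex.Re y.
Proof. by case: a x y => [? ?] [? ?] [? ?]. Qed.

Lemma ImD (a x y : C) : complex.Im (a * x + y) =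
  complex.Re a * complex.Im x + complex.Im a * complex.Re x + complex.Im y.
Proof. by case: a x y => [? ?] [? ?] [? ?]. Qed.

Lemma ccontinuousP (T : topologicalType) (a : C) (f g : T -> C) :
  ccontinuous f -> ccontinuous g -> ccontinuous (a *: f + g).
Proof.
move=> [f1 f2] [g1 g2]; split=> x.
  rewrite (_ : _ \o _ = fun x => complex.Re a * complex.Re (f x)
    - complex.Im a * complex.Im (f x) + complex.Re (g x)).
    apply: cvgD; last exact: g1.
    by apply: cvgB; apply: cvgMr; [exact: f1|exact: f2].
  by apply/funext => y; rewrite -ReD.
rewrite (_ : _ \o _ = fun x => complex.Re a * complex.Im (f x)
    + complex.Im a * complex.Re (f x) + complex.Im (g x)).
  by apply: cvgD; [apply: cvgD; apply: cvgMr; [exact: f2|exact: f1]|exact: g2].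
by apply/funext => y; rewrite -ImD.
Qed.

Lemma is_cderiveP (a : C) (f g : R -> C) x : cderivable f x -> cderivable g x ->
  cderivable (a *: f + g) x /\
  cderive (a *: f + g) x = a * cderive f x + cderive g x.
Proof.
move=> [/derivableP f1 /derivableP f2] [/derivableP g1 /derivableP g2].
pose r := (complex.Re a \*: (@complex.Re R \o f : R -> R)
    - complex.Im a \*: (@complex.Im R \o f : R -> R))
    + (@complex.Re R \o g : R -> R).
pose i := (complex.Re a \*: (@complex.Im R \o f : R -> R)
    + complex.Im a \*: (@complex.Re R \o f : R -> R))
    + (@complex.Im R \o g : R -> R).
have rE : @complex.Re R \o (a *: f + g) = r.
  by apply/funext => y; rewrite /= ReD.
have iE : @complex.Im R \o (a *: f + g) = i.
  by apply/funext => y; rewrite /= ImD.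
have dr := is_deriveD (is_deriveB (is_deriveZ (complex.Re a) f1)
  (is_deriveZ (complex.Im a) f2)) g1 : is_derive x 1 r _.
have di := is_deriveD (is_deriveD (is_deriveZ (complex.Re a) f2)
  (is_deriveZ (complex.Im a) f1)) g2 : is_derive x 1 i _.
split; first by split; [rewrite rE; case: dr|rewrite iE; case: di].
apply/eqP; rewrite eq_complex ReD ImD /cderive rE iE /= !derive1E.
by rewrite (@derive_val _ _ _ _ _ _ _ dr) (@derive_val _ _ _ _ _ _ _ di) !eqxx.
Qed.

Lemma supnorm_ge (T : Type) (f : T -> C) x : supbounded f ->
  normc (f x) <= supnorm f.
Proof.
by move=> fb; apply: ub_le_sup => //; exists x.
Qed.

Lemma supbounded_lin (T : Type) (a : C) (f g : T -> C) :
  supbounded f -> supbounded g -> supbounded (a *: f + g).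
Proof.
move=> [M fM] [N gN]; exists (normc a * M + N) => _ [x _ <-].
rewrite (le_trans (le_normcD _ _))// normcM lerD//; last by apply: gN; exists x.
by rewrite ler_wpM2l ?normc_ge0//; apply: fM; exists x.
Qed.

Lemma supnormD (T : pointedType) (f g : T -> C) :
  supbounded f -> supbounded g -> supnorm (f + g) <= supnorm f + supnorm g.
Proof.
move=> fb gb; apply: ge_sup; first by exists (normc ((f + g) point)), point.
by move=> _ [x _ <-]; rewrite (le_trans (le_normcD _ _))// lerD// supnorm_ge.
Qed.

Lemma supnormZ (T : pointedType) (a : C) (f : T -> C) :
  supbounded f -> supnorm (a *: f) = normc a * supnorm f.
Proof.
have le (b : C) (g : T -> C) : supbounded g ->
    supnorm (b *: g) <= normc b * supnorm g.
  move=> gb; apply: ge_sup; first by exists (normc ((b *: g) point)), point.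
  by move=> _ [x _ <-]; rewrite normcM ler_wpM2l ?normc_ge0 ?supnorm_ge.
move=> fb; have afb : supbounded (a *: f).
  have [M fM] := fb; exists (normc a * M) => _ [x _ <-].
  by rewrite normcM ler_wpM2l ?normc_ge0//; apply: fM; exists x.
apply/eqP; rewrite eq_le le//=.
have [->|a0] := eqVneq a 0.
  rewrite normc0 mul0r; apply: le_trans (supnorm_ge point _).
    exact: normc_ge0.
  by rewrite scale0r; exists 0 => _ [x _ <-]; rewrite normc0.
have na0 : 0 < normc a.
  by rewrite lt_def normc_ge0 andbT; apply: contra_neq a0 => /eq0_normc.
rewrite -ler_pdivlMl// -normcV (le_trans _ (le a^-1 _ afb))//.
by rewrite scalerA mulVf// scale1r.
Qed.

End complex_calculus.

Section schwartz_functions.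
Context {R : realType}.
Local Notation C := R[i].

Definition smooth1 (f : R -> C) : Prop :=
  forall m x, cderivable (iter m cderive f) x.

Definition weighted1 (km : nat * nat) (f : R -> C) (x : R) : C :=
  ((x ^+ km.1)%:C)%C * iter km.2 cderive f x.

Definition schwartz1 : set (R -> C) :=
  [set f | smooth1 f /\ forall km, supbounded (weighted1 km f)].

Definition pderivable (d : bool) (f : R * R -> C) (u : R * R) : Prop :=
  if d then cderivable (fun t => f (u.1, t)) u.2
  else cderivable (fun t => f (t, u.2)) u.1.

Definition pderive (d : bool) (f : R * R -> C) (u : R * R) : C :=
  if d then cderive (fun t => f (u.1, t)) u.2
  else cderive (fun t => f (t, u.2)) u.1.

(* Mixed partial derivatives are indexed by words of variables (false is the
   first one, true the second one) instead of multi-indices. *)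
Definition pderives (s : seq bool) (f : R * R -> C) : R * R -> C :=
  foldr pderive f s.

Definition smooth2 (f : R * R -> C) : Prop :=
  forall s, ccontinuous (pderives s f) /\
    forall d u, pderivable d (pderives s f) u.

Definition weighted2 (kls : nat * nat * seq bool) (f : R * R -> C)
    (u : R * R) : C :=
  ((u.1 ^+ kls.1.1 * u.2 ^+ kls.1.2)%:C)%C * pderives kls.2 f u.

Definition schwartz2 : set (R * R -> C) :=
  [set f | smooth2 f /\ forall kls, supbounded (weighted2 kls f)].

Lemma iter_cderiveD (a : C) f g m : smooth1 f -> smooth1 g ->
  iter m cderive (a *: f + g) = a *: iter m cderive f + iter m cderive g.
Proof.
move=> sf sg; elim: m => //= m ->; apply/funext => x.
by rewrite (is_cderiveP a (sf m x) (sg m x)).2.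
Qed.

Lemma pderivesD (a : C) f g s : smooth2 f -> smooth2 g ->
  pderives s (a *: f + g) = a *: pderives s f + pderives s g.
Proof.
move=> sf sg; elim: s => //= d s ->; apply/funext => u.
have := (sf s).2 d u; have := (sg s).2 d u; rewrite /pderivable /pderive.
by case: d => gu fu; have [_ /= ->] := is_cderiveP a fu gu.
Qed.

Lemma weighted1D km (a : C) f g : smooth1 f -> smooth1 g ->
  weighted1 km (a *: f + g) = a *: weighted1 km f + weighted1 km g.
Proof.
move=> sf sg; apply/funext => x; rewrite /weighted1 iter_cderiveD//.
by rewrite -[LHS]/(_ * (a * _ + _)) mulrDr mulrCA.
Qed.

Lemma weighted2D kls (a : C) f g : smooth2 f -> smooth2 g ->
  weighted2 kls (a *: f + g) = a *: weighted2 kls f + weighted2 kls g.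
Proof.
move=> sf sg; apply/funext => u; rewrite /weighted2 pderivesD//.
by rewrite -[LHS]/(_ * (a * _ + _)) mulrDr mulrCA.
Qed.

Fact cderive0 : cderive (0 : R -> C) = 0.
Proof.
apply/funext => x; rewrite /cderive.
have -> : @complex.Re R \o (0 : R -> C) = cst 0 by [].
have -> : @complex.Im R \o (0 : R -> C) = cst 0 by [].
by rewrite derive1_cst.
Qed.

Fact cderivable0 x : cderivable (0 : R -> C) x.
Proof. by split; exact: (derivable_cst (0 : R)). Qed.

Fact schwartz1_submod : submod_closed (mem schwartz1).
Proof.
split=> [|a f g].
  have d0 m : iter m cderive (0 : R -> C) = 0.
    by elim: m => //= m ->; exact: cderive0.
  rewrite inE; split=> [m x|km]; first by rewrite d0; exact: cderivable0.
  exists 0 => _ [x _ <-]; rewrite /weighted1 d0 mulr0 normc0 //.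
rewrite !inE => -[sf fb] [sg gb]; split=> [m x|km].
  by rewrite iter_cderiveD//; exact: (is_cderiveP a (sf m x) (sg m x)).1.
by rewrite weighted1D//; exact: supbounded_lin.
Qed.

Fact schwartz2_submod : submod_closed (mem schwartz2).
Proof.
split=> [|a f g].
  have d0 s : pderives s (0 : R * R -> C) = 0.
    elim: s => //= d s ->; apply/funext => u; rewrite /pderive.
    by case: d; [exact: (congr1 (@^~ u.2) cderive0)|
                 exact: (congr1 (@^~ u.1) cderive0)].
  rewrite inE; split=> [s|kls].
    rewrite d0; split; first by split=> x; exact: cvg_cst.
    by move=> d u; rewrite /pderivable; case: d; exact: cderivable0.
  exists 0 => _ [x _ <-]; rewrite /weighted2 d0 mulr0 normc0 //.
rewrite !inE => -[sf fb] [sg gb]; split=> [s|kls].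
  rewrite pderivesD//; have [cf df] := sf s; have [cg dg] := sg s.
  split; first exact: ccontinuousP.
  move=> d u; have := df d u; have := dg d u; rewrite /pderivable.
  by case: d => gu fu; exact: (is_cderiveP a fu gu).1.
by rewrite weighted2D//; exact: supbounded_lin.
Qed.

End schwartz_functions.

Definition S1 (R : realType) : Type := {f : R -> R[i] | f \in schwartz1}.

Definition S2 (R : realType) : Type := {f : R * R -> R[i] | f \in schwartz2}.

Section schwartz_spaces.
Context (R : realType).
Local Notation C := R[i].

HB.instance Definition _ := [isSub of S1 R for sval].
HB.instance Definition _ := [Choice of S1 R by <:].
HB.instance Definition _ :=
  GRing.SubChoice_isSubLmodule.Build C (R -> C) (mem schwartz1) (S1 R)
    schwartz1_submod.

HB.instance Definition _ := [isSub of S2 R for sval].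
HB.instance Definition _ := [Choice of S2 R by <:].
HB.instance Definition _ :=
  GRing.SubChoice_isSubLmodule.Build C (R * R -> C) (mem schwartz2) (S2 R)
    schwartz2_submod.

Definition snorm1 (km : nat * nat) (f : S1 R) : R :=
  supnorm (weighted1 km (val f)).

Definition snorm2 (kls : nat * nat * seq bool) (f : S2 R) : R :=
  supnorm (weighted2 kls (val f)).

Fact snorm1D km f g : snorm1 km (f + g) <= snorm1 km f + snorm1 km g.
Proof.
have := valP f; have := valP g; rewrite !inE => -[sg gb] [sf fb].
have := weighted1D km 1 sf sg; rewrite !scale1r => fgE.
by rewrite /snorm1 [val _]/(val f + val g) fgE; exact: supnormD.
Qed.

Fact snorm1Z km a f : snorm1 km (a *: f) = normc a * snorm1 km f.
Proof.
have := valP f; have := valP (0 : S1 R); rewrite !inE => -[s0 b0] [sf fb].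
rewrite /snorm1 -supnormZ//; congr supnorm.
have := weighted1D km 0 sf sf; have := weighted1D km a sf s0.
have -> : weighted1 km (val (0 : S1 R)) = 0.
  have := weighted1D km (-1) s0 s0.
  by rewrite scaler0 add0r scaleN1r addNr.
by rewrite !addr0.
Qed.

Fact snorm2D kls f g : snorm2 kls (f + g) <= snorm2 kls f + snorm2 kls g.
Proof.
have := valP f; have := valP g; rewrite !inE => -[sg gb] [sf fb].
have := weighted2D kls 1 sf sg; rewrite !scale1r => fgE.
by rewrite /snorm2 [val _]/(val f + val g) fgE; exact: supnormD.
Qed.

Fact snorm2Z kls a f : snorm2 kls (a *: f) = normc a * snorm2 kls f.
Proof.
have := valP f; have := valP (0 : S2 R); rewrite !inE => -[s0 b0] [sf fb].
rewrite /snorm2 -supnormZ//; congr supnorm.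
have := weighted2D kls a sf s0.
have -> : weighted2 kls (val (0 : S2 R)) = 0.
  have := weighted2D kls (-1) s0 s0.
  by rewrite scaler0 add0r scaleN1r addNr.
by rewrite !addr0.
Qed.

HB.instance Definition _ :=
  Lmodule_hasSeminorms.Build R (S1 R) snorm1D snorm1Z.

HB.instance Definition _ :=
  Lmodule_hasSeminorms.Build R (S2 R) snorm2D snorm2Z.

End schwartz_spaces.

Section moyal.
Context {R : realType}.
Local Notation C := R[i].
Local Notation S1 := (S1 R).
Local Notation S2 := (S2 R).
Local Notation mu := (@lebesgue_measure R).
Local Notation mu2 := (mu \x mu)%E.

Definition dual2 := Lb S2 C^o.

(* S1 and S2 are viewed in their duals through these pairings. *)
Definition pairing1 (f g : S1) : C :=
  (((Num.sqrt (2 * pi))^-1)%:C)%C * cintegral mu (fun x => val f x * val g x).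

Definition pairing2 (f g : S2) : C :=
  (((2 * pi)^-1)%:C)%C * cintegral mu2 (fun u => val f u * val g u).

(* [toS2] returns 0 on functions that are not Schwartz functions; in the
   definitions below it is only applied to Schwartz functions. *)
Definition toS2 (f : R * R -> C) : S2 := insubd 0 f.

Definition tensor (f g : S1) : S2 := toS2 (fun u => val f u.1 * val g u.2).

(* u^T J v with J = (0 1; -1 0) *)
Definition symp (u v : R * R) : R := u.1 * v.2 - u.2 * v.1.

Definition twisted (f g : S2) : S2 := toS2 (fun u =>
  (((4 * pi ^+ 2)^-1)%:C)%C *
  cintegral mu2 (fun v => cintegral mu2 (fun w =>
    val f v * val g w * expi (symp u v + symp v w + symp w u)))).

Definition twisted_dual (T : dual2) (f : S2) (h : S2) : C :=
  val T (twisted f h).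

Definition M_L : set dual2 :=
  [set T | forall f, exists g : S2, forall h,
    twisted_dual T f h = pairing2 g h].

Definition Wbarinv (h : S2) : S2 := toS2 (fun u =>
  (((Num.sqrt (2 * pi))^-1)%:C)%C *
  cintegral mu (fun z =>
    val h ((u.1 + z) / Num.sqrt 2, (u.1 - z) / Num.sqrt 2) * expi (u.2 * z))).

(* The Wigner transformation on the dual of S2 is the transpose of Wbarinv. *)
Definition W_dual (T : dual2) (h : S2) : C := val T (Wbarinv h).

Definition Z (T : S2 -> C) (phi psi : S1) : C :=
  (((Num.sqrt 2)^-1)%:C)%C * T (tensor psi phi).

(* The continuous operator A on S1 such that, for all phi, the function A phi
   represents the distribution Z (W T) phi. It exists for every T in M_L and is
   unique, so the default value Lb0 is not used. *)
Definition ZW (T : M_L) : Lb S1 S1 :=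
  xget (Lb0 S1 S1) [set A | forall phi psi,
    Z (W_dual (val T)) phi psi = pairing1 (val A phi) psi].

(* The continuous operator f |-> S x f on S2; the default value Lb0 is not used
   either. *)
Definition Lmul (S : M_L) : Lb S2 S2 :=
  xget (Lb0 S2 S2) [set A | forall f h,
    twisted_dual (val S) f h = pairing2 (val A f) h].

(* An injective map f : X -> Y is a homeomorphism onto its image, which is Y if
   f is bijective, exactly for the topology initial_topology f on X. *)
Definition T1 : set_system M_L := @open (initial_topology ZW).
Definition T2 : set_system M_L := @open (initial_topology Lmul).

End moyal.
Arguments M_L : clear implicits.
Arguments T1 : clear implicits.
Arguments T2 : clear implicits.

(* Main.v *)
Require Import Defs.
From HB Require Import structures.
From mathcomp Require Import all_boot all_order all_algebra.
From mathcomp Require Import complex.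
From mathcomp Require Import all_classical all_reals all_analysis.
From mathcomp Require Import measurable_realfun ring lra.

(* The Wigner transformation turns the twisted product into composition of
   kernels. Let V be the inverse of [Wbarinv], called [Wbar] below; then f x h is
   a constant multiple of Wbarinv (V h o V f), where (H o F)(x, y) is the integral
   of H(x, z) F(z, y) over z. It follows that, for A = ZW S and L = L_S, the
   operator L is A acting on one variable in Wigner coordinates:
   V (L f)(y, .) = A (V f (y, .)). Taking V f = chi (x) phi for a fixed Gaussian chi
   expresses A phi as a continuous function of L (Wbarinv (chi (x) phi)), so that
   uniform convergence of L on bounded sets implies that of A. Conversely a
   seminorm of V (L f) is the supremum over y of a seminorm of A at the functions
   y^k d^n/dy^n V f (y, .), which stay in a bounded set as f does. All the linear
   maps involved are continuous by the closed graph theorem, which follows from a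
   uniform boundedness principle on the complete spaces S1 and S2. *)

Set Implicit Arguments.
Unset Strict Implicit.
Unset Printing Implicit Defensive.
Import Order.TTheory GRing.Theory Num.Theory.
Import numFieldNormedType.Exports.
Import ComplexField.Normc.

Local Open Scope classical_set_scope.
Local Open Scope ring_scope.

#[local] Arguments normc : simpl never.
#[local] Arguments cderive : simpl never.
#[local] Arguments pderive : simpl never.
#[local] Arguments expi : simpl never.
#[local] Arguments isSub.val_subdef : simpl never.

(** * Calculus of complex-valued functions *)

(** Membership in [M_L] only asserts that for each f some mate g with T x f = g exists. Linearity
    and continuity of f |-> g are not given, and [ZW] and [Lmul] are chosen by [xget], so continuous
    operators must first be produced. They come from testing against rank-one kernels psi (x) theta,
    which reveals A only on averages of V f against theta. Letting theta tend to a Dirac mass, at a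
    rate controlled in every seminorm, yields the identity on slices. Derivatives of integrals, of
    limits and of slices under A are all obtained from remainder bounds M t^2: such bounds survive
    integration against 1/(1+x^2), pointwise limits and continuous linear maps. The constant
    sqrt(pi) that accompanies T is what remains of the normalizations: 1/sqrt 2 in [Z] against
    1/sqrt(2 pi) in [pairing1], and 1/(2 sqrt pi) from [twisted] against 1/(2 pi) in [pairing2]. *)

Section complex_estimates.
Context {R : realType}.
Local Notation C := R[i].
Implicit Types (x y z : C) (t M : R).

Lemma ReB x y : complex.Re (x - y) = complex.Re x - complex.Re y.
Proof. by case: x y => [? ?] [? ?]. Qed.

Lemma ImB x y : complex.Im (x - y) = complex.Im x - complex.Im y.
Proof. by case: x y => [? ?] [? ?]. Qed.

Lemma ReMr t x : complex.Re (t%:C%C * x) = t * complex.Re x.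
Proof. by case: x => a b; rewrite /= mul0r subr0. Qed.

Lemma ImMr t x : complex.Im (t%:C%C * x) = t * complex.Im x.
Proof. by case: x => a b; rewrite /= mul0r addr0. Qed.

Lemma Re_le_normc x : `|complex.Re x| <= normc x.
Proof.
by case: x => a b /=; rewrite -sqrtr_sqr ler_wsqrtr// lerDl sqr_ge0.
Qed.

Lemma Im_le_normc x : `|complex.Im x| <= normc x.
Proof.
by case: x => a b /=; rewrite -sqrtr_sqr ler_wsqrtr// lerDr sqr_ge0.
Qed.

Lemma realcM (a b : R) : (a * b)%:C%C = a%:C%C * b%:C%C :> C.
Proof. exact: rmorphM. Qed.

Lemma realcN (a : R) : (- a)%:C%C = - a%:C%C :> C.
Proof. exact: rmorphN. Qed.

Lemma realcD (a b : R) : (a + b)%:C%C = a%:C%C + b%:C%C :> C.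
Proof. exact: rmorphD. Qed.

Lemma normc_real t : normc t%:C%C = `|t|.
Proof. by rewrite /normc /= expr0n addr0 sqrtr_sqr. Qed.

Lemma normc_le x : normc x <= `|complex.Re x| + `|complex.Im x|.
Proof.
case: x => a b /=; rewrite -[leRHS]ger0_norm ?addr_ge0// -sqrtr_sqr.
by rewrite ler_wsqrtr// sqrrD !real_normK ?num_real// lerD2r lerDl mulrn_wge0 ?mulr_ge0.
Qed.

Lemma normcMr t x : normc (t%:C%C * x) = `|t| * normc x.
Proof. by rewrite normcM normc_real. Qed.

Lemma le_normcB x y : normc (x - y) <= normc x + normc y.
Proof. by rewrite -(normcN y) le_normcD. Qed.

Lemma normc_expi t : normc (expi t) = 1.
Proof. by rewrite /expi /normc cos2Dsin2 sqrtr1. Qed.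

Lemma expiD (s t : R) : expi (s + t) = expi s * expi t.
Proof.
rewrite /expi cosD sinD; apply/eqP; rewrite eq_complex /=.
by rewrite eqxx/= addrC.
Qed.

Lemma expi0 : expi (0 : R) = 1.
Proof. by rewrite /expi cos0 sin0. Qed.

End complex_estimates.

Section quadratic_calculus.
Context {R : realType}.
Local Notation C := R[i].
Implicit Types (x y t M : R).

(** The criterion by which integrals, limits and slices are differentiated: a quadratic remainder is
    an inequality, so it can be integrated, passed to a limit or pushed through an operator. *)
Lemma is_derive_quadratic (f : R -> R) x d M :
  (forall t, `|f (x + t) - f x - t * d| <= M * t ^+ 2) -> is_derive x 1 f d.
Proof.
move=> H.
have M0 : 0 <= M by have := H 1; rewrite expr1n mulr1; apply: le_trans.
have cv : h^-1 *: (f (h *: 1 + x) - f x) @[h --> 0^'] --> d.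
  apply/cvgrPdist_le => e e0; near=> h.
  have h0 : h != 0 by near: h; exact: nbhs_dnbhs_neq.
  have hn : 0 < `|h| by rewrite normr_gt0.
  rewrite -(ler_pM2l hn) -normrM.
  have -> : h * (d - h^-1 *: (f (h *: 1 + x) - f x)) =
      - (f (x + h) - f x - h * d).
    by rewrite [h *: 1]mulr1 [h + x]addrC mulrBr mulVKf// opprB addrC -opprB opprB addrC; ring.
  rewrite normrN (le_trans (H h))// -real_normK ?num_real// expr2 mulrCA.
  rewrite ler_wpM2l// (@le_trans _ _ ((M + 1) * `|h|))//.
    by rewrite ler_wpM2r// lerDl.
  rewrite mulrC -ler_pdivlMr ?ltr_wpDl//.
  near: h; apply: dnbhs0_le; rewrite divr_gt0// ltr_wpDl//.
split; first by apply/cvg_ex; exists d.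
by apply: cvg_lim => //; exact: norm_hausdorff.
Unshelve. all: by end_near. Qed.

Lemma cderive_quadratic (f : R -> C) x d M :
  (forall t, normc (f (x + t) - f x - t%:C%C * d) <= M * t ^+ 2) ->
  cderivable f x /\ cderive f x = d.
Proof.
move=> H.
have r : is_derive x 1 (@complex.Re R \o f) (complex.Re d).
  apply: (@is_derive_quadratic _ _ _ M) => t; apply: le_trans (H t).
  by apply: le_trans (Re_le_normc _); rewrite !ReB ReMr.
have i : is_derive x 1 (@complex.Im R \o f) (complex.Im d).
  apply: (@is_derive_quadratic _ _ _ M) => t; apply: le_trans (H t).
  by apply: le_trans (Im_le_normc _); rewrite !ImB ImMr.
split; first by split; [case: r|case: i].
rewrite /cderive !derive1E (@derive_val _ _ _ _ _ _ _ r).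
by rewrite (@derive_val _ _ _ _ _ _ _ i); case: (d).
Qed.

Lemma real_lipschitz (f g : R -> R) M :
  (forall x, is_derive x 1 f (g x)) -> (forall x, `|g x| <= M) ->
  forall x y, `|f y - f x| <= M * `|y - x|.
Proof.
move=> fg gM x y; wlog xy : x y / x <= y.
  move=> H; have [|/ltW] := leP x y; first exact: H.
  by move=> yx; rewrite distrC [`|y - x|]distrC; exact: H.
have [c _ ->] : exists2 c, c \in `[x, y]%R & f y - f x = g c * (y - x).
  apply: MVT_segment => //; apply: continuous_subspaceT => z.
  by apply: differentiable_continuous; apply/derivable1_diffP; case: (fg z).
by rewrite normrM ler_wpM2r.
Qed.

(** One use of the mean value theorem: the increment is t g(c) with |c - x| <= |t|, and the
    Lipschitz bound compares g(c) with g(x). The second derivative itself does not appear. *)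
Lemma real_taylor (f g : R -> R) M :
  (forall x, is_derive x 1 f (g x)) ->
  (forall x y, `|g y - g x| <= M * `|y - x|) ->
  forall x t, `|f (x + t) - f x - t * g x| <= M * t ^+ 2.
Proof.
move=> fg gM x t.
have M0 : 0 <= M by have := gM 0 1; rewrite subr0 normr1 mulr1; apply: le_trans.
have key a b : a <= b -> exists2 c, c \in `[a, b]%R & f b - f a = g c * (b - a).
  move=> ab; apply: MVT_segment => //; apply: continuous_subspaceT => z.
  by apply: differentiable_continuous; apply/derivable1_diffP; case: (fg z).
have [c cE cx] : exists2 c, f (x + t) - f x = g c * t & `|c - x| <= `|t|.
  have [t0|/ltW t0] := leP 0 t.
    have [|c] := key x (x + t); first by rewrite lerDl.
    rewrite in_itv/= => /andP[xc ct] cE; exists c; first by rewrite cE; congr *%R; ring.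
    by rewrite !ger0_norm ?subr_ge0// lerBlDl.
  have [|c] := key (x + t) x; first by rewrite gerDl.
  rewrite in_itv/= => /andP[xc ct] cE; exists c.
    by rewrite -opprB cE; ring.
  by rewrite !ler0_norm ?subr_le0// lerN2 lerBrDl.
rewrite cE [t * _]mulrC -mulrBl normrM (le_trans (ler_wpM2r _ (gM _ _)))//.
by rewrite -mulrA ler_wpM2l// -real_normK ?num_real// expr2 ler_wpM2r.
Qed.

Lemma cderivable_is_derive (f : R -> C) x : cderivable f x ->
  is_derive x 1 (@complex.Re R \o f) (complex.Re (cderive f x)) /\
  is_derive x 1 (@complex.Im R \o f) (complex.Im (cderive f x)).
Proof.
move=> [r i]; split; rewrite /cderive /= derive1E; exact/derivableP.
Qed.

(** The mean value theorem fails for complex values, so it is applied to the real and imaginary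
    parts; hence the factor 2. *)
Lemma clipschitz (f : R -> C) M :
  (forall x, cderivable f x) -> (forall x, normc (cderive f x) <= M) ->
  forall x y, normc (f y - f x) <= 2 * M * `|y - x|.
Proof.
move=> df fM x y; rewrite (le_trans (normc_le _))// -mulrA mulr2n mulrDl mul1r.
apply: lerD; rewrite ?ReB ?ImB.
  apply: (@real_lipschitz (@complex.Re R \o f) (@complex.Re R \o cderive f)) => z.
    by have [] := cderivable_is_derive (df z).
  exact: le_trans (Re_le_normc _) (fM z).
apply: (@real_lipschitz (@complex.Im R \o f) (@complex.Im R \o cderive f)) => z.
  by have [] := cderivable_is_derive (df z).
exact: le_trans (Im_le_normc _) (fM z).
Qed.

(** The factor 4 is 2 from the Lipschitz bound on the derivative times 2 from adding the real and
    imaginary remainders. *)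
Lemma ctaylor (f : R -> C) M :
  (forall x, cderivable f x) -> (forall x, cderivable (cderive f) x) ->
  (forall x, normc (cderive (cderive f) x) <= M) ->
  forall x t, normc (f (x + t) - f x - t%:C%C * cderive f x) <= 4 * M * t ^+ 2.
Proof.
move=> df ddf fM x t; have L := clipschitz ddf fM.
rewrite (le_trans (normc_le _))// !ReB ReMr !ImB ImMr.
rewrite (_ : 4 * M * t ^+ 2 = 2 * M * t ^+ 2 + 2 * M * t ^+ 2); last by ring.
apply: lerD.
  apply: (@real_taylor (@complex.Re R \o f) (@complex.Re R \o cderive f)).
    by move=> z; have [] := cderivable_is_derive (df z).
  move=> y z; apply: le_trans (L y z).
  by rewrite -[X in `|X|]ReB Re_le_normc.
apply: (@real_taylor (@complex.Im R \o f) (@complex.Im R \o cderive f)).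
  by move=> z; have [] := cderivable_is_derive (df z).
move=> y z; apply: le_trans (L y z).
by rewrite -[X in `|X|]ImB Im_le_normc.
Qed.

Lemma cderivable_expi x : cderivable (@expi R) x.
Proof. by split; rewrite /comp/=; [exact: derivable_cos|exact: derivable_sin]. Qed.

Lemma cderive_expi : cderive (@expi R) = fun x => 'i%C * expi x.
Proof.
apply/funext => x; rewrite /cderive /comp/= !derive1E.
rewrite (@derive_val _ _ _ _ _ _ _ (is_derive_cos x)).
rewrite (@derive_val _ _ _ _ _ _ _ (is_derive_sin x)).
by apply/eqP; rewrite eq_complex /=; apply/andP; split; apply/eqP; ring.
Qed.

Lemma normc_i : normc ('i%C : C) = 1.
Proof. by rewrite /normc /= expr0n add0r expr1n sqrtr1. Qed.

Lemma normc_expiB x y : normc (expi y - expi x : C) <= 2 * `|y - x|.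
Proof.
rewrite -[2]mulr1; apply: clipschitz => z; first exact: cderivable_expi.
by rewrite cderive_expi normcM normc_i normc_expi mulr1.
Qed.

Lemma normc_expi_taylor x t :
  normc (expi (x + t) - expi x - t%:C%C * ('i%C * expi x) : C) <= 4 * t ^+ 2.
Proof.
rewrite -[4]mulr1 -[_ * expi x]/((fun y => 'i%C * expi y) x) -cderive_expi; apply: ctaylor =>
    z; first exact: cderivable_expi.
  rewrite cderive_expi; have := (is_cderiveP 'i%C (cderivable_expi z) (cderivable0 z)).1.
  by rewrite addr0.
rewrite cderive_expi; have := (is_cderiveP 'i%C (cderivable_expi z) (cderivable0 z)).2.
rewrite addr0 => ->; rewrite [cderive 0]cderive0 addr0 cderive_expi.
by rewrite !normcM normc_i normc_expi !mulr1.
Qed.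

End quadratic_calculus.

(** * Membership in the Schwartz spaces *)

Section schwartz_criteria.
Context {R : realType}.
Local Notation C := R[i].
Implicit Types (x y t M : R).

Lemma cderivableM (f g : R -> C) x : cderivable f x -> cderivable g x ->
  cderivable (f * g) x /\
  cderive (f * g) x = f x * cderive g x + g x * cderive f x.
Proof.
move=> /[dup] [[/derivableP f1 /derivableP f2] _].
move=> /[dup] [[/derivableP g1 /derivableP g2] _].
pose r := (@complex.Re R \o f : R -> R) * (@complex.Re R \o g : R -> R)
   - (@complex.Im R \o f : R -> R) * (@complex.Im R \o g : R -> R).
pose i := (@complex.Re R \o f : R -> R) * (@complex.Im R \o g : R -> R)
   + (@complex.Im R \o f : R -> R) * (@complex.Re R \o g : R -> R).
have rE : @complex.Re R \o (f * g) = r.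
  by apply/funext => y; rewrite /r /= -[(f * g) y]/(f y * g y) -![(_ - _) y]/(_ y - _ y) -![((_
      \o f) * _) y]/(_ y * _ y) /=; case: (f y) (g y) => ? ? [].
have iE : @complex.Im R \o (f * g) = i.
  by apply/funext => y; rewrite /i /= -[(f * g) y]/(f y * g y) -![(_ + _) y]/(_ y + _ y) -![((_
      \o f) * _) y]/(_ y * _ y) /=; case: (f y) (g y) => ? ? [].
have dr := is_deriveB (is_deriveM f1 g1) (is_deriveM f2 g2) : is_derive x 1 r _.
have di := is_deriveD (is_deriveM f1 g2) (is_deriveM f2 g1) : is_derive x 1 i _.
split; first by split; [rewrite rE; case: dr|rewrite iE; case: di].
rewrite /cderive rE iE !derive1E.
rewrite (@derive_val _ _ _ _ _ _ _ dr) (@derive_val _ _ _ _ _ _ _ di).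
rewrite -!derive1E; clear; move: (derive1 _ x) (derive1 _ x) (derive1 _ x) (derive1 _ x) => p q
    r s.
rewrite /comp; case: (f x) (g x) => a b [c d].
apply/eqP; rewrite eq_complex /=.
apply/andP; split; apply/eqP.
  by change (a * s + c * r - (b * q + d * p) = a * s - b * q + (c * r - d * p)); ring.
by change (a * q + d * r + (b * s + c * p) = a * q + b * s + (c * p + d * r)); ring.
Qed.

Lemma cderivable_id x : cderivable (fun y => y%:C%C : C) x /\
  cderive (fun y => y%:C%C : C) x = 1.
Proof.
apply: (@cderive_quadratic _ _ _ _ 0) => t.
by rewrite mulr1 -!rmorphB/= [x + t]addrC addrK subrr normc0 mul0r.
Qed.

Lemma cderivable_cst (a : C) x : cderivable (fun=> a) x /\
  cderive (fun=> a) x = 0.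
Proof.
apply: (@cderive_quadratic _ _ _ _ 0) => t.
by rewrite subrr mulr0 subr0 normc0 mul0r.
Qed.

Definition toS1 (f : R -> C) : S1 R := insubd 0 f.

Lemma val_toS1 f : schwartz1 f -> val (toS1 f) = f.
Proof. by move=> fS; rewrite val_insubd; case: ifPn => //; rewrite notin_setE. Qed.

Lemma val_toS2 (f : R * R -> C) : schwartz2 f -> val (toS2 f) = f.
Proof. by move=> fS; rewrite val_insubd; case: ifPn => //; rewrite notin_setE. Qed.

#[local] Opaque toS1 toS2.

Lemma S1P (f : S1 R) : schwartz1 (val f).
Proof. by have := valP f; rewrite inE. Qed.

Lemma S2P (f : S2 R) : schwartz2 (val f).
Proof. by have := valP f; rewrite inE. Qed.

Lemma S1_bound (f : S1 R) k m x :
  normc ((x ^+ k)%:C%C * iter m cderive (val f) x) <= snorm1 (k, m) f.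
Proof. exact: (supnorm_ge x ((S1P f).2 (k, m))). Qed.

Lemma S2_bound (f : S2 R) k l s u :
  normc ((u.1 ^+ k * u.2 ^+ l)%:C%C * pderives s (val f) u) <=
  snorm2 (k, l, s) f.
Proof. exact: (supnorm_ge u ((S2P f).2 (k, l, s))). Qed.

Lemma supnorm_le (T : pointedType) (f : T -> C) M :
  (forall x : T, normc (f x) <= M) -> supnorm f <= M.
Proof.
move=> fM; apply: ge_sup; first by exists (normc (f point)), point.
by move=> _ [x _ <-].
Qed.

(* Coinduction: membership only requires one derivative at a time. *)
Lemma schwartz1_coind (P : set (R -> C)) :
  (forall f, P f -> forall k, exists M, forall x,
    normc ((x ^+ k)%:C%C * f x) <= M) ->
  (forall f, P f -> exists2 g, P g & forall x,
    cderivable f x /\ cderive f x = g x) ->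
  P `<=` schwartz1.
Proof.
move=> Pb Pd f Pf; have Pm m : P (iter m cderive f).
  elim: m => //= m /Pd[g Pg H]; rewrite (_ : cderive _ = g)//.
  by apply/funext => x; exact: (H x).2.
split=> [m x|[k m]].
  by have [g _ /(_ x)[]] := Pd _ (Pm m).
by have [M H] := Pb _ (Pm m) k; exists M => _ [x _ <-]; exact: H.
Qed.

Definition coord (d : bool) (u : R * R) : R := if d then u.2 else u.1.

Definition line (d : bool) (u : R * R) t : R * R :=
  if d then (u.1, t) else (t, u.2).

Definition shift (d : bool) (u : R * R) t : R * R :=
  line d u (coord d u + t).

Lemma line_coord d u : line d u (coord d u) = u.
Proof. by case: u; case: d. Qed.

Lemma coord_line d u t : coord d (line d u t) = t.
Proof. by case: d. Qed.

Lemma coordN_line d u t : coord (~~ d) (line d u t) = coord (~~ d) u.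
Proof. by case: d. Qed.

Lemma pderivableE d (f : R * R -> C) u :
  pderivable d f u = cderivable (fun t => f (line d u t)) (coord d u).
Proof. by case: d. Qed.

Lemma pderiveE d (f : R * R -> C) u :
  pderive d f u = cderive (fun t => f (line d u t)) (coord d u).
Proof. by case: d. Qed.

Lemma pderivable_line d (f : R * R -> C) u t :
  pderivable d f (line d u t) = cderivable (fun t => f (line d u t)) t.
Proof. by case: d. Qed.

Lemma pderive_line d (f : R * R -> C) u t :
  pderive d f (line d u t) = cderive (fun t => f (line d u t)) t.
Proof. by case: d. Qed.

Lemma pderive_quadratic d (f : R * R -> C) u (a : C) M :
  (forall t, normc (f (shift d u t) - f u - t%:C%C * a) <= M * t ^+ 2) ->
  pderivable d f u /\ pderive d f u = a.
Proof.
rewrite pderivableE pderiveE => H; apply: (@cderive_quadratic _ _ _ _ M).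
by move=> t; rewrite [in X in _ - X - _](line_coord d u); exact: H.
Qed.

Lemma lipschitz_ccontinuous (f : R * R -> C) M :
  (forall u v, normc (f v - f u) <= M * (`|v.1 - u.1| + `|v.2 - u.2|)) ->
  ccontinuous f.
Proof.
move=> fM; have M0 : 0 <= M.
  have := fM (0, 0) (1, 0); rewrite /= !subr0 normr0 normr1 addr0 mulr1.
  by apply: le_trans; exact: normc_ge0.
suff H (g : R * R -> R) : (forall u v, `|g v - g u| <= normc (f v - f u)) ->
    continuous g.
  by split; apply: H => u v /=; rewrite -?ReB -?ImB ?Re_le_normc ?Im_le_normc.
move=> gf u; apply/cvgrPdist_le => e e0.
pose d := e / (M + M + 1).
have d0 : 0 < d by rewrite divr_gt0// ltr_wpDl ?addr_ge0.
exists (ball u.1 d, ball u.2 d); first by split; apply: nbhsx_ballx.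
move=> v [/= v1 v2]; rewrite distrC (le_trans (gf _ _))// (le_trans (fM _ _))//.
rewrite mulrDr (@le_trans _ _ (M * d + M * d))//.
  by rewrite lerD// ler_wpM2l// ltW// distrC; [exact: v1|exact: v2].
rewrite -mulrDl /d mulrCA ger_pMr// ler_pdivrMr ?ltr_wpDl ?addr_ge0//.
by rewrite mul1r lerDl.
Qed.

(** Bounded partial derivatives make f Lipschitz along the broken path from (a, b) through (a, d) to
    (c, d), which gives joint continuity. *)
Lemma pderive_ccontinuous (f g h : R * R -> C) M :
  (forall u, normc (g u) <= M) -> (forall u, normc (h u) <= M) ->
  (forall u, pderivable false f u /\ pderive false f u = g u) ->
  (forall u, pderivable true f u /\ pderive true f u = h u) ->
  ccontinuous f.
Proof.
move=> gM hM fg fh; apply: (@lipschitz_ccontinuous _ (2 * M)) => -[a b] [c d].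
rewrite -(subrKA (f (a, d))) (le_trans (le_normcD _ _))// mulrDr lerD//=.
  apply: (@clipschitz _ (fun t => f (t, d))) => t.
    exact: (fg (t, d)).1.
  by rewrite [cderive _ _](fg (t, d)).2.
apply: (@clipschitz _ (fun t => f (a, t))) => t; first exact: (fh (a, t)).1.
by rewrite [cderive _ _](fh (a, t)).2.
Qed.

(** The joint continuity required by [smooth2] is not asked of [P]: it follows from the boundedness,
    at weight 0, of the two first derivatives, which again lie in [P]. *)
Lemma schwartz2_coind (P : set (R * R -> C)) :
  (forall f, P f -> forall k l, exists M, forall u,
    normc ((u.1 ^+ k * u.2 ^+ l)%:C%C * f u) <= M) ->
  (forall f, P f -> forall d, exists2 g, P g & forall u,
    pderivable d f u /\ pderive d f u = g u) ->
  P `<=` schwartz2.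
Proof.
move=> Pb Pd f Pf; have Pm s : P (pderives s f).
  elim: s => //= d s /Pd-/(_ d)[g Pg H]; rewrite (_ : pderive _ _ = g)//.
  by apply/funext => x; exact: (H x).2.
split=> [s|[[k l] s]]; last first.
  by have [M H] := Pb _ (Pm s) k l; exists M => _ [x _ <-]; exact: H.
split; last by move=> d u; have [g _ /(_ u)[]] := Pd _ (Pm s) d.
have [g Pg Hg] := Pd _ (Pm s) false; have [h Ph Hh] := Pd _ (Pm s) true.
have [M1 HM1] := Pb _ Pg 0 0; have [M2 HM2] := Pb _ Ph 0 0.
apply: (@pderive_ccontinuous _ g h (Num.max M1 M2)) => // u.
  by have := HM1 u; rewrite !expr0 mul1r mul1r le_max => ->.
by have := HM2 u; rewrite !expr0 mul1r mul1r le_max => ->; rewrite orbT.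
Qed.

Lemma S1_derive (f : S1 R) : schwartz1 (cderive (val f)).
Proof.
have [fd fb] := S1P f; split=> [m x|[k m]]; first by rewrite -iterSr; exact: fd.
by rewrite /weighted1 /= -iterSr; exact: (fb (k, m.+1)).
Qed.

Definition D1 (f : S1 R) : S1 R := toS1 (cderive (val f)).

Lemma val_D1 f : val (D1 f) = cderive (val f).
Proof. exact/val_toS1/S1_derive. Qed.

Lemma S2_derive d (f : S2 R) : schwartz2 (pderive d (val f)).
Proof.
have [fd fb] := S2P f; split=> [s|[[k l] s]].
  (* The last letter of a word is the derivative taken first, so differentiating f beforehand
     appends a letter. *)
  by have := fd (rcons s d); rewrite /pderives foldr_rcons.
by have := fb (k, l, rcons s d); rewrite /weighted2 /pderives/= foldr_rcons.
Qed.

Definition D2 d (f : S2 R) : S2 R := toS2 (pderive d (val f)).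

Lemma val_D2 d f : val (D2 d f) = pderive d (val f).
Proof. exact/val_toS2/S2_derive. Qed.

#[local] Opaque D1 D2.

Lemma S2_pderives (f : S2 R) s : exists g : S2 R, val g = pderives s (val f).
Proof.
elim: s => [|d s [g gE]]; first by exists f.
by exists (D2 d g); rewrite val_D2 gE.
Qed.

Lemma S1_cderivable (f : S1 R) x : cderivable (val f) x.
Proof. exact: ((S1P f).1 0). Qed.

Lemma S2_pderivable (f : S2 R) d u : pderivable d (val f) u.
Proof. exact: ((S2P f).1 [::]).2. Qed.

Lemma snorm1_ge0 k f : 0 <= @snorm1 R k f.
Proof.
by case: k => k m; apply: le_trans (S1_bound f k m 0); exact: normc_ge0.
Qed.

Lemma snorm2_ge0 k f : 0 <= @snorm2 R k f.
Proof.
by case: k => -[k l] s; apply: le_trans (S2_bound f k l s 0); exact: normc_ge0.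
Qed.

Lemma S1_le (f : S1 R) x : normc (val f x) <= snorm1 (0, 0)%N f.
Proof. by have := S1_bound f 0 0 x; rewrite expr0 mul1r. Qed.

Lemma S2_le (f : S2 R) u : normc (val f u) <= snorm2 (0, 0, [::])%N f.
Proof. by have := S2_bound f 0 0 [::] u; rewrite !expr0 mul1r mul1r. Qed.

Lemma S1_taylor (f : S1 R) m x t :
  normc (iter m cderive (val f) (x + t) - iter m cderive (val f) x
         - t%:C%C * iter m.+1 cderive (val f) x)
  <= 4 * snorm1 (0, m.+2)%N f * t ^+ 2.
Proof.
apply: ctaylor => y; [exact: (S1P f).1|exact: ((S1P f).1 m.+1)|].
by have := S1_bound f 0 m.+2 y; rewrite expr0 mul1r.
Qed.

Lemma S1_lipschitz (f : S1 R) m x y :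
  normc (iter m cderive (val f) y - iter m cderive (val f) x)
  <= 2 * snorm1 (0, m.+1)%N f * `|y - x|.
Proof.
apply: clipschitz => z; first exact: (S1P f).1.
by have := S1_bound f 0 m.+1 z; rewrite expr0 mul1r.
Qed.

Lemma cderiveZl (a : C) (f : R -> C) x : cderivable f x ->
  cderivable (fun y => a * f y) x /\ cderive (fun y => a * f y) x = a * cderive f x.
Proof.
move=> df; have [] := is_cderiveP a df (cderivable0 x).
by rewrite addr0 [cderive 0]cderive0 addr0.
Qed.

(* Only powers of the coordinate which is not differentiated are allowed as
   weights in the next two lemmas. *)
Definition weightN (d : bool) (k : nat) : nat * nat := if d then (k, 0)%N else (0, k)%N.

Lemma weightN_bound (f : S2 R) d k s u :
  normc ((coord (~~ d) u ^+ k)%:C%C * pderives s (val f) u)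
    <= snorm2 (weightN d k, s)%N f.
Proof.
have := S2_bound f (weightN d k).1 (weightN d k).2 s u.
by case: d; rewrite expr0 ?mulr1 ?mul1r.
Qed.

(** The weight depends on the other coordinate only, so it is constant along the line and commutes
    with the derivative. This is why [weightN] excludes powers of the differentiated coordinate. *)
Lemma weighted_line (f : S2 R) d k s u t :
  let h := fun s t => (coord (~~ d) u ^+ k)%:C%C * pderives s (val f) (line d u t) in
  cderivable (h s) t /\ cderive (h s) t = h (d :: s) t.
Proof.
rewrite /= pderive_line; apply: cderiveZl; rewrite -pderivable_line.
by have [g <-] := S2_pderives f s; exact: S2_pderivable.
Qed.

Lemma S2_taylor (f : S2 R) d k s u t :
  normc ((coord (~~ d) u ^+ k)%:C%C * (pderives s (val f) (shift d u t)
     - pderives s (val f) u - t%:C%C * pderives (d :: s) (val f) u))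
  <= 4 * snorm2 (weightN d k, d :: d :: s)%N f * t ^+ 2.
Proof.
have H := @weighted_line f d k _ u.
pose h s t := (coord (~~ d) u ^+ k)%:C%C * pderives s (val f) (line d u t).
have hE : cderive (h s) = h (d :: s) by apply/funext => z; exact: (H s z).2.
rewrite !mulrBr mulrCA.
have := (H s (coord d u)).2; rewrite /= [in X in _ = X]line_coord => <-.
rewrite -[in X in _ - X - _](line_coord d u) coordN_line.
apply: (@ctaylor _ (h s)) => y; first exact: (H s y).1.
  by rewrite hE; exact: (H (d :: s) y).1.
rewrite hE (H (d :: s) y).2 -(coordN_line d u y); exact: weightN_bound.
Qed.

Lemma S2_lipschitz (f : S2 R) d k s u t :
  normc ((coord (~~ d) u ^+ k)%:C%C * (pderives s (val f) (shift d u t)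
     - pderives s (val f) u))
  <= 2 * snorm2 (weightN d k, d :: s)%N f * `|t|.
Proof.
have H := @weighted_line f d k _ u.
have -> : `|t| = `|coord d u + t - coord d u| by rewrite addrC addKr.
rewrite !mulrBr -[in X in normc (_ - X)](line_coord d u) coordN_line.
apply: (@clipschitz _ (fun t => (coord (~~ d) u ^+ k)%:C%C *
  pderives s (val f) (line d u t))) => y; first exact: (H s y).1.
by rewrite (H s y).2 -(coordN_line d u y); exact: weightN_bound.
Qed.

End schwartz_criteria.

(** * Integration of complex-valued functions *)

Section complex_integral.
Context {R : realType} {d} {T : measurableType d}.
Local Notation C := R[i].
Implicit Types (f g : T -> C) (mu : {measure set T -> \bar R}).

Definition cmeasurable f := measurable_fun setT (@complex.Re R \o f) /\
  measurable_fun setT (@complex.Im R \o f).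

Definition cintegrable mu f :=
  mu.-integrable setT (EFin \o (@complex.Re R \o f)) /\
  mu.-integrable setT (EFin \o (@complex.Im R \o f)).

Lemma cmeasurable_cst (a : C) : cmeasurable (fun=> a).
Proof. by split; exact: measurable_cst. Qed.

Lemma cmeasurableD f g : cmeasurable f -> cmeasurable g ->
  cmeasurable (fun x => f x + g x).
Proof.
move=> [f1 f2] [g1 g2]; split.
  rewrite (_ : _ \o _ = (@complex.Re R \o f) \+ (@complex.Re R \o g)).
    exact: measurable_funD.
  by apply/funext => x /=; case: (f x) (g x) => ? ? [].
rewrite (_ : _ \o _ = (@complex.Im R \o f) \+ (@complex.Im R \o g)).
  exact: measurable_funD.
by apply/funext => x /=; case: (f x) (g x) => ? ? [].
Qed.

Lemma cmeasurableM f g : cmeasurable f -> cmeasurable g ->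
  cmeasurable (fun x => f x * g x).
Proof.
move=> [f1 f2] [g1 g2]; split.
  rewrite (_ : _ \o _ = ((@complex.Re R \o f) \* (@complex.Re R \o g)) \-
    ((@complex.Im R \o f) \* (@complex.Im R \o g))).
    by apply: measurable_funB; exact: measurable_funM.
  by apply/funext => x /=; case: (f x) (g x) => ? ? [].
rewrite (_ : _ \o _ = ((@complex.Re R \o f) \* (@complex.Im R \o g)) \+
  ((@complex.Im R \o f) \* (@complex.Re R \o g))).
  by apply: measurable_funD; exact: measurable_funM.
by apply/funext => x /=; case: (f x) (g x) => ? ? [].
Qed.

Lemma cmeasurable_expi (h : T -> R) : measurable_fun setT h ->
  cmeasurable (fun x => expi (h x)).
Proof.
move=> mh; split; apply: (measurableT_comp (f := _)) => //.
  by apply: continuous_measurable_fun; exact: continuous_cos.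
by apply: continuous_measurable_fun; exact: continuous_sin.
Qed.

Lemma cintegrable_dominated mu f (h : T -> R) : cmeasurable f ->
  mu.-integrable setT (EFin \o h) -> (forall x, normc (f x) <= h x) ->
  cintegrable mu f.
Proof.
move=> [f1 f2] ih fh; split; apply: (le_integrable measurableT _ _ ih).
- exact/measurable_EFinP.
- move=> x _; rewrite /= lee_fin (le_trans (Re_le_normc _))// (le_trans (fh x))//.
  exact: ler_norm.
- exact/measurable_EFinP.
move=> x _; rewrite /= lee_fin (le_trans (Im_le_normc _))// (le_trans (fh x))//.
exact: ler_norm.
Qed.

(** The factor 2 again comes from treating the real and imaginary parts separately. *)
Lemma cintegral_le mu f (h : T -> R) : cmeasurable f ->
  mu.-integrable setT (EFin \o h) -> (forall x, normc (f x) <= h x) ->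
  normc (cintegral mu f) <= 2 * \int[mu]_x h x.
Proof.
move=> mf ih fh; have [f1 f2] := cintegrable_dominated mf ih fh.
rewrite (le_trans (normc_le _))// mulr2n mulrDl mul1r; apply: lerD.
  rewrite (le_trans (le_normr_Rintegral _ _))// le_Rintegral//=.
    exact: (integrable_norm f1).
  by move=> x _; rewrite (le_trans (Re_le_normc _)).
rewrite (le_trans (le_normr_Rintegral _ _))// le_Rintegral//=.
  exact: (integrable_norm f2).
by move=> x _; rewrite (le_trans (Im_le_normc _)).
Qed.

Lemma cintegral_lin mu (a : C) f g : cintegrable mu f -> cintegrable mu g ->
  cintegral mu (fun x => a * f x + g x) = a * cintegral mu f + cintegral mu g.
Proof.
move=> [f1 f2] [g1 g2].
have Z (c : R) (h : T -> R) : mu.-integrable setT (EFin \o h) ->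
    mu.-integrable setT (EFin \o (fun x => c * h x)).
  by move=> ih; exact: (integrableZl measurableT c ih).
have D (h k : T -> R) : mu.-integrable setT (EFin \o h) ->
    mu.-integrable setT (EFin \o k) ->
    mu.-integrable setT (EFin \o (fun x => h x + k x)).
  by move=> ih ik; exact: (integrableD measurableT ih ik).
have B (h k : T -> R) : mu.-integrable setT (EFin \o h) ->
    mu.-integrable setT (EFin \o k) ->
    mu.-integrable setT (EFin \o (fun x => h x - k x)).
  by move=> ih ik; exact: (integrableB measurableT ih ik).
apply/eqP; rewrite eq_complex ReD ImD /cintegral /=; apply/andP; split; apply/eqP.
  under eq_Rintegral do rewrite ReD.
  rewrite RintegralD ?RintegralB ?RintegralZl//; try exact: Z; try exact: B.
  by apply: B; exact: Z.
under eq_Rintegral do rewrite ImD.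
rewrite !RintegralD ?RintegralZl//; try exact: Z; by apply: D; exact: Z.
Qed.

Lemma cintegrable_lin mu (a : C) f g : cintegrable mu f -> cintegrable mu g ->
  cintegrable mu (fun x => a * f x + g x).
Proof.
move=> [f1 f2] [g1 g2].
have Z (c : R) (h : T -> R) : mu.-integrable setT (EFin \o h) ->
    mu.-integrable setT (EFin \o (fun x => c * h x)).
  by move=> ih; exact: (integrableZl measurableT c ih).
split.
  rewrite (_ : EFin \o _ = (((EFin \o (fun x => (complex.Re a * complex.Re (f x))%R)) \-
     (EFin \o (fun x => (complex.Im a * complex.Im (f x))%R))) \+ (EFin \o (@complex.Re R \o
         g)))%E).
    by apply: integrableD => //; apply: integrableB => //; exact: Z.
  by apply/funext => x /=; rewrite ReD.
rewrite (_ : EFin \o _ = (((EFin \o (fun x => (complex.Re a * complex.Im (f x))%R)) \+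
   (EFin \o (fun x => (complex.Im a * complex.Re (f x))%R))) \+ (EFin \o (@complex.Im R \o
       g)))%E).
  by apply: integrableD => //; apply: integrableD => //; exact: Z.
by apply/funext => x /=; rewrite ImD.
Qed.

Lemma cintegrable0 mu : cintegrable mu (fun=> 0).
Proof. by split; rewrite (_ : _ \o _ = cst 0%E) //; exact: integrable0. Qed.

Lemma cintegral0 mu : cintegral mu (fun=> 0 : C) = 0.
Proof. by rewrite /cintegral /= !Rintegral_cst//= !mul0r. Qed.

Lemma cintegralZ mu (a : C) f : cintegrable mu f ->
  cintegral mu (fun x => a * f x) = a * cintegral mu f.
Proof.
move=> fi; have := cintegral_lin a fi (cintegrable0 mu).
by rewrite cintegral0 addr0; under eq_fun do rewrite addr0.
Qed.

Lemma cintegralD mu f g : cintegrable mu f -> cintegrable mu g ->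
  cintegral mu (fun x => f x + g x) = cintegral mu f + cintegral mu g.
Proof.
move=> fi gi; have := cintegral_lin 1 fi gi.
by rewrite mul1r; under eq_fun do rewrite mul1r.
Qed.

Lemma cintegrableZ mu (a : C) f : cintegrable mu f ->
  cintegrable mu (fun x => a * f x).
Proof.
move=> fi; have := cintegrable_lin a fi (cintegrable0 mu).
by under eq_fun do rewrite addr0.
Qed.

Lemma cintegralB mu f g : cintegrable mu f -> cintegrable mu g ->
  cintegral mu (fun x => f x - g x) = cintegral mu f - cintegral mu g.
Proof.
move=> fi gi; have := cintegral_lin (-1) gi fi; rewrite mulN1r addrC => <-.
by congr cintegral; apply/funext => x; rewrite mulN1r addrC.
Qed.

End complex_integral.

Lemma cmeasurable_comp {R : realType} d d' (T : measurableType d)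
    (U : measurableType d') (f : U -> R[i]) (h : T -> U) :
  cmeasurable f -> measurable_fun setT h -> cmeasurable (fun x => f (h x)).
Proof. by move=> [f1 f2] mh; split; [exact: measurableT_comp f1 mh|exact: measurableT_comp f2
    mh]. Qed.

Section complex_fubini.
Context {R : realType} d1 d2 (T1 : measurableType d1) (T2 : measurableType d2).
Variables (m1 : {sigma_finite_measure set T1 -> \bar R}).
Variables (m2 : {sigma_finite_measure set T2 -> \bar R}).
Variables (f : T1 * T2 -> R[i]) (a : T1 -> R) (b : T2 -> R).
Hypothesis mf : cmeasurable f.
Hypothesis ia : m1.-integrable setT (EFin \o a).
Hypothesis ib : m2.-integrable setT (EFin \o b).
Hypothesis fab : forall x y, normc (f (x, y)) <= a x * b y.

Lemma integrable_prod : (m1 \x m2)%E.-integrable setT (EFin \o (fun u => a u.1 * b u.2)).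
Proof.
have ma : measurable_fun setT a by apply/measurable_EFinP; exact: measurable_int ia.
have mb : measurable_fun setT b by apply/measurable_EFinP; exact: measurable_int ib.
apply/integrable12ltyP.
  apply/measurable_EFinP/measurable_funM; exact: measurableT_comp.
rewrite [ltLHS](_ : _ = \int[m1]_x (`|a x|%:E * \int[m2]_y `|b y|%:E))%E; last first.
  apply: eq_integral => x _ /=.
  rewrite -ge0_integralZl//; last first.
    by apply/measurable_EFinP; exact: measurableT_comp.
  by apply: eq_integral => y _; rewrite normrM EFinM.
rewrite ge0_integralZr//; last 2 first.
  by apply/measurable_EFinP; exact: measurableT_comp.
  by apply: integral_ge0 => y _; rewrite lee_fin.
have /integrableP[_ ia'] := ia; have /integrableP[_ ib'] := ib.
rewrite lte_mul_pinfty//; first by apply: integral_ge0 => y _; rewrite lee_fin.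
by rewrite ge0_fin_numE//; apply: integral_ge0 => y _; rewrite lee_fin.
Qed.

Lemma cintegrable_prod : cintegrable (m1 \x m2)%E f.
Proof.
apply: (cintegrable_dominated mf integrable_prod) => -[x y]; exact: fab.
Qed.

Lemma cintegrable_section2 x : cintegrable m2 (fun y => f (x, y)).
Proof.
apply: (@cintegrable_dominated _ _ _ _ _ (fun y => a x * b y)) => //.
  exact: cmeasurable_comp mf (pair1_measurable x).
exact: (integrableZl measurableT (a x) ib).
Qed.

Lemma cintegrable_section1 y : cintegrable m1 (fun x => f (x, y)).
Proof.
apply: (@cintegrable_dominated _ _ _ _ _ (fun x => b y * a x)) => //.
- exact: cmeasurable_comp mf (pair2_measurable y).
- exact: (integrableZl measurableT (b y) ia).
- by move=> x; rewrite mulrC.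
Qed.

(** The product majorant makes every section integrable, not merely almost every one, so the
    real-valued inner integral agrees at every point with the extended one in Fubini's theorem. *)
Lemma cintegrable_fubini1 :
  cintegrable m1 (fun x => cintegral m2 (fun y => f (x, y))).
Proof.
have [i1 i2] := cintegrable_prod.
have E (g : T1 * T2 -> R) : (forall x, m2.-integrable setT (EFin \o (fun y => g (x, y)))) ->
    (m1 \x m2)%E.-integrable setT (EFin \o g) ->
    m1.-integrable setT (EFin \o (fun x => \int[m2]_y g (x, y))).
  move=> gi ig; have := integrable_fubini_F ig; congr (m1.-integrable setT _).
  by apply/funext => x; rewrite /fubini_F/= /Rintegral fineK//; exact: integrable_fin_num (gi x).
split.
  exact: (E (@complex.Re R \o f) (fun x => (cintegrable_section2 x).1) i1).
exact: (E (@complex.Im R \o f) (fun x => (cintegrable_section2 x).2) i2).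
Qed.

Lemma cfubini1 : cintegral (m1 \x m2)%E f =
  cintegral m1 (fun x => cintegral m2 (fun y => f (x, y))).
Proof.
have [i1 i2] := cintegrable_prod.
have E (g : T1 * T2 -> R) : (forall x, m2.-integrable setT (EFin \o (fun y => g (x, y)))) ->
    (m1 \x m2)%E.-integrable setT (EFin \o g) ->
    \int[(m1 \x m2)%E]_u g u = \int[m1]_x \int[m2]_y g (x, y).
  move=> gi ig; rewrite {1 2}/Rintegral -(integral12_prod_meas1 ig); congr fine.
  apply: eq_integral => x _; rewrite /fubini_F/= /Rintegral fineK//.
  exact: integrable_fin_num (gi x).
by congr Complex; apply: E => // x; have [] := cintegrable_section2 x.
Qed.

Lemma cfubini2 : cintegral (m1 \x m2)%E f =
  cintegral m2 (fun y => cintegral m1 (fun x => f (x, y))).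
Proof.
have [i1 i2] := cintegrable_prod.
have E (g : T1 * T2 -> R) : (forall y, m1.-integrable setT (EFin \o (fun x => g (x, y)))) ->
    (m1 \x m2)%E.-integrable setT (EFin \o g) ->
    \int[(m1 \x m2)%E]_u g u = \int[m2]_y \int[m1]_x g (x, y).
  move=> gi ig; rewrite {1 2}/Rintegral -(integral21_prod_meas1 ig); congr fine.
  apply: eq_integral => x _; rewrite /fubini_G/= /Rintegral fineK//.
  exact: integrable_fin_num (gi x).
by congr Complex; apply: E => // x; have [] := cintegrable_section1 x.
Qed.

Lemma cfubini : cintegral m1 (fun x => cintegral m2 (fun y => f (x, y))) =
  cintegral m2 (fun y => cintegral m1 (fun x => f (x, y))).
Proof. by rewrite -cfubini1 cfubini2. Qed.

End complex_fubini.

(** * Measurability, the integrable weight and affine substitutions *)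

Section lebesgue_facts.
Context {R : realType}.
Local Notation C := R[i].
Local Notation mu := (@lebesgue_measure R).
Local Notation Rm := (measurableTypeR R).
Local Notation cmeasurable1 f := (@cmeasurable R _ Rm f).
Local Notation cmeasurable2 f := (@cmeasurable R _ (Rm * Rm)%type f).

(** The sigma-algebra of the product is generated by rectangles, so an open set is written as the
    countable union of the open rational boxes it contains; boxes not contained in [U] contribute
    the empty set. *)
Lemma open_prod_measurable (U : set (R * R)) : open U ->
  measurable (U : set (Rm * Rm)).
Proof.
move=> oU.
pose box (a b c e : rat) : set (Rm * Rm) :=
  `]ratr a, ratr b[%classic `*` `]ratr c, ratr e[%classic.
have -> : U = \bigcup_(a : rat) \bigcup_(b : rat) \bigcup_(c : rat) \bigcup_(e : rat)
    (if `[< box a b c e `<=` U >] then box a b c e else set0).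
  apply/seteqP; split=> [[x y] Uxy|u [a _ [b _ [c _ [e _]]]]]; last first.
    by case: asboolP => // s /s.
  have : nbhs (x, y) U by exact: open_nbhs_nbhs.
  move=> [[A B] [/= /nbhs_ballP[r r0 rA] /nbhs_ballP[s s0 sB]] ABU].
  have [|a] := rat_in_itvoo (_ : x - r < x); first by rewrite ltrBlDr ltrDl.
  rewrite in_itv/= => /andP[xa ax].
  have [|b] := rat_in_itvoo (_ : x < x + r); first by rewrite ltrDl.
  rewrite in_itv/= => /andP[xb bx].
  have [|c] := rat_in_itvoo (_ : y - s < y); first by rewrite ltrBlDr ltrDl.
  rewrite in_itv/= => /andP[yc cy].
  have [|e] := rat_in_itvoo (_ : y < y + s); first by rewrite ltrDl.
  rewrite in_itv/= => /andP[ye ey].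
  exists a => //; exists b => //; exists c => //; exists e => //.
  case: asboolP => [_|[]]; first by split => /=; rewrite in_itv/= ?ax ?cy ?xb ?ye.
  move=> [p q] [/=]; rewrite !in_itv/= => /andP[p1 p2] /andP[q1 q2].
  apply: (ABU (p, q)); split => /=.
    apply: rA; rewrite /ball/= ltr_distlC; apply/andP; split; lra.
  apply: sB; rewrite /ball/= ltr_distlC; apply/andP; split; lra.
do 4! (apply: bigcupT_measurable_rat => ?).
by case: asboolP => // _; apply: measurableX; exact: measurable_itv.
Qed.

Lemma ccontinuous_cmeasurable (f : R * R -> C) : ccontinuous f -> cmeasurable2 f.
Proof.
have H (g : R * R -> R) : continuous g -> measurable_fun setT (g : Rm * Rm -> R).
  move=> /continuousP cg; apply: (measurability _ (RGenOpens.measurableE R)).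
  move=> _ [_ [a [b ->] <-]]; rewrite setTI; apply: open_prod_measurable.
  by apply: cg; exact: interval_open.
by move=> [c1 c2]; split; exact: H.
Qed.

Lemma cmeasurable_S2 (f : S2 R) : cmeasurable2 (val f).
Proof. exact/ccontinuous_cmeasurable/((S2P f).1 [::]).1. Qed.

Lemma cderivable_cmeasurable (f : R -> C) : (forall x, cderivable f x) -> cmeasurable1 f.
Proof.
have H (g : R -> R) : (forall x, derivable g x 1) -> measurable_fun setT (g : Rm -> R).
  move=> dg; have := @continuous_measurable_fun R g; apply => x.
  by apply: differentiable_continuous; apply/derivable1_diffP.
by move=> df; split; apply: H => x; case: (df x).
Qed.

Lemma cmeasurable_S1 (f : S1 R) : cmeasurable1 (val f).
Proof. by apply: cderivable_cmeasurable; exact: S1_cderivable. Qed.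

(** The common integrable majorant: a bound on a and one on x^2 a give a bound of a by a multiple of
    [wt x], so two seminorms always suffice for integrability. *)
Definition wt (x : R) : R := (1 + x ^+ 2)^-1.

Lemma oneD_gt0 (x : R) : 0 < 1 + x ^+ 2.
Proof. by rewrite ltr_pwDl// sqr_ge0. Qed.

Lemma wt_gt0 x : 0 < wt x.
Proof. by rewrite invr_gt0 oneD_gt0. Qed.

Lemma integrable_wt : mu.-integrable setT (EFin \o wt).
Proof.
have cw : continuous wt by exact: continuous_oneDsqrV.
have mw : measurable_fun setT (wt : Rm -> R) by exact: continuous_measurable_fun.
apply/integrableP; split; first exact/measurable_EFinP.
under eq_integral do rewrite /= ger0_norm ?(ltW (wt_gt0 _))//.
rewrite ge0_symfun_integralT//=.
- rewrite (_ : [set x | _] = `[0, +oo[%classic); last first.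
    by apply/seteqP; split => x/=; rewrite in_itv/= andbT.
  have -> : (\int[mu]_(x in `[0%R, +oo[) (wt x)%:E = (pi / 2)%:E)%E.
    exact: integral0y_oneDsqr.
  by rewrite -EFinM ltry.
- by move=> x; exact/ltW/wt_gt0.
- by move=> x/=; rewrite /wt sqrrN.
Qed.

Definition wtI : R := \int[mu]_x wt x.

Lemma wtI_ge0 : 0 <= wtI.
Proof. by apply: Rintegral_ge0 => x _; exact/ltW/wt_gt0. Qed.

Lemma integrable_wtZ (M : R) : mu.-integrable setT (EFin \o (fun x => M * wt x)).
Proof. exact: (integrableZl measurableT M integrable_wt). Qed.

Lemma cintegrable_wt (f : R -> C) M : cmeasurable1 f ->
  (forall x, normc (f x) <= M * wt x) -> cintegrable mu f.
Proof. by move=> mf; apply: (cintegrable_dominated mf (integrable_wtZ M)). Qed.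

Lemma cintegral_wt (f : R -> C) M : cmeasurable1 f ->
  (forall x, normc (f x) <= M * wt x) ->
  normc (cintegral mu f) <= 2 * wtI * M.
Proof.
move=> mf fM; have := cintegral_le mf (integrable_wtZ M) fM.
by rewrite RintegralZl//; [rewrite mulrA mulrAC|exact: integrable_wt].
Qed.

Section affine.
Variables (a b : R) (a0 : 0 < a).
Let phi : Rm -> Rm := fun x => a * x + b.

Let mphi : measurable_fun setT phi.
Proof. by apply: measurable_funD => //; exact: measurable_funM. Qed.

Let pmu : {measure set Rm -> \bar R} :=
  measure_function_pushforward__canonical__measure_function_Measure mu mphi.

(** Uniqueness of Lebesgue measure: a times the pushforward under x |-> a x + b agrees with it on
    half-open intervals. *)
Lemma lebesgue_measure_affine (A : set Rm) : measurable A ->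
  mu A = mscale (NngNum (ltW a0)) pmu A.
Proof.
move=> mA; apply: lebesgue_measure_unique => //= _ [[u v]] _ <-.
rewrite /mscale/= /pmu/= /pushforward/=.
have -> : phi @^-1` `]u, v] = `](u - b) / a, (v - b) / a]%classic.
  apply/seteqP; split => x /=; rewrite !in_itv/= ltr_pdivrMr// ler_pdivlMr//;
  by rewrite ltrBlDr lerBrDr mulrC.
rewrite !lebesgue_measure_itv/= !lte_fin ltr_pM2r ?invr_gt0// ltrD2r.
case: ifPn => // uv; last by rewrite mule0.
rewrite -!EFinD -EFinM; congr EFin.
by rewrite -mulrBl mulrC mulfVK ?gt_eqF//; ring.
Qed.

Lemma ge0_integral_affine (f : Rm -> \bar R) : measurable_fun setT f ->
  (forall x, 0 <= f x)%E ->
  (\int[mu]_x f (a * x + b)%R = (a^-1)%:E * \int[mu]_x f x)%E.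
Proof.
move=> mf f0; rewrite [in RHS](@eq_measure_integral _ _ _ _
  (mscale (NngNum (ltW a0)) pmu)); last first.
  by move=> A mA _; exact: lebesgue_measure_affine.
rewrite ge0_integral_mscale//= /pmu ge0_integral_pushforward//=.
by rewrite muleA -EFinM mulVf ?gt_eqF// mul1e.
Qed.

Lemma integrable_affine (f : Rm -> \bar R) : mu.-integrable setT f ->
  mu.-integrable setT (fun x : Rm => f (a * x + b)).
Proof.
move=> /integrableP[mf fi]; apply/integrableP; split.
  exact: measurableT_comp mf mphi.
have := @ge0_integral_affine (abse \o f); rewrite /= => ->//; last first.
  exact: measurableT_comp.
by rewrite lte_mul_pinfty// lee_fin invr_ge0 ltW.
Qed.

Lemma Rintegral_affine (f : Rm -> R) : mu.-integrable setT (EFin \o f) ->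
  \int[mu]_x f (a * x + b) = a^-1 * \int[mu]_x f x.
Proof.
move=> fi; have mf := measurable_int _ fi.
have -> : a^-1 = fine (a^-1)%:E by [].
rewrite /Rintegral -fineM//; last exact: integrable_fin_num.
congr fine; rewrite [in RHS]integralE muleBr//; last first.
  by apply: fin_num_adde_defl; rewrite fin_numN integrable_neg_fin_num.
rewrite [LHS]integralE.
rewrite -(ge0_integral_affine (measurable_funepos mf))//.
rewrite -(ge0_integral_affine (measurable_funeneg mf))//.
by congr (_ - _)%E; apply: eq_integral => x _; rewrite ?funeposE ?funenegE.
Qed.

End affine.

Lemma cintegrable_affine (f : R -> C) (a b : R) : 0 < a -> cintegrable mu f ->
  cintegrable mu (fun x => f (a * x + b)).
Proof.
by move=> a0 [f1 f2]; split; [exact: integrable_affine f1|exact: integrable_affine f2].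
Qed.

Lemma cintegral_affine (f : R -> C) (a b : R) : 0 < a -> cintegrable mu f ->
  cintegral mu (fun x => f (a * x + b)) = (a^-1)%:C%C * cintegral mu f.
Proof.
move=> a0 [f1 f2]; apply/eqP; rewrite eq_complex ReMr ImMr /=.
by rewrite -!(@Rintegral_affine _ b a0)// !eqxx.
Qed.

Lemma cintegral_translation (f : R -> C) (b : R) : cintegrable mu f ->
  cintegral mu (fun x => f (x + b)) = cintegral mu f.
Proof.
move=> fi; have := @cintegral_affine f 1 b ltr01 fi.
by under eq_fun do rewrite mul1r; rewrite invr1 mul1r.
Qed.

End lebesgue_facts.

#[local] Opaque toS1 toS2 D1 D2.

(** * Operations on Schwartz functions *)

Section schwartz_operations.
Context {R : realType}.
Local Notation C := R[i].
Implicit Types (x y t M : R) (f g h : S2 R) (phi psi : S1 R).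

Lemma weight_normc k l (u : R * R) (a : C) :
  normc ((u.1 ^+ k * u.2 ^+ l)%:C%C * a) = `|u.1| ^+ k * `|u.2| ^+ l * normc a.
Proof. by rewrite normcMr normrM !normrX. Qed.

Lemma S2_weight_le f k l u :
  `|u.1| ^+ k * `|u.2| ^+ l * normc (val f u) <= snorm2 (k, l, [::]) f.
Proof. by rewrite -weight_normc; exact: (S2_bound f k l [::] u). Qed.

Lemma S1_weight_le phi k x :
  `|x| ^+ k * normc (val phi x) <= snorm1 (k, 0)%N phi.
Proof. by have := S1_bound phi k 0 x; rewrite normcMr normrX. Qed.

Lemma mulX_schwartz d f :
  schwartz2 (fun u => (coord d u)%:C%C * val f u).
Proof.
(* The products x_d g alone are not stable under differentiation; adding a free term h absorbs the g
   that Leibniz' rule produces. *)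
pose P := [set F : R * R -> C | exists g h,
  F = fun u => (coord d u)%:C%C * val g u + val h u].
suff : P `<=` schwartz2.
  apply; exists f, 0; apply/funext => u.
  by rewrite [val 0 u](_ : _ = 0) ?addr0.
apply: schwartz2_coind => _ [g [h ->]].
  move=> k l; pose kl := if d then (k, l.+1) else (k.+1, l).
  exists (snorm2 (kl, [::]) g + snorm2 (k, l, [::]) h) => u.
  rewrite mulrDr (le_trans (le_normcD _ _))// lerD//; last exact: (S2_bound h k l [::] u).
  have := S2_bound g kl.1 kl.2 [::] u; rewrite /kl /coord.
  rewrite !mulrA -rmorphM/=; congr (normc (_%:C%C * _) <= _).
  by case: (d); rewrite /= exprS; ring.
move=> e; exists (fun u => (coord d u)%:C%C * val (D2 e g) u +
    val ((if e == d then g else 0) + D2 e h) u).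
  by exists (D2 e g), ((if e == d then g else 0) + D2 e h).
move=> u; rewrite pderivableE pderiveE.
have dg := S2_pderivable g e (line e u (coord e u)).
have dh := S2_pderivable h e (line e u (coord e u)).
rewrite pderivable_line in dg; rewrite pderivable_line in dh.
have dX : cderivable (fun t => (coord d (line e u t))%:C%C : C) (coord e u) /\
   cderive (fun t => (coord d (line e u t))%:C%C : C) (coord e u) = (e == d)%:R.
  clear; case: e; case: d => /=.
  - exact: cderivable_id.
  - exact: cderivable_cst.
  - exact: cderivable_cst.
  - exact: cderivable_id.
have [m1 m2] := cderivableM dX.1 dg.
have [s1 s2] := is_cderiveP 1 m1 dh.
rewrite scale1r in s1 s2; split; first exact: s1.
rewrite [LHS]s2 mul1r m2 dX.2 -!pderive_line !line_coord !val_D2.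
rewrite -[val (_ + _)]/(val _ + val _) -[(val _ + val _) u]/(val _ u + val _ u).
rewrite val_D2 -addrA; congr (_ + (_ + _)); case: ifP => _; first by rewrite mulr1.
by rewrite mulr0.
Qed.

Definition mulX d f : S2 R := toS2 (fun u => (coord d u)%:C%C * val f u).

Lemma val_mulX d f : val (mulX d f) = fun u => (coord d u)%:C%C * val f u.
Proof. exact/val_toS2/mulX_schwartz. Qed.

Lemma pderive_mulX d f u : pderive d (val (mulX d f)) u =
  (coord d u)%:C%C * pderive d (val f) u + val f u.
Proof.
rewrite val_mulX pderiveE.
have df := S2_pderivable f d (line d u (coord d u)); rewrite pderivable_line in df.
under eq_fun do rewrite coord_line.
have [i1 i2] := cderivable_id (coord d u).
have [_ /= m2] := cderivableM i1 df.
by rewrite [LHS]m2 i2 mulr1 -pderive_line line_coord.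
Qed.

Lemma tensor_schwartz phi psi : schwartz2 (fun u => val phi u.1 * val psi u.2).
Proof.
pose P := [set F : R * R -> C | exists phi psi, F = fun u => val phi u.1 * val psi u.2].
suff : P `<=` schwartz2 by apply; exists phi, psi.
apply: schwartz2_coind => _ [g [h ->]].
  move=> k l; exists (snorm1 (k, 0)%N g * snorm1 (l, 0)%N h) => u.
  rewrite weight_normc normcM mulrACA ler_pM ?mulr_ge0 ?exprn_ge0 ?normc_ge0//;
  exact: S1_weight_le.
case.
  exists (fun u => val g u.1 * val (D1 h) u.2); first by exists g, (D1 h).
  move=> u; rewrite val_D1; exact: (cderiveZl (val g u.1) (S1_cderivable h u.2)).
exists (fun u => val (D1 g) u.1 * val h u.2); first by exists (D1 g), h.
move=> u; rewrite /pderivable /pderive val_D1 mulrC.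
under eq_fun do rewrite mulrC; exact: (cderiveZl (val h u.2) (S1_cderivable g u.1)).
Qed.

Lemma val_tensor phi psi :
  val (tensor phi psi) = fun u => val phi u.1 * val psi u.2.
Proof. exact/val_toS2/tensor_schwartz. Qed.

Lemma iter_cderive_slice f y m :
  iter m cderive (fun x => val f (y, x)) =
  fun x => pderives (nseq m true) (val f) (y, x).
Proof. by elim: m => //= m ->. Qed.

Lemma slice_schwartz f y : schwartz1 (fun x => val f (y, x)).
Proof.
split=> [m x|[k m]].
  rewrite iter_cderive_slice; have [g <-] := S2_pderives f (nseq m true).
  exact: (S2_pderivable g true (y, x)).
exists (snorm2 (0, k, nseq m true)%N f) => _ [x _ <-].
rewrite /weighted1 iter_cderive_slice/=.
by have := S2_bound f 0 k (nseq m true) (y, x); rewrite expr0 mul1r.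
Qed.

Definition slice f y : S1 R := toS1 (fun x => val f (y, x)).

Lemma val_slice f y : val (slice f y) = fun x => val f (y, x).
Proof. exact/val_toS1/slice_schwartz. Qed.

Lemma mul_le_sqr (a b : R) : 0 <= a -> 0 <= b -> a * b <= a ^+ 2 + b ^+ 2.
Proof. by move=> a0 b0; nra. Qed.

(** The increment is split at (u.1, u.2 + t). The first half yields the derivative at that point
    instead of u; the correction is of size |s| |t|, hence at most s^2 + t^2. *)
Lemma S2_taylor2 f : exists M, forall (u : R * R) s t,
  normc (val f (u.1 + s, u.2 + t) - val f u
    - (s%:C%C * val (D2 false f) u + t%:C%C * val (D2 true f) u))
  <= M * (s ^+ 2 + t ^+ 2).
Proof.
have idE (p q r a b c s t : C) : p - r - (s * a + t * b) =
  (p - q - s * c) + (q - r - t * b) + s * (c - a) by ring.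
have T d u t := S2_taylor f d 0 [::] u t.
have L d u t := S2_lipschitz (D2 false f) d 0 [::] u t.
set A := fun d => 4 * snorm2 (weightN d 0, [:: d; d]) f in T.
set B := 2 * snorm2 (weightN true 0, [:: true]) (D2 false f) in L.
exists (A false + A true + B) => u s t.
have := L true u t; have := T true u t; have := T false (u.1, u.2 + t) s.
rewrite !expr0 !mul1r /shift/= -!val_D2 => T1 T2 L1.
set a := _ - _ - _ in T1; set b := _ - _ - _ in T2; set c := _ - _ in L1.
have -> : val f (u.1 + s, u.2 + t) - val f u -
  (s%:C%C * val (D2 false f) u + t%:C%C * val (D2 true f) u) = a + b + s%:C%C * c.
  exact: idE.
rewrite (le_trans (le_normcD _ _))// !mulrDl lerD//.
  rewrite (le_trans (le_normcD _ _))// lerD//.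
    by rewrite (le_trans T1)// ler_wpM2l ?mulr_ge0 ?snorm2_ge0 ?lerDl ?sqr_ge0.
  by rewrite (le_trans T2)// ler_wpM2l ?mulr_ge0 ?snorm2_ge0 ?lerDr ?sqr_ge0.
rewrite normcMr (le_trans (ler_wpM2l _ L1))// mulrCA ler_wpM2l ?mulr_ge0 ?snorm2_ge0//.
rewrite -[s ^+ 2]real_normK ?num_real// -[t ^+ 2]real_normK ?num_real//.
exact: mul_le_sqr.
Qed.

(** Despite its name a reflection: an orthogonal map of determinant -1, hence its own inverse. It is
    the change of variables inside [Wbarinv]. *)
Definition rotation (u : R * R) : R * R :=
  ((u.1 + u.2) / Num.sqrt 2, (u.1 - u.2) / Num.sqrt 2).

Lemma sqrt2_gt0 : 0 < Num.sqrt 2 :> R.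
Proof. by rewrite sqrtr_gt0. Qed.

Lemma sqrt2_sqr : Num.sqrt 2 ^+ 2 = 2 :> R.
Proof. by rewrite sqr_sqrtr. Qed.

Lemma rotationK : involutive rotation.
Proof.
move=> [a b]; have n0 : Num.sqrt 2 != 0 :> R by rewrite gt_eqF// sqrt2_gt0.
rewrite /rotation/= -mulrDl -mulrBl -!mulrA -invfM -expr2 sqrt2_sqr.
by congr pair; field.
Qed.

Lemma rotation_le u : (`|u.1| <= `|(rotation u).1| + `|(rotation u).2|) /\
  (`|u.2| <= `|(rotation u).1| + `|(rotation u).2|).
Proof.
have s0 : 0 < (Num.sqrt 2)^-1 :> R by rewrite invr_gt0 sqrt2_gt0.
have s1 : (Num.sqrt 2)^-1 <= 1 :> R.
  by rewrite invf_le1 ?sqrt2_gt0// -[leLHS]sqrtr1 ler_wsqrtr// ler1n.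
have := rotationK u; case: (rotation u) => a b <-.
rewrite /rotation/= !normrM (gtr0_norm s0); split.
  by rewrite -[leRHS]mulr1 ler_pM ?ler_normD// ltW.
by rewrite -[leRHS]mulr1 ler_pM ?ler_normB// ltW.
Qed.

Lemma expr_add_le (a b : R) n : 0 <= a -> 0 <= b ->
  (a + b) ^+ n <= 2 ^+ n * (a ^+ n + b ^+ n).
Proof.
move=> a0 b0; wlog ab : a b a0 b0 / a <= b.
  move=> H; have [|/ltW] := leP a b; first exact: H.
  by move=> ba; rewrite addrC [a ^+ n + _]addrC; exact: H.
rewrite (@le_trans _ _ ((2 * b) ^+ n))//.
  by rewrite lerXn2r ?nnegrE ?addr_ge0 ?mulr_ge0// mulr2n mulrDl mul1r lerD2r.
by rewrite exprMn ler_wpM2l ?exprn_ge0// lerDr exprn_ge0.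
Qed.

Lemma lin_factor (c e t : R) (x y : C) : (c * t)%:C%C * x + (e * c * t)%:C%C * y
  = t%:C%C * (c%:C%C * x + (e * c)%:C%C * y).
Proof. by rewrite !realcM; ring. Qed.

Lemma rot_schwartz f : schwartz2 (fun u => val f (rotation u)).
Proof.
pose P := [set F : R * R -> C | exists f, F = fun u => val f (rotation u)].
suff : P `<=` schwartz2 by apply; exists f.
apply: schwartz2_coind => _ [g ->].
  move=> k l; exists (2 ^+ (k + l) * (snorm2 (k + l, 0, [::])%N g + snorm2 (0, k + l, [::])%N
      g)) => u.
  rewrite weight_normc; have [r1 r2] := rotation_le u.
  have := S2_weight_le g (k + l) 0 (rotation u).
  have := S2_weight_le g 0 (k + l) (rotation u).
  rewrite !expr0 mul1r mulr1; move: r1 r2.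
  set a := `|(rotation u).1|; set b := `|(rotation u).2|; set n := normc _.
  move=> r1 r2 b1 b2; have ab0 : 0 <= a + b by rewrite addr_ge0 ?normr_ge0.
  rewrite (@le_trans _ _ ((a + b) ^+ (k + l) * n))//.
    rewrite ler_wpM2r ?normc_ge0// exprD ler_pM ?exprn_ge0//.
      by rewrite lerXn2r// nnegrE.
    by rewrite lerXn2r// nnegrE.
  rewrite (le_trans (ler_wpM2r (normc_ge0 _) (expr_add_le (k + l) (normr_ge0 _) (normr_ge0
      _))))//.
  by rewrite -mulrA ler_wpM2l ?exprn_ge0// mulrDl lerD.
(* Moving coordinate [d] by t moves the rotated point by (c t, e c t); [e] is the sign of [u.2] in
   the second component of [rotation]. *)
move=> d; pose c := (Num.sqrt 2)^-1 : R; pose e : R := if d then -1 else 1.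
pose g' := c%:C%C *: D2 false g + (e * c)%:C%C *: D2 true g.
exists (fun u => val g' (rotation u)); first by exists g'.
have [M HM] := S2_taylor2 g; move=> u.
apply: (@pderive_quadratic _ _ _ _ _ (M * (c ^+ 2 + c ^+ 2))) => t.
have := HM (rotation u) (c * t) (e * c * t).
have -> : ((rotation u).1 + c * t, (rotation u).2 + e * c * t) = rotation (shift d u t).
  by rewrite /rotation /shift /line /coord /e /c; case: (d) => /=; congr pair; ring.
have -> : M * ((c * t) ^+ 2 + (e * c * t) ^+ 2) = M * (c ^+ 2 + c ^+ 2) * t ^+ 2.
  by rewrite /e; case: (d); ring.
rewrite -[val g' _]/(c%:C%C * val (D2 false g) _ + (e * c)%:C%C * val (D2 true g) _).
by rewrite lin_factor.
Qed.

Definition rot f : S2 R := toS2 (fun u => val f (rotation u)).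

Lemma val_rot f : val (rot f) = fun u => val f (rotation u).
Proof. exact/val_toS2/rot_schwartz. Qed.

Lemma rotK : involutive rot.
Proof.
by move=> f; apply: val_inj; rewrite !val_rot; apply/funext => u; rewrite rotationK.
Qed.

End schwartz_operations.

(** * Gaussians as Schwartz functions *)

Section gaussian.
Context {R : realType}.
Local Notation C := R[i].
Implicit Types (x y t M : R).

Definition gaussian (a b x : R) : R := expR (- (a * (x - b) ^+ 2)).

Lemma gaussian_gt0 a b x : 0 < gaussian a b x.
Proof. exact: expR_gt0. Qed.

Lemma gaussian_le1 a b x : 0 < a -> gaussian a b x <= 1.
Proof.
by move=> a0; rewrite -expR0 ler_expR oppr_le0 mulr_ge0 ?sqr_ge0// ltW.
Qed.

Lemma pow_expR_bound a n : 0 < a ->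
  exists M, forall x, `|x| ^+ n * expR (- (a * x ^+ 2)) <= M.
Proof.
move=> a0; have [->|n0] := eqVneq n 0.
  exists 1 => x; rewrite expr0 mul1r -expR0 ler_expR oppr_le0 mulr_ge0 ?sqr_ge0//.
  exact: ltW.
have n0' : 0 < n%:R :> R by rewrite ltr0n lt0n.
(* From 1 + y <= exp y with y = a x^2 / n, raised to the power n, x^(2n) is at most (n/a)^n exp(a
   x^2). The odd powers are covered by z <= 1 + z^2 with z = |x|^n, whence the summand 1. *)
exists (1 + (n%:R / a) ^+ n) => x.
have e0 : 0 < expR (a * x ^+ 2) by exact: expR_gt0.
rewrite expRN -ler_pdivlMr ?invr_gt0// invrK mulrDl mul1r.
have x2 : (x ^+ 2) ^+ n <= (n%:R / a) ^+ n * expR (a * x ^+ 2).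
  have -> : expR (a * x ^+ 2) = expR (a * x ^+ 2 / n%:R) ^+ n.
    by rewrite -expRM_natl [n%:R * _]mulrC divfK// gt_eqF.
  have q0 : 0 < n%:R / a by rewrite divr_gt0.
  rewrite -exprMn lerXn2r ?nnegrE ?sqr_ge0//.
    by rewrite mulr_ge0 ?expR_ge0// ltW.
  rewrite mulrC -ler_pdivrMr// invf_div mulrA [x ^+ 2 * a]mulrC.
  have := @expR_ge1Dx R (a * x ^+ 2 / n%:R); apply: le_trans.
  by rewrite mulrAC lerDr.
rewrite -exprM mulnC exprM in x2.
have e1 : 1 <= expR (a * x ^+ 2).
  by rewrite -expR0 ler_expR mulr_ge0 ?sqr_ge0// ltW.
apply: le_trans (lerD e1 x2).
rewrite -[x ^+ n ^+ 2]real_normK ?num_real// normrX.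
have : 0 <= `|x| ^+ n by rewrite exprn_ge0.
by move: (`|x| ^+ n) => z z0; nra.
Qed.

(** Polynomials times one Gaussian, generated inductively: both the decay and the stability under
    differentiation follow by induction, without any bookkeeping of degrees. *)
Inductive gauss_span (a b : R) : (R -> C) -> Prop :=
| gauss_span_base : gauss_span a b (fun x => (gaussian a b x)%:C%C)
| gauss_span_mul f : gauss_span a b f -> gauss_span a b (fun x => x%:C%C * f x)
| gauss_span_lin c f g : gauss_span a b f -> gauss_span a b g ->
    gauss_span a b (fun x => c * f x + g x).

Lemma is_derive_gaussian a b x :
  is_derive x 1 (gaussian a b) (- 2 * a * (x - b) * gaussian a b x).
Proof.
have -> : gaussian a b = expR \o (fun x => - (a * (x - b) ^+ 2)) by [].
have h : is_derive x 1 (fun x => - (a * (x - b) ^+ 2)) (- 2 * a * (x - b)).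
  apply: (@is_derive_quadratic _ _ _ _ `|a|) => t.
  rewrite [X in `|X|](_ : _ = - a * t ^+ 2); last by ring.
  by rewrite normrM normrN normrX real_normK ?num_real.
have := @is_derive1_comp R expR (fun x => - (a * (x - b) ^+ 2)) x _ _ (is_derive_expR _) h.
by rewrite /= mulrC.
Qed.

Lemma cderive_gaussian a b x :
  cderivable (fun x => (gaussian a b x)%:C%C : C) x /\
  cderive (fun x => (gaussian a b x)%:C%C : C) x =
    (- 2 * a * (x - b) * gaussian a b x)%:C%C.
Proof.
have h := is_derive_gaussian a b x.
have rE : @complex.Re R \o (fun x => (gaussian a b x)%:C%C : C) = gaussian a b by [].
have iE : @complex.Im R \o (fun x => (gaussian a b x)%:C%C : C) = cst 0 by [].
rewrite /cderivable /cderive rE iE; split.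
  by split; [case: h|exact: derivable_cst].
by rewrite derive1_cst derive1E (@derive_val _ _ _ _ _ _ _ h).
Qed.

Lemma gaussian_bound a b n : 0 < a ->
  exists M, forall x, `|x| ^+ n * gaussian a b x <= M.
Proof.
move=> a0; have [M HM] := @pow_expR_bound (a / 2) n (divr_gt0 a0 (ltr0Sn _ 1)).
exists (expR (a * b ^+ 2) * M) => x.
apply: (@le_trans _ _ (expR (a * b ^+ 2) * (`|x| ^+ n * expR (- (a / 2 * x ^+ 2))))).
  rewrite mulrCA ler_wpM2l ?exprn_ge0// -expRD ler_expR.
  (* Completing the square: a (x - b)^2 - a x^2 / 2 + a b^2 = (a/2) (x - 2 b)^2, so half of the
     exponent pays for the shift. *)
  have := sqr_ge0 (x - 2 * b) => H; nra.
by rewrite ler_wpM2l// expR_ge0.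
Qed.

Lemma gauss_span_schwartz a b : 0 < a -> gauss_span a b `<=` schwartz1.
Proof.
move=> a0; apply: schwartz1_coind => f.
  elim=> {f} [k|f _ IH k|c f g _ IHf _ IHg k].
  - have [M HM] := gaussian_bound b k a0; exists M => x.
    by rewrite normcMr normc_real normrX (gtr0_norm (gaussian_gt0 _ _ _)).
  - have [M HM] := IH k.+1; exists M => x.
    by have := HM x; rewrite exprSr rmorphM/= mulrA.
  - have [M HM] := IHf k; have [N HN] := IHg k; exists (normc c * M + N) => x.
    rewrite mulrDr (le_trans (le_normcD _ _))// lerD// mulrCA normcM.
    by rewrite ler_wpM2l ?normc_ge0.
elim=> {f} [|f sf [g sg IH]|c f g sf [f' sf' IHf] sg [g' sg' IHg]].
- exists (fun x => (- 2 * a)%:C%C * (x%:C%C * (gaussian a b x)%:C%C) +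
      ((2 * a * b - 1)%:C%C * (gaussian a b x)%:C%C + (gaussian a b x)%:C%C)).
    apply: gauss_span_lin; first exact/gauss_span_mul/gauss_span_base.
    apply: gauss_span_lin; exact: gauss_span_base.
  move=> x; have [c1 ->] := cderive_gaussian a b x; split => //.
  by rewrite -!rmorphM -!rmorphD; congr (_%:C%C) => /=; ring.
- exists (fun x => 1 * (x%:C%C * g x) + f x).
    by apply: gauss_span_lin => //; exact: gauss_span_mul.
  move=> x; have [i1 i2] := cderivable_id x; have [/= c1 c2] := cderivableM i1 (IH x).1.
  by rewrite mul1r; split; [exact: c1|rewrite [LHS]c2 i2 mulr1 (IH x).2].
- exists (fun x => c * f' x + g' x); first exact: gauss_span_lin.
  move=> x; have [c1 c2] := is_cderiveP c (IHf x).1 (IHg x).1.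
  by split; [exact: c1|rewrite [LHS]c2 (IHf x).2 (IHg x).2].
Qed.

End gaussian.

#[local] Opaque mulX tensor slice rot.

(** * Composition of kernels and the partial Fourier transform *)

Section integral_operators.
Context {R : realType}.
Local Notation C := R[i].
Local Notation mu := (@lebesgue_measure R).
Local Notation Rm := (measurableTypeR R).
Local Notation cmeasurable1 f := (@cmeasurable R _ Rm f).
Local Notation cmeasurable2 f := (@cmeasurable R _ (Rm * Rm)%type f).
Implicit Types (x y t M : R) (f g h H F : S2 R) (phi psi : S1 R).

Lemma wt_bound (a : C) z M0 M2 : normc a <= M0 -> `|z| ^+ 2 * normc a <= M2 ->
  normc a <= (M0 + M2) * wt z.
Proof.
move=> a0 a2; rewrite /wt ler_pdivlMr ?oneD_gt0// mulrDr mulr1 lerD//.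
by rewrite mulrC -real_normK ?num_real.
Qed.

Definition wt2_norm f := snorm2 (0, 0, [::])%N f + snorm2 (0, 2, [::])%N f.
Definition wt1_norm f := snorm2 (0, 0, [::])%N f + snorm2 (2, 0, [::])%N f.
Definition wt12_norm f := snorm2 (0, 0, [::])%N f + snorm2 (0, 2, [::])%N f +
  (snorm2 (2, 0, [::])%N f + snorm2 (2, 2, [::])%N f).

Lemma S2_wt2 f u : normc (val f u) <= wt2_norm f * wt u.2.
Proof.
apply: wt_bound; first exact: S2_le.
by have := S2_weight_le f 0 2 u; rewrite expr0 mul1r.
Qed.

Lemma S2_wt1 f u : normc (val f u) <= wt1_norm f * wt u.1.
Proof.
apply: wt_bound; first exact: S2_le.
by have := S2_weight_le f 2 0 u; rewrite expr0 mulr1.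
Qed.

Lemma S2_wt12 f u : normc (val f u) <= wt12_norm f * (wt u.1 * wt u.2).
Proof.
have := S2_weight_le f 0 0 u; have := S2_weight_le f 0 2 u.
have := S2_weight_le f 2 0 u; have := S2_weight_le f 2 2 u.
rewrite !expr0 !mul1r !mulr1 !real_normK ?num_real// /wt12_norm /wt.
set n := normc _; move=> s22 s20 s02 s00.
rewrite -invfM ler_pdivlMr ?mulr_gt0 ?oneD_gt0//.
have -> : n * ((1 + u.1 ^+ 2) * (1 + u.2 ^+ 2)) =
  n + u.2 ^+ 2 * n + (u.1 ^+ 2 * n + u.1 ^+ 2 * u.2 ^+ 2 * n) by ring.
by rewrite !lerD.
Qed.

Lemma S1_wt phi x : normc (val phi x) <=
  (snorm1 (0, 0)%N phi + snorm1 (2, 0)%N phi) * wt x.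
Proof.
apply: wt_bound; last exact: S1_weight_le.
exact: S1_le.
Qed.

Lemma S1_integrable phi : cintegrable mu (val phi).
Proof. exact: cintegrable_wt (cmeasurable_S1 phi) (S1_wt phi). Qed.

Lemma S2_cmeasurable_l f y : cmeasurable1 (fun x => val f (x, y)).
Proof. exact: cmeasurable_comp (cmeasurable_S2 f) (pair2_measurable y). Qed.

Lemma S2_cmeasurable_r f x : cmeasurable1 (fun y => val f (x, y)).
Proof. exact: cmeasurable_comp (cmeasurable_S2 f) (pair1_measurable x). Qed.

Lemma cmeasurable_expiZ c : cmeasurable1 (fun z => expi (c * z)).
Proof. by apply: cmeasurable_expi; exact: measurable_funM. Qed.

(** Differentiation under the integral sign: a remainder bounded by M t^2 [wt z] integrates to a
    quadratic remainder of the integral. *)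
Lemma integral_quadratic (a b c : R -> C) t M : cintegrable mu a ->
  cintegrable mu b -> cintegrable mu c -> cmeasurable1 (fun z => a z - b z - t%:C%C * c z) ->
  (forall z, normc (a z - b z - t%:C%C * c z) <= M * t ^+ 2 * wt z) ->
  normc (cintegral mu a - cintegral mu b - t%:C%C * cintegral mu c)
    <= 2 * wtI * M * t ^+ 2.
Proof.
move=> ai bi ci m H; rewrite -mulrA.
have tc := cintegrableZ t%:C%C ci.
have ab : cintegrable mu (fun z => a z - b z).
  have := cintegrable_lin (-1) bi ai; congr cintegrable.
  by apply/funext => z; rewrite mulN1r addrC.
rewrite -cintegralZ// -cintegralB// -cintegralB//; exact: cintegral_wt.
Qed.

Lemma cmeasurableN (f : Rm -> C) : cmeasurable1 f -> cmeasurable1 (fun x => - f x).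
Proof.
move=> mf; have := cmeasurableM (cmeasurable_cst (-1)) mf.
by under eq_fun do rewrite mulN1r.
Qed.

Lemma cmeasurable_taylor (a b c : R -> C) t : cmeasurable1 a -> cmeasurable1 b ->
  cmeasurable1 c -> cmeasurable1 (fun z => a z - b z - t%:C%C * c z).
Proof.
move=> ma mb mc; apply: cmeasurableD.
  by apply: cmeasurableD => //; exact: cmeasurableN.
by apply: cmeasurableN; apply: cmeasurableM => //; exact: cmeasurable_cst.
Qed.

Section composition.
Definition kcomp H F (u : R * R) : C :=
  cintegral mu (fun z => val H (u.1, z) * val F (z, u.2)).

Lemma kcomp_measurable H F x y : cmeasurable1 (fun z => val H (x, z) * val F (z, y)).
Proof. by apply: cmeasurableM; [exact: S2_cmeasurable_r|exact: S2_cmeasurable_l]. Qed.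

Lemma kcomp_le_wt H F x y z : normc (val H (x, z) * val F (z, y)) <=
  snorm2 (0, 0, [::])%N H * wt1_norm F * wt z.
Proof.
rewrite normcM -mulrA ler_pM ?normc_ge0//; first exact: S2_le.
exact: (S2_wt1 F (z, y)).
Qed.

Lemma kcomp_integrable H F x y : cintegrable mu (fun z => val H (x, z) * val F (z, y)).
Proof. exact: cintegrable_wt (kcomp_measurable H F x y) (kcomp_le_wt H F x y). Qed.

Lemma kcomp_le H F u : normc (kcomp H F u) <=
  2 * wtI * (snorm2 (0, 0, [::])%N H * wt1_norm F).
Proof. exact: cintegral_wt (kcomp_measurable H F u.1 u.2) (kcomp_le_wt H F u.1 u.2). Qed.

Lemma kcomp_mulXl H F u : kcomp (mulX false H) F u = (u.1)%:C%C * kcomp H F u.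
Proof.
rewrite /kcomp -cintegralZ; last exact: kcomp_integrable.
by congr cintegral; apply/funext => z; rewrite val_mulX mulrA.
Qed.

Lemma kcomp_mulXr H F u : kcomp H (mulX true F) u = (u.2)%:C%C * kcomp H F u.
Proof.
rewrite /kcomp -cintegralZ; last exact: kcomp_integrable.
by congr cintegral; apply/funext => z; rewrite val_mulX mulrCA.
Qed.

Lemma normc_iM (c : R) (a : C) : normc ('i%C * c%:C%C * a) = `|c| * normc a.
Proof. by rewrite -mulrA normcM normc_i mul1r normcMr. Qed.

Lemma mulr4_perm (a b c e : R) : a * b * c * e = a * e * (b * c).
Proof. by ring. Qed.

Lemma factor_r (a b c e s : C) : a * e - b * e - s * (c * e) = (a - b - s * c) * e.
Proof. ring. Qed.

Lemma factor_l (a b c e s : C) : e * a - e * b - s * (e * c) = e * (a - b - s * c).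
Proof. ring. Qed.

Lemma kcomp_pderive2 H F u : pderivable true (kcomp H F) u /\
  pderive true (kcomp H F) u = kcomp H (D2 true F) u.
Proof.
  apply: (@pderive_quadratic _ _ _ _ _
    (2 * wtI * (wt2_norm H * (4 * snorm2 (0, 0, [:: true; true])%N F)))) => t.
  apply: integral_quadratic; try exact: kcomp_integrable.
    by apply: cmeasurable_taylor; exact: kcomp_measurable.
  move=> z; rewrite factor_l normcM.
  rewrite [leRHS]mulr4_perm.
  rewrite ler_pM ?normc_ge0//.
    exact: (S2_wt2 H (u.1, z)).
  have := S2_taylor F true 0 [::] (z, u.2) t.
  by rewrite expr0 mul1r /= val_D2.
Qed.

Lemma kcomp_pderive1 H F u : pderivable false (kcomp H F) u /\
  pderive false (kcomp H F) u = kcomp (D2 false H) F u.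
Proof.
apply: (@pderive_quadratic _ _ _ _ _
  (2 * wtI * (4 * snorm2 (0, 0, [:: false; false])%N H * wt1_norm F))) => t.
apply: integral_quadratic; try exact: kcomp_integrable.
  by apply: cmeasurable_taylor; exact: kcomp_measurable.
move=> z; rewrite factor_r normcM.
rewrite -[_ * wt1_norm F * _]mulrA [wt1_norm F * _]mulrC mulrA -mulrA ler_pM ?normc_ge0//.
  have := S2_taylor H false 0 [::] (u.1, z) t.
  by rewrite expr0 mul1r /= val_D2.
exact: (S2_wt1 F (z, u.2)).
Qed.

Lemma kcomp_schwartz H F : schwartz2 (kcomp H F).
Proof.
pose P := [set G : R * R -> C | exists H F, G = kcomp H F].
suff : P `<=` schwartz2 by apply; exists H, F.
apply: schwartz2_coind => _ [H' [F' ->]].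
  (* A factor u.1 is absorbed by the left kernel and a factor u.2 by the right one, so both
     inductions end at the plain bound [kcomp_le]. *)
  move=> k l; elim: k H' => [|k IHk] H'.
    elim: l F' => [|l IHl] F'.
      exists (2 * wtI * (snorm2 (0, 0, [::])%N H' * wt1_norm F')) => u.
      by rewrite !expr0 mul1r mul1r; exact: kcomp_le.
    have [M HM] := IHl (mulX true F'); exists M => u; have := HM u.
    by rewrite kcomp_mulXr !expr0 !mul1r mulrA -realcM -exprSr.
  have [M HM] := IHk (mulX false H'); exists M => u; have := HM u.
  by rewrite kcomp_mulXl mulrA -realcM mulrAC -exprSr.
case; [exists (kcomp H' (D2 true F'))|exists (kcomp (D2 false H') F')].
- by exists H', (D2 true F').
- by move=> u; exact: kcomp_pderive2.
- by exists (D2 false H'), F'.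
- by move=> u; exact: kcomp_pderive1.
Qed.

Definition comp H F : S2 R := toS2 (kcomp H F).

Lemma val_comp H F : val (comp H F) = kcomp H F.
Proof. exact/val_toS2/kcomp_schwartz. Qed.

End composition.

(** Here the weight z^2 is in the differentiated variable, so it does not commute with the
    increment. With a = h(z + t), b = h(z), d = h'(z), the weighted remainder of h is G - 2 t k +
    t^2 a, where G is the remainder of z^2 h and k the increment of z h; each term is O(t^2). *)
Lemma wtaylor_algebra (z t h0 h2 k1 g2 : R) (a b d : C) :
  normc a <= h0 -> normc (a - b - t%:C%C * d) <= h2 * t ^+ 2 ->
  normc ((z + t)%:C%C * a - z%:C%C * b) <= k1 * `|t| ->
  normc ((z + t)%:C%C * ((z + t)%:C%C * a) - z%:C%C * (z%:C%C * b)
    - t%:C%C * (z%:C%C * (z%:C%C * d + b) + z%:C%C * b)) <= g2 * t ^+ 2 ->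
  normc (a - b - t%:C%C * d) <= (h2 + (g2 + 2 * k1 + h0)) * t ^+ 2 * wt z.
Proof.
move=> A0 T0 K T2; rewrite mulrDl; apply: wt_bound => //.
rewrite -normrX -normcMr.
set G := (X in normc X <= g2 * _) in T2; set k := (X in normc X <= k1 * _) in K.
have -> : (z ^+ 2)%:C%C * (a - b - t%:C%C * d) =
    G + (- (2 * t))%:C%C * k + (t ^+ 2)%:C%C * a.
  have -> : (- (2 * t))%:C%C = - (t%:C%C + t%:C%C) :> C by rewrite -realcD -rmorphN; congr
      (_%:C%C); ring.
  by rewrite /G /k !expr2 !realcM !realcD; ring.
rewrite (le_trans (le_normcD _ _))// [leRHS]mulrDl lerD//; last first.
  by rewrite normcMr ger0_norm ?sqr_ge0// mulrC ler_wpM2r ?sqr_ge0.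
rewrite (le_trans (le_normcD _ _))// [leRHS]mulrDl lerD//.
rewrite normcMr normrN normrM ger0_norm// (le_trans (ler_wpM2l _ K)) ?mulr_ge0//.
rewrite -[t ^+ 2]real_normK ?num_real// expr2.
by rewrite [X in X <= _](_ : _ = 2 * k1 * (`|t| * `|t|))//; ring.
Qed.

(** A remainder integrable in the very variable that is shifted: this is what integration by parts
    requires. *)
Lemma S2_wtaylor h : exists M, forall x z t,
  normc (val h (x, z + t) - val h (x, z) - t%:C%C * val (D2 true h) (x, z))
   <= M * t ^+ 2 * wt z.
Proof.
have [k kE] : exists k, k = mulX true h by eexists.
have [g gE] : exists g, g = mulX true k by eexists.
eexists => x z t; apply: wtaylor_algebra.
- exact: S2_le.
- have := S2_taylor h true 0 [::] (x, z) t.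
  by rewrite expr0 mul1r val_D2; exact.
- have := S2_lipschitz k true 0 [::] (x, z) t.
  by rewrite expr0 mul1r kE val_mulX; exact.
have := S2_taylor g true 0 [::] (x, z) t.
have -> : pderives [:: true] (val g) (x, z) = z%:C%C *
    (z%:C%C * val (D2 true h) (x, z) + val h (x, z)) + z%:C%C * val h (x, z).
  rewrite -[LHS]/(pderive true (val g) (x, z)) gE pderive_mulX kE pderive_mulX.
  by rewrite val_mulX val_D2.
by rewrite expr0 mul1r gE val_mulX kE val_mulX; exact.
Qed.

Section fourier.
Variable s : R.

(** Partial transform in the second variable, without normalization. The sign [s] is meant to be 1
    or -1, recorded later as [s ^+ 2 = 1]. *)
Definition fou h (u : R * R) : C :=
  cintegral mu (fun z => val h (u.1, z) * expi (s * u.2 * z)).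

Lemma fou_measurable h x y : cmeasurable1 (fun z => val h (x, z) * expi (s * y * z)).
Proof. by apply: cmeasurableM; [exact: S2_cmeasurable_r|exact: cmeasurable_expiZ]. Qed.

Lemma fou_le_wt h x y z : normc (val h (x, z) * expi (s * y * z)) <= wt2_norm h * wt z.
Proof. by rewrite normcM normc_expi mulr1; exact: (S2_wt2 h (x, z)). Qed.

Lemma fou_integrable h x y : cintegrable mu (fun z => val h (x, z) * expi (s * y * z)).
Proof. exact: cintegrable_wt (fou_measurable h x y) (fou_le_wt h x y). Qed.

Lemma fou_le h u : normc (fou h u) <= 2 * wtI * wt2_norm h.
Proof. exact: cintegral_wt (fou_measurable h u.1 u.2) (fou_le_wt h u.1 u.2). Qed.

Lemma fou_lin (a : C) f g u : fou (a *: f + g) u = a * fou f u + fou g u.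
Proof.
rewrite /fou -cintegral_lin; [|exact: fou_integrable|exact: fou_integrable].
congr cintegral; apply/funext => z.
by rewrite -[val (a *: f + g) _]/(a * val f _ + val g _) mulrDl mulrA.
Qed.

Lemma fou_mulX h u : fou (mulX false h) u = (u.1)%:C%C * fou h u.
Proof.
rewrite /fou -cintegralZ; last exact: fou_integrable.
by congr cintegral; apply/funext => z; rewrite val_mulX mulrA.
Qed.

Lemma fou_pderive1 h u :
  pderivable false (fou h) u /\ pderive false (fou h) u = fou (D2 false h) u.
Proof.
pose N k := 4 * snorm2 (0, k, [:: false; false])%N h.
apply: (@pderive_quadratic _ _ _ _ _ (2 * wtI * (N 0 + N 2))) => t.
apply: integral_quadratic; try exact: fou_integrable.
  by apply: cmeasurable_taylor; exact: fou_measurable.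
move=> z; rewrite factor_r normcM normc_expi mulr1 mulrDl.
have T k := S2_taylor h false k [::] (u.1, z) t.
apply: wt_bound.
  by have := T 0; rewrite expr0 mul1r /= val_D2.
by have := T 2; rewrite normcMr normrX /= val_D2.
Qed.

Lemma fou_pderive2 h u : pderivable true (fou h) u /\
  pderive true (fou h) u = fou (('i%C * s%:C%C) *: mulX true h) u.
Proof.
(* The remainder of the exponential brings a factor z^2, and the majorant [wt] asks for two more
   powers: hence the moments 2 and 4. *)
pose N := 4 * s ^+ 2 * (snorm2 (0, 2, [::])%N h + snorm2 (0, 4, [::])%N h).
apply: (@pderive_quadratic _ _ _ _ _ (2 * wtI * N)) => t.
apply: integral_quadratic; try exact: fou_integrable.
  by apply: cmeasurable_taylor; exact: fou_measurable.
move=> z.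
have -> : val (('i%C * s%:C%C) *: mulX true h) (u.1, z) =
  val h (u.1, z) * (s * z)%:C%C * 'i%C.
  rewrite -[val (_ *: _) _]/(_ * val _ _) val_mulX /= realcM.
  by move: (val h _) => a; ring.
have := normc_expi_taylor (s * u.2 * z) (s * t * z).
have -> : s * u.2 * z + s * t * z = s * (u.2 + t) * z by ring.
set E := _ - _ - _ => HE.
have -> : val h (u.1, z) * expi (s * (u.2 + t) * z) - val h (u.1, z) * expi (s * u.2 * z)
  - t%:C%C * (val h (u.1, z) * (s * z)%:C%C * 'i%C * expi (s * u.2 * z))
  = val h (u.1, z) * E.
  have idE (a b c e f r : C) : a * b - a * c - e * (a * f * r * c) = a * (b - c - f * e * (r *
      c)) by ring.
  rewrite idE /E; have -> : (s * t * z)%:C%C = (s * z)%:C%C * t%:C%C :> C => //.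
  by rewrite -realcM; congr (_%:C%C); ring.
rewrite normcM (le_trans (ler_wpM2l (normc_ge0 _) HE))//.
have -> : normc (val h (u.1, z)) * (4 * (s * t * z) ^+ 2) =
  4 * s ^+ 2 * t ^+ 2 * (`|z| ^+ 2 * normc (val h (u.1, z))).
  by rewrite real_normK ?num_real// !exprMn; ring.
rewrite (_ : N * _ * _ = 4 * s ^+ 2 * t ^+ 2 * ((snorm2 (0, 2, [::])%N h + snorm2 (0, 4,
    [::])%N h) * wt z)); last by rewrite /N; ring.
have c0 : 0 <= 4 * s ^+ 2 * t ^+ 2.
  by apply: mulr_ge0; [apply: mulr_ge0 => //|]; exact: sqr_ge0.
rewrite ler_wpM2l//.
have := S2_weight_le h 0 4 (u.1, z); have := S2_weight_le h 0 2 (u.1, z).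
rewrite !expr0 !mul1r /= => h2 h4.
rewrite /wt ler_pdivlMr ?oneD_gt0//.
rewrite mulrDr mulr1 lerD// -[z ^+ 2]real_normK ?num_real//.
by rewrite mulrAC -exprD.
Qed.

End fourier.

(** By translation invariance the integrals of f(z + t) and f(z) cancel, so integrating the
    remainder leaves |t| |I| <= C t^2; dividing by |t| and letting t tend to 0 gives I = 0. *)
Lemma integral_derive_eq0 (f f' : R -> C) M : cmeasurable1 f -> cmeasurable1 f' ->
  (forall z, normc (f z) <= M * wt z) -> (forall z, normc (f' z) <= M * wt z) ->
  (forall z t, normc (f (z + t) - f z - t%:C%C * f' z) <= M * t ^+ 2 * wt z) ->
  cintegral mu f' = 0.
Proof.
move=> mf mf' fM f'M H; set I := cintegral mu f'.
have fi := cintegrable_wt mf fM; have f'i := cintegrable_wt mf' f'M.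
have key t : `|t| * normc I <= 2 * wtI * M * t ^+ 2.
  have ti : cintegrable mu (fun z => f (z + t)).
    have := cintegrable_affine t ltr01 fi.
    by under eq_fun do rewrite mul1r.
  have := @integral_quadratic (fun z => f (z + t)) f f' t M ti fi f'i.
  rewrite cintegral_translation// subrr sub0r normcN normcMr; apply => //.
  apply: cmeasurable_taylor => //.
  by apply: cmeasurable_comp mf _; exact: measurable_funD.
apply: eq0_normc; apply/eqP; rewrite eq_le normc_ge0 andbT.
apply/ler_addgt0Pl => e e0; rewrite addr0.
have A0 : 0 <= 2 * wtI * M.
  have := key 1; rewrite normr1 expr1n mul1r mulr1 ; apply: le_trans; exact: normc_ge0.
pose t := Num.min 1 (e / (2 * wtI * M + 1)).
have A1 : 0 < 2 * wtI * M + 1 by rewrite ltr_wpDl.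
have t0 : 0 < t by rewrite lt_min ltr01 divr_gt0.
have := key t; rewrite gtr0_norm// expr2 mulrCA ler_pM2l// => /le_trans; apply.
rewrite (@le_trans _ _ ((2 * wtI * M + 1) * t))//.
  by rewrite ler_wpM2r ?(ltW t0)// lerDl.
by rewrite mulrC -ler_pdivlMr// ge_min lexx orbT.
Qed.

(** The derivative of h(u.1, z) exp(i c z), with c = s u.2, has integral 0; its two Leibniz terms
    are the two transforms. The constant M adds up all the bounds involved, so that one value serves
    for the function, its derivative and the remainder. *)
Lemma fou_parts s h u :
  fou s (D2 true h) u = - ('i%C * (s * u.2)%:C%C) * fou s h u.
Proof.
pose c := s * u.2.
pose f z := val h (u.1, z) * expi (c * z).
pose f' z := val (D2 true h) (u.1, z) * expi (c * z) +
  'i%C * c%:C%C * (val h (u.1, z) * expi (c * z)).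
have [W HW] := S2_wtaylor h.
pose Mh := wt2_norm h; pose Md := wt2_norm (D2 true h).
have w2_ge0 g : 0 <= wt2_norm g by rewrite addr_ge0 ?snorm2_ge0.
have W0 : 0 <= `|W| by [].
pose M := `|W| + 2 * `|c| * Md + 4 * c ^+ 2 * Mh + Mh + Md + `|c| * Mh.
have mf : cmeasurable1 f by exact: fou_measurable.
have mf' : cmeasurable1 f'.
  apply: cmeasurableD; first exact: fou_measurable.
  by apply: cmeasurableM; [exact: cmeasurable_cst|exact: fou_measurable].
have p1 : 0 <= 2 * `|c| * Md by rewrite mulr_ge0 ?mulr_ge0//; exact: w2_ge0.
have p2 : 0 <= 4 * c ^+ 2 * Mh by apply: mulr_ge0; [apply: mulr_ge0 => //; exact:
    sqr_ge0|exact: w2_ge0].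
have p3 : 0 <= `|c| * Mh by rewrite mulr_ge0//; exact: w2_ge0.
have p4 : 0 <= Mh by exact: w2_ge0.
have p5 : 0 <= Md by exact: w2_ge0.
have fM z : normc (f z) <= M * wt z.
  rewrite (le_trans (fou_le_wt s h u.1 u.2 z))// ler_wpM2r ?(ltW (wt_gt0 _))//.
  by rewrite /M; move: p1 p2 p3 p4 p5 W0; clear; rewrite -/Mh -/Md; lra.
have f'M z : normc (f' z) <= M * wt z.
  rewrite (@le_trans _ _ ((Md + `|c| * Mh) * wt z))//; last first.
    rewrite ler_wpM2r ?(ltW (wt_gt0 _))//.
    by rewrite /M; move: p1 p2 p3 p4 p5 W0; clear; rewrite -/Mh -/Md; lra.
  rewrite (le_trans (le_normcD _ _))// mulrDl lerD//.
    exact: (fou_le_wt s (D2 true h) u.1 u.2 z).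
  rewrite normc_iM -[leRHS]mulrA ler_wpM2l//.
  exact: (fou_le_wt s h u.1 u.2 z).
have taylor z t : normc (f (z + t) - f z - t%:C%C * f' z) <= M * t ^+ 2 * wt z.
  have H1 := HW u.1 z t.
  have H2 := normc_expiB (c * z) (c * z + c * t).
  have H3 := normc_expi_taylor (c * z) (c * t).
  have H4 := S2_wt2 h (u.1, z); have H5 := S2_wt2 (D2 true h) (u.1, z).
  move: H1 H2 H3 H4 H5; rewrite /f /f' mulrDr.
  set a := val h (u.1, z + t); set b := val h _; set d := val _ _.
  set e1 := expi (c * z + c * t); set e := expi (c * z).
  set X1 := (X in normc X) => H1; set X2 := (X in normc X) => H2.
  set X3 := (X in normc X) => H3 H4 H5.
  (* Remainder of a product: the remainder of h, the increment of the exponential times t h', and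
     the remainder of the exponential. *)
  have -> : a * e1 - b * e - t%:C%C * (d * e + 'i%C * c%:C%C * (b * e)) =
      X1 * e1 + t%:C%C * d * X2 + b * X3.
    by rewrite /X1 /X2 /X3 realcM; ring.
  rewrite (@le_trans _ _ ((`|W| + 2 * `|c| * Md + 4 * c ^+ 2 * Mh) * t ^+ 2 * wt z))//; last
      first.
    rewrite ler_wpM2r ?(ltW (wt_gt0 _))// ler_wpM2r ?sqr_ge0//.
    by rewrite /M; move: p1 p2 p3 p4 p5 W0; clear; rewrite -/Mh -/Md; lra.
  have wz := ltW (wt_gt0 z).
  rewrite (_ : (`|W| + 2 * `|c| * Md + 4 * c ^+ 2 * Mh) * t ^+ 2 * wt z =
    `|W| * t ^+ 2 * wt z + 2 * `|c| * Md * t ^+ 2 * wt z + 4 * c ^+ 2 * Mh * t ^+ 2 * wt z);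
    last by rewrite !mulrDl.
  rewrite (le_trans (le_normcD _ _))// lerD//.
    rewrite (le_trans (le_normcD _ _))// lerD//.
      rewrite normcM normc_expi mulr1 (le_trans H1)// ler_wpM2r// ler_wpM2r ?sqr_ge0//.
      exact: ler_norm.
    rewrite normcM normcMr.
    have -> : 2 * `|c| * Md * t ^+ 2 * wt z = `|t| * (Md * wt z) * (2 * (`|c| * `|t|)).
      by rewrite -[t ^+ 2]real_normK ?num_real//; ring.
    rewrite ler_pM ?mulr_ge0 ?normc_ge0//; first by rewrite ler_wpM2l.
    by rewrite (le_trans H2)// addrC addKr normrM.
  rewrite normcM.
  have -> : 4 * c ^+ 2 * Mh * t ^+ 2 * wt z = (Mh * wt z) * (4 * (c * t) ^+ 2) by ring.
  by rewrite ler_pM ?normc_ge0.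
have := integral_derive_eq0 mf mf' fM f'M taylor.
rewrite /f' cintegralD; [|exact: fou_integrable|]; last first.
  by apply: cintegrableZ; exact: fou_integrable.
rewrite cintegralZ; last exact: fou_integrable.
move=> /eqP; rewrite addr_eq0 => /eqP e.
by transitivity (- ('i%C * c%:C%C * fou s h u)); [exact: e|rewrite mulNr].
Qed.

(** Source of the decay in the transformed variable: each factor u.2 is exchanged for a derivative
    of h, at the cost of a constant of modulus 1. *)
Lemma fou_mulXr s h u : s ^+ 2 = 1 ->
  (u.2)%:C%C * fou s h u = 'i%C * s%:C%C * fou s (D2 true h) u.
Proof.
move=> s1; rewrite fou_parts.
have -> : 'i%C * s%:C%C * (- ('i%C * (s * u.2)%:C%C) * fou s h u) =
  - ('i%C * 'i%C) * (s ^+ 2)%:C%C * (u.2)%:C%C * fou s h u.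
  by rewrite !realcM; ring.
have -> : 'i%C * 'i%C = -1 :> C.
  by apply/eqP; rewrite eq_complex /=; apply/andP; split; apply/eqP; ring.
by rewrite opprK mul1r s1 mul1r.
Qed.

Lemma fou_schwartz s h : s ^+ 2 = 1 -> schwartz2 (fou s h).
Proof.
move=> s1; pose P := [set G : R * R -> C | exists h, G = fou s h].
suff : P `<=` schwartz2 by apply; exists h.
apply: schwartz2_coind => _ [h' ->].
  move=> k l; elim: k h' => [|k IHk] h'.
    elim: l h' => [|l IHl] h'.
      exists (2 * wtI * wt2_norm h') => u.
      by rewrite !expr0 mul1r mul1r; exact: fou_le.
    have [M HM] := IHl (D2 true h'); exists M => u; have := HM u.
    rewrite !expr0 !mul1r exprSr realcM -mulrA fou_mulXr// mulrCA.
    rewrite normc_iM.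
    suff -> : `|s| = 1 by rewrite mul1r.
    by apply/eqP; rewrite -sqrp_eq1// real_normK ?num_real// s1.
  have [M HM] := IHk (mulX false h'); exists M => u; have := HM u.
  by rewrite fou_mulX mulrA -realcM mulrAC -exprSr.
case; [exists (fou s (('i%C * s%:C%C) *: mulX true h'))|exists (fou s (D2 false h'))].
- by eexists.
- by move=> u; exact: fou_pderive2.
- by eexists.
- by move=> u; exact: fou_pderive1.
Qed.

Definition fourier s h : S2 R := toS2 (fou s h).

Lemma val_fourier s h : s ^+ 2 = 1 -> val (fourier s h) = fou s h.
Proof. by move=> s1; exact/val_toS2/fou_schwartz. Qed.

End integral_operators.

(** * Gaussians and Fourier inversion *)

Section gaussian_analysis.
Context {R : realType}.
Local Notation C := R[i].
Local Notation mu := (@lebesgue_measure R).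
Local Notation Rm := (measurableTypeR R).
Local Notation cmeasurable1 f := (@cmeasurable R _ Rm f).
Implicit Types (x y t M : R) (f g h H F : S2 R) (phi psi : S1 R).

Definition gS1 (a b : R) : S1 R := toS1 (fun x => (gaussian a b x)%:C%C).

Lemma val_gS1 a b : 0 < a -> val (gS1 a b) = fun x => (gaussian a b x)%:C%C.
Proof. by move=> a0; apply/val_toS1/(gauss_span_schwartz a0)/gauss_span_base. Qed.

Local Notation G := (gaussian 2^-1 0 : R -> R).

Lemma half_gt0 : 0 < 2^-1 :> R. Proof. by rewrite invr_gt0. Qed.

Lemma gaussian_half_integral : cintegral mu (fun z => (G z)%:C%C : C) = (Num.sqrt (2 * pi))%:C%C.
Proof.
have gi : mu.-integrable setT (EFin \o (@gauss_fun R : Rm -> R)) by exact: integrableT_gauss.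
have s0 : 0 < (Num.sqrt 2)^-1 :> R by rewrite invr_gt0 sqrt2_gt0.
have E := Rintegral_affine 0 s0 gi.
rewrite /cintegral; congr Complex; last by rewrite /= Rintegral_cst//= mul0r.
transitivity (\int[mu]_x gauss_fun ((Num.sqrt 2)^-1 * x + 0)).
  apply: eq_Rintegral => x _; rewrite /= /gaussian /gauss_fun subr0 addr0 exprMn.
  by rewrite exprVn sqrt2_sqr.
rewrite E invrK sqrtrM//; congr *%R.
by rewrite /Rintegral integralT_gauss.
Qed.

(* The Gaussian is its own Fourier transform: both solve y' = - x y. *)
Lemma fourier_gaussian s y : s ^+ 2 = 1 ->
  cintegral mu (fun z => (G z)%:C%C * expi (s * y * z)) = (Num.sqrt (2 * pi) * G y)%:C%C.
Proof.
move=> s1; pose gam := gS1 2^-1 0.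
have gE z : val gam z = (G z)%:C%C by rewrite val_gS1// half_gt0.
(* The statement concerns one variable while [fou] acts on two; since G(0) = 1, the slice of h at 0
   is the Gaussian itself. *)
pose h := tensor gam gam.
have g0 : G 0 = 1 by rewrite /gaussian subrr expr0n mulr0 oppr0 expR0.
have hE z : val h (0, z) = (G z)%:C%C by rewrite val_tensor/= !gE g0 mul1r.
pose gm y := cintegral mu (fun z => (G z)%:C%C * expi (s * y * z)).
have gmE z : gm z = fou s h (0, z).
  by congr cintegral; apply/funext => w; rewrite hE.
have DhE z : fou s (('i%C * s%:C%C) *: mulX true h) (0, z) =
    - ('i%C * s%:C%C) * fou s (D2 true h) (0, z).
  rewrite /fou -cintegralZ; last exact: fou_integrable.
  congr cintegral; apply/funext => w.
  rewrite -[val (_ *: _) _]/('i%C * s%:C%C * val (mulX true h) (0, w)) val_mulX hE val_D2.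
  rewrite /pderive/= (_ : (fun t => val h (0, t)) = fun t => (G t)%:C%C); last exact/funext.
  rewrite (cderive_gaussian _ _ w).2.
  have -> : - 2 * 2^-1 * (w - 0) * G w = - (w * G w).
    by rewrite subr0 mulNr divff// mulN1r mulNr.
  rewrite realcN realcM.
  by rewrite !mulNr mulrN opprK !mulrA.
have dgm z : cderivable gm z /\ cderive gm z = - z%:C%C * gm z.
  have -> : gm = fun z => fou s h (0, z) by apply/funext.
  have [p1 p2] := fou_pderive2 s h (0, z); split; first exact: p1.
  rewrite [LHS]p2 DhE fou_parts /= -gmE.
  have ii : 'i%C * 'i%C = -1 :> C.
    by apply/eqP; rewrite eq_complex /=; apply/andP; split; apply/eqP; ring.
  have -> : - ('i%C * s%:C%C) * (- ('i%C * (s * z)%:C%C) * gm z) =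
      'i%C * 'i%C * (s ^+ 2)%:C%C * z%:C%C * gm z.
    by rewrite expr2 !realcM; move: (gm z) => p; ring.
  by rewrite ii s1 mulr1 mulN1r.
(* With a negative parameter this is exp(z^2 / 2), the inverse of G. The product with the transform
   has derivative 0, hence is Lipschitz with constant 0 and equal to its value at 0. *)
pose k z := (gaussian (- 2^-1) 0 z)%:C%C : C.
have kd z : cderivable (gm * (k : R -> C)) z /\ cderive (gm * (k : R -> C)) z = 0.
  have [k1 k2] := cderive_gaussian (- 2^-1) 0 z.
  have [m1 m2] := cderivableM (dgm z).1 k1; split; first exact: m1.
  rewrite [LHS]m2 (dgm z).2 k2 subr0.
  have -> : - 2 * - 2^-1 * z * gaussian (- 2^-1) 0 z = z * gaussian (- 2^-1) 0 z.
    by rewrite mulrNN divff// mul1r.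
  by rewrite realcM /k; ring.
have L := @clipschitz _ (gm * (k : R -> C)) 0 (fun z => (kd z).1) _ 0 y.
have : gm y * k y = gm 0 * k 0.
  apply/eqP; rewrite -subr_eq0; apply/eqP/eq0_normc/eqP; rewrite eq_le normc_ge0 andbT.
  have := L; rewrite mulr0 mul0r; apply => z; rewrite (kd z).2 normc0 //.
have -> : k 0 = 1 by rewrite /k /gaussian subrr expr0n mulr0 oppr0 expR0.
have -> : gm 0 = (Num.sqrt (2 * pi))%:C%C.
  rewrite -gaussian_half_integral /gm; congr cintegral; apply/funext => z.
  by rewrite mulr0 mul0r expi0 mulr1.
have kG : k y * (G y)%:C%C = 1.
  by rewrite /k -realcM /gaussian -expRD mulNr opprK subr0 addrN expR0.
by rewrite mulr1 => e; rewrite -/(gm y) realcM -e -mulrA kG mulr1.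
Qed.

Lemma gaussian_wt : exists2 K, 0 <= K & forall w, `|w| * G w <= K * wt w.
Proof.
have [A HA] := gaussian_bound 0 1 half_gt0; have [B HB] := gaussian_bound 0 3 half_gt0.
exists (A + B).
  rewrite addr_ge0//; [apply: le_trans (HA 0)|apply: le_trans (HB 0)];
  by rewrite mulr_ge0 ?exprn_ge0// ltW// gaussian_gt0.
move=> w; have -> : `|w| * G w = normc (`|w| * G w)%:C%C.
  by rewrite normc_real normrM normr_id (gtr0_norm (gaussian_gt0 _ _ _)).
apply: wt_bound; rewrite normc_real normrM normr_id (gtr0_norm (gaussian_gt0 _ _ _)).
  by have := HA w; rewrite expr1.
by have := HB w; rewrite mulrA -exprSr.
Qed.

Lemma gS1_integrable a b : 0 < a -> cintegrable mu (fun z => (gaussian a b z)%:C%C : C).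
Proof. by move=> a0; rewrite -val_gS1//; exact: S1_integrable. Qed.

Lemma cmeasurable_gaussian a b : 0 < a -> cmeasurable1 (fun z => (gaussian a b z)%:C%C : C).
Proof. by move=> a0; rewrite -val_gS1//; exact: cmeasurable_S1. Qed.

Lemma gaussian_mul_integrable (f : R -> C) N : cmeasurable1 f -> (forall z, normc (f z) <= N) ->
  cintegrable mu (fun z => (G z)%:C%C * f z).
Proof.
move=> mf fN; have := S1_wt (gS1 2^-1 0); rewrite val_gS1 ?half_gt0//.
pose A := snorm1 (0, 0)%N (gS1 2^-1 0) + snorm1 (2, 0)%N (gS1 2^-1 0).
rewrite -/A => HA.
apply: (@cintegrable_wt _ _ (A * N)).
  by apply: cmeasurableM => //; exact: cmeasurable_gaussian half_gt0.
move=> z; rewrite normcM mulrAC ler_pM ?normc_ge0//; exact: HA.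
Qed.

(** The error is at most the Gaussian average of L e |w|, so K comes from a first moment and depends
    on neither f nor y. This uniformity later yields estimates in whole seminorms and not only at
    points. *)
Lemma approx_identity : exists2 K, 0 <= K & forall (f : R -> C) y L N e,
  cmeasurable1 f -> (forall z, normc (f z) <= N) -> 0 <= L ->
  (forall z, normc (f z - f y) <= L * `|z - y|) -> 0 < e ->
  normc (cintegral mu (fun w => (G w)%:C%C * f (e * w + y))
         - (Num.sqrt (2 * pi))%:C%C * f y) <= K * L * e.
Proof.
have [K0 K00 HK0] := gaussian_wt.
exists (2 * wtI * K0); first by rewrite mulr_ge0// mulr_ge0// wtI_ge0.
move=> f y L N e mf fN L0 fL e0.
have mg : cmeasurable1 (fun w => f (e * w + y)).
  by apply: cmeasurable_comp mf _; apply: measurable_funD => //; exact: measurable_funM.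
have gi := gaussian_mul_integrable mg (fun w => fN (e * w + y)).
have gc : cintegrable mu (fun z => (G z)%:C%C * f y).
  by apply: (@gaussian_mul_integrable _ N); [exact: cmeasurable_cst|move=> _; exact: fN].
have -> : (Num.sqrt (2 * pi))%:C%C * f y = cintegral mu (fun z => (G z)%:C%C * f y).
  rewrite -gaussian_half_integral mulrC -cintegralZ; last exact: gS1_integrable half_gt0.
  by congr cintegral; apply/funext => z; rewrite mulrC.
rewrite -cintegralB// (_ : 2 * wtI * K0 * L * e = 2 * wtI * (K0 * L * e)); last by rewrite !mulrA.
apply: cintegral_wt.
  apply: cmeasurableD.
    by apply: cmeasurableM => //; exact: cmeasurable_gaussian half_gt0.
  by apply: cmeasurableN; apply: cmeasurableM;
    [exact: cmeasurable_gaussian half_gt0|exact: cmeasurable_cst].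
move=> z; rewrite -mulrBr normcMr gtr0_norm ?gaussian_gt0//.
rewrite (le_trans (ler_wpM2l (ltW (gaussian_gt0 _ _ _)) (fL _)))//.
rewrite addrK normrM (gtr0_norm e0).
have idE (a b c r : R) : a * (b * (c * r)) = b * c * (r * a) by ring.
rewrite idE (_ : K0 * L * e * wt z = L * e * (K0 * wt z)); last first.
  by rewrite -[_ * L * e]mulrA [K0 * _]mulrC mulrA.
by rewrite ler_wpM2l// mulr_ge0// ltW.
Qed.

Lemma normc_eq0_linear (a : C) K : (forall e, 0 < e -> e <= 1 -> normc a <= K * e) -> a = 0.
Proof.
move=> H; apply: eq0_normc; apply/eqP; rewrite eq_le normc_ge0 andbT.
have K0 : 0 <= K by have := H 1 ltr01 (lexx _); rewrite mulr1; apply: le_trans; exact: normc_ge0.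
apply/ler_addgt0Pl => e e0; rewrite addr0.
have K1 : 0 < K + 1 by rewrite ltr_wpDl.
pose t := Num.min 1 (e / (K + 1)).
have t0 : 0 < t by rewrite lt_min ltr01 divr_gt0.
rewrite (le_trans (H t t0 _)) ?ge_min ?lexx//.
rewrite (@le_trans _ _ ((K + 1) * t))// ?ler_wpM2r ?(ltW t0) ?lerDl//.
by rewrite mulrC -ler_pdivlMr// ge_min lexx orbT.
Qed.

Lemma S1_mul_integrable phi psi : cintegrable mu (fun x => val phi x * val psi x).
Proof.
apply: (@cintegrable_wt _ _ (snorm1 (0, 0)%N phi *
     (snorm1 (0, 0)%N psi + snorm1 (2, 0)%N psi))).
  by apply: cmeasurableM; exact: cmeasurable_S1.
by move=> z; rewrite normcM -mulrA ler_pM ?normc_ge0//; [exact: S1_le|exact: S1_wt].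
Qed.

(** The normal density of mean y and standard deviation e: a Dirac mass at y approximated by a
    Schwartz function, so that it may serve as a test function. *)
Definition delta_S1 (e y : R) : S1 R :=
  ((e * Num.sqrt (2 * pi))^-1)%:C%C *: gS1 (2 * e ^+ 2)^-1 y.

Lemma delta_approx : exists2 K, 0 <= K & forall (f : R -> C) y L N e,
  cmeasurable1 f -> (forall z, normc (f z) <= N) -> 0 <= L ->
  (forall z, normc (f z - f y) <= L * `|z - y|) -> 0 < e ->
  normc (cintegral mu (fun x => val (delta_S1 e y) x * f x) - f y) <= K * L * e.
Proof.
have [K K0 HK] := approx_identity.
have p0 : 0 < Num.sqrt (2 * pi) :> R by rewrite sqrtr_gt0 mulr_gt0// pi_gt0.
set P := Num.sqrt (2 * pi) in p0 *.
exists (P^-1 * K) => [|f y L N e mf fN L0 fL e0]; first by rewrite mulr_ge0// invr_ge0 ltW.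
have a0 : 0 < (2 * e ^+ 2)^-1 by rewrite invr_gt0 mulr_gt0// exprn_gt0.
pose d := gS1 (2 * e ^+ 2)^-1 y.
have fg : cintegrable mu (fun z => val d z * f z).
  apply: (@cintegrable_wt _ _ (N * (snorm1 (0, 0)%N d + snorm1 (2, 0)%N d))).
    by apply: cmeasurableM => //; exact: cmeasurable_S1.
  by move=> z; rewrite mulrC normcM -mulrA ler_pM ?normc_ge0//; exact: S1_wt.
have S : cintegral mu (fun w => (G w)%:C%C * f (e * w + y)) =
    (e^-1)%:C%C * cintegral mu (fun z => val d z * f z).
  rewrite -(@cintegral_affine _ _ e y e0)//.
  congr cintegral; apply/funext => w; rewrite /d val_gS1//; congr (_%:C%C * _).
  rewrite /gaussian addrK subr0 exprMn; congr (expR (- _)).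
  by rewrite invfM -mulrA mulKf// expf_neq0// gt_eqF.
have Zf := cintegralZ ((e * P)^-1)%:C%C fg.
rewrite (_ : cintegral _ _ = (P^-1)%:C%C * cintegral mu (fun w => (G w)%:C%C * f (e * w + y)));
    last first.
  rewrite S mulrA -realcM -invfM [P * e]mulrC -Zf; congr cintegral.
  by apply/funext => x; rewrite mulrA.
set J := cintegral _ _; rewrite -[f y in X in normc X]mul1r.
rewrite (_ : 1 = (P^-1)%:C%C * P%:C%C); last by rewrite -realcM mulVf// gt_eqF.
rewrite -[_ * _ * f y]mulrA -mulrBr normcMr gtr0_norm ?invr_gt0//.
rewrite -!mulrA ler_pM2l ?invr_gt0// mulrA.
exact: (HK _ y _ _ e mf fN L0 fL e0).
Qed.

Lemma delta_S1_approx : exists2 K, 0 <= K & forall (f : S1 R) y e, 0 < e ->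
  normc (cintegral mu (fun x => val f x * val (delta_S1 e y) x) - val f y)
    <= K * snorm1 (0, 1)%N f * e.
Proof.
have [K K0 HK] := delta_approx.
exists (K * 2) => [|f y e e0]; first by rewrite mulr_ge0.
rewrite -[K * 2 * _]mulrA; under eq_fun do rewrite mulrC.
apply: (HK _ y _ _ e (cmeasurable_S1 f) (S1_le f)) => //.
  by rewrite mulr_ge0// snorm1_ge0.
by move=> z; exact: (S1_lipschitz f 0 y z).
Qed.

(** Testing with [delta_S1 e y] shows that the values at y differ by O(e) for every e. *)
Lemma S1_dual_separates phi psi :
  (forall chi : S1 R, cintegral mu (fun x => val phi x * val chi x)
     = cintegral mu (fun x => val psi x * val chi x)) -> phi = psi.
Proof.
move=> H; apply: val_inj; apply/funext => y; apply/eqP; rewrite -subr_eq0; apply/eqP.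
have [K K0 HK] := delta_S1_approx.
apply: (@normc_eq0_linear _ (K * snorm1 (0, 1)%N phi + K * snorm1 (0, 1)%N psi)) => e e0 _.
have := HK phi y e e0; have := HK psi y e e0; rewrite H.
set I := cintegral _ _ => h1 h2.
rewrite (_ : _ - _ = (I - val psi y) - (I - val phi y)); last first.
  by rewrite opprB [RHS]addrC subrKA.
apply: (le_trans (le_normcB _ _)); rewrite mulrDl addrC; exact: (lerD h2 h1).
Qed.

Lemma gaussian_scaled_fourier s e r : s ^+ 2 = 1 -> 0 < e ->
  cintegral mu (fun y => (G (e * y))%:C%C * expi (s * r * y)) =
  (e^-1 * (Num.sqrt (2 * pi) * G (r / e)))%:C%C.
Proof.
move=> s1 e0; rewrite realcM -(fourier_gaussian (r / e) s1).
rewrite -(cintegral_affine 0 e0); last first.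
  have := gaussian_mul_integrable (cmeasurable_expiZ (s * (r / e))) (N := 1); apply => z.
  by rewrite normc_expi.
congr cintegral; apply/funext => y; rewrite addr0; congr (_ * expi _).
by rewrite mulrA -[s * (r / e) * e]mulrA divfK// gt_eqF.
Qed.

Lemma expR_le_quadratic (a : R) : 0 <= a -> 0 <= 1 - expR (- a) <= a.
Proof.
move=> a0; rewrite subr_ge0 -[X in _ <= X]expR0 ler_expR oppr_le0 a0/=.
by rewrite lerBlDr -lerBlDl -[leLHS]/(1 - a) expR_ge1Dx.
Qed.

(* Fourier inversion, by inserting the factor G (e y), whose transform is an
   approximate identity. *)
Lemma fourier_inversion s h u : s ^+ 2 = 1 ->
  fou (- s) (fourier s h) u = (2 * pi)%:C%C * val h u.
Proof.
move=> s1; case: u => x y0.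
have sN : (- s) ^+ 2 = 1 by rewrite sqrrN.
pose P := (Num.sqrt (2 * pi) : R).
have PP : P * P = 2 * pi by rewrite -expr2 sqr_sqrtr// mulr_ge0// pi_ge0.
have P0 : 0 <= P by rewrite sqrtr_ge0.
have HE : val (fourier s h) = fou s h by exact: val_fourier.
have mphi := S2_cmeasurable_r h x.
have mPhi := S2_cmeasurable_r (fourier s h) x.
have mG e : cmeasurable1 (fun y => (G (e * y))%:C%C : C).
  apply: cmeasurable_comp (cmeasurable_gaussian 0 half_gt0) _; exact: measurable_funM.
have Gi e : 0 < e -> cintegrable mu (fun y => (G (e * y))%:C%C : C).
  move=> e0; have := cintegrable_affine 0 e0 (gS1_integrable 0 half_gt0).
  by under eq_fun do rewrite addr0.
have G1 y : normc (G y)%:C%C <= 1.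
  by rewrite normc_real gtr0_norm ?gaussian_gt0// gaussian_le1// half_gt0.
pose J y := val (fourier s h) (x, y) * expi (- s * y0 * y).
have Jm : cmeasurable1 J by exact: fou_measurable.
have Ji : cintegrable mu J by exact: fou_integrable.
(* The regularized inversion integral. The factor G(e y) makes the double integral absolutely
   convergent, so [I1] may exchange the integrations. *)
pose I e := cintegral mu (fun y => J y * (G (e * y))%:C%C).
have I1 e : 0 < e -> I e = P%:C%C * cintegral mu (fun w => (G w)%:C%C * val h (x, e * w + y0)).
  move=> e0; pose f (yz : R * R) := (G (e * yz.1))%:C%C *
    (expi (s * (yz.2 - y0) * yz.1) * val h (x, yz.2)).
  have fE y z : f (y, z) = (G (e * y))%:C%C * expi (- s * y0 * y) * (val h (x, z) * expi (s * y
      * z)).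
    rewrite /f /= (_ : s * (z - y0) * y = - s * y0 * y + s * y * z); last by ring.
    by rewrite expiD -!mulrA; congr (_ * (_ * _)); rewrite mulrC.
  have -> : I e = cintegral mu (fun y => cintegral mu (fun z => f (y, z))).
    congr cintegral; apply/funext => y.
    rewrite (_ : (fun z => f (y, z)) = fun z => (G (e * y))%:C%C * expi (- s * y0 * y) *
      (val h (x, z) * expi (s * y * z))); last by apply/funext => z; exact: fE.
    rewrite cintegralZ; last exact: fou_integrable.
    rewrite /J HE -[cintegral _ _]/(fou s h (x, y)).
    by rewrite [LHS]mulrC [X in _ * X = _]mulrC mulrA.
  have fm : @cmeasurable R _ (Rm * Rm)%type f.
    apply: cmeasurableM; first exact: cmeasurable_comp (mG e) measurable_fst.
    apply: cmeasurableM; last exact: cmeasurable_comp mphi measurable_snd.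
    apply: cmeasurable_expi; apply: measurable_funM => //.
    by apply: measurable_funM => //; apply: measurable_funB => //; exact: measurable_snd.
  have fb y z : normc (f (y, z)) <= G (e * y) * (wt2_norm h * wt z).
    rewrite /f normcMr gtr0_norm ?gaussian_gt0// ler_wpM2l// ?(ltW (gaussian_gt0 _ _ _))//.
    by rewrite normcM normc_expi mul1r; exact: (S2_wt2 h (x, z)).
  rewrite (cfubini fm (Gi e e0).1 (integrable_wtZ _) fb).
  pose F z := (G ((z - y0) / e))%:C%C * val h (x, z).
  have Fm : cmeasurable1 F.
    apply: cmeasurableM => //.
    apply: cmeasurable_comp (cmeasurable_gaussian 0 half_gt0) _.
    by apply: measurable_funM => //; exact: measurable_funB.
  have Fi : cintegrable mu F.
    apply: (cintegrable_wt (M := wt2_norm h)) => // z.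
    rewrite normcM -[leRHS]mul1r ler_pM ?normc_ge0//; exact: (S2_wt2 h (x, z)).
  have -> : (fun z => cintegral mu (fun y => f (y, z))) = fun z => (e^-1 * P)%:C%C * F z.
    apply/funext => z; rewrite /F mulrA -realcM -mulrA /P -(gaussian_scaled_fourier (z - y0) s1
        e0).
    rewrite mulrC -cintegralZ; last first.
      apply: (cintegrable_dominated _ (Gi e e0).1).
        by apply: cmeasurableM => //; exact: cmeasurable_expiZ.
      move=> y; rewrite normcMr normc_expi mulr1 gtr0_norm ?gaussian_gt0//.
    by congr cintegral; apply/funext => y; rewrite /f/= mulrA mulrC.
  have A := cintegral_affine y0 e0 Fi.
  have Z := cintegralZ (e^-1 * P)%:C%C Fi.
  transitivity ((e^-1 * P)%:C%C * cintegral mu F); first exact: Z.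
  transitivity (P%:C%C * ((e^-1)%:C%C * cintegral mu F)).
    by rewrite [e^-1 * P]mulrC realcM mulrA.
  rewrite -A.
  congr (_ * cintegral _ _); apply/funext => w.
  by rewrite /F addrK [e * w]mulrC mulfK ?gt_eqF.
have [K K0 HK] := approx_identity.
pose L := 2 * snorm2 (0, 0, [:: true])%N h.
have L0 : 0 <= L by rewrite mulr_ge0// snorm2_ge0.
have lip z : normc (val h (x, z) - val h (x, y0)) <= L * `|z - y0|.
  have := S2_lipschitz h true 0 [::] (x, y0) (z - y0).
  by rewrite expr0 mul1r /shift/= [y0 + _]addrC subrK.
(* Removing the factor G(e y) costs at most e y^2; against [wt] this calls for the moments 2 and 4
   of the transform. *)
pose M := snorm2 (0, 2, [::])%N (fourier s h) + snorm2 (0, 4, [::])%N (fourier s h).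
apply/eqP; rewrite -subr_eq0; apply/eqP.
apply: (@normc_eq0_linear _ (2 * wtI * M + P * (K * L))) => e e0 e1.
rewrite -[fou _ _ _]/(cintegral mu J) -(subrKA (I e)) (le_trans (le_normcD _ _))//
    [leRHS]mulrDl lerD//.
  rewrite -cintegralB//; last first.
    apply: (cintegrable_wt (M := wt2_norm (fourier s h))).
      by apply: cmeasurableM => //.
    move=> y; rewrite normcM -[leRHS]mulr1 ler_pM ?normc_ge0//; exact: fou_le_wt.
  rewrite -[leRHS]mulrA; apply: cintegral_wt.
    apply: cmeasurableD => //; apply: cmeasurableN; exact: cmeasurableM.
  move=> y; rewrite -{1}[J y]mulr1 -mulrBr /J normcM normcM normc_expi mulr1.
  have /andP[q0 q1] : 0 <= 1 - G (e * y) <= 2^-1 * (e * y) ^+ 2.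
    by rewrite /gaussian subr0; apply: expR_le_quadratic; rewrite mulr_ge0 ?sqr_ge0.
  have -> : normc (1 - (G (e * y))%:C%C) = 1 - G (e * y).
    by rewrite -[1 - (G (e * y))%:C%C]/((1 : R)%:C%C - _) -rmorphB/= normc_real ger0_norm.
  (* The true order is e^2; since e <= 1 it is weakened to e, to match the rate of the approximate
     identity. *)
  have q2 : 1 - G (e * y) <= e * `|y| ^+ 2.
    rewrite (le_trans q1)// exprMn real_normK ?num_real// mulrA ler_wpM2r ?sqr_ge0//.
    by nra.
  rewrite (le_trans (ler_wpM2l (normc_ge0 _) q2))// mulrCA [M * e]mulrC -mulrA ler_wpM2l ?(ltW
      e0)//.
  have := S2_weight_le (fourier s h) 0 4 (x, y); have := S2_weight_le (fourier s h) 0 2 (x, y).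
  rewrite !expr0 !mul1r /= => h2 h4.
  rewrite /wt /M ler_pdivlMr ?oneD_gt0// -[y ^+ 2]real_normK ?num_real//.
  by rewrite mulrDr mulr1 lerD// 1?mulrC// mulrCA -exprD mulrC.
rewrite I1// -PP realcM -mulrA -mulrBr normcMr ger0_norm// -mulrA ler_wpM2l//.
exact: (HK _ y0 L _ e mphi (fun z => S2_le h (x, z)) L0 lip e0).
Qed.

End gaussian_analysis.

#[local] Opaque comp fourier gS1.

(** * The twisted product in Wigner coordinates *)

Section moyal_factorization.
Context {R : realType}.
Local Notation C := R[i].
Local Notation mu := (@lebesgue_measure R).
Local Notation mu2 := (mu \x mu)%E.
Local Notation Rm := (measurableTypeR R).
Local Notation cmeasurable1 f := (@cmeasurable R _ Rm f).
Local Notation cmeasurable2 f := (@cmeasurable R _ (Rm * Rm)%type f).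
Implicit Types (x y t M : R) (f g h H F : S2 R) (phi psi : S1 R).

Local Notation P := (Num.sqrt (2 * pi) : R).

Lemma sqrt2pi_gt0 : 0 < P.
Proof. by rewrite sqrtr_gt0 mulr_gt0// pi_gt0. Qed.

Lemma sqrt2pi_sqr : P * P = 2 * pi.
Proof. by rewrite -expr2 sqr_sqrtr// mulr_ge0// pi_ge0. Qed.

Lemma sqrt2pi_inv : P^-1 * P^-1 * (2 * pi) = 1.
Proof. by rewrite -invfM sqrt2pi_sqr mulVf// gt_eqF// mulr_gt0// pi_gt0. Qed.

Lemma val_scale (a : C) f u : val (a *: f) u = a * val f u.
Proof. by []. Qed.

Lemma one_sqr : (1 : R) ^+ 2 = 1. Proof. by rewrite expr1n. Qed.
Lemma oneN_sqr : (- 1 : R) ^+ 2 = 1. Proof. by rewrite sqrrN expr1n. Qed.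

Definition Fp f : S2 R := (P^-1)%:C%C *: fourier 1 f.
Definition Fm f : S2 R := (P^-1)%:C%C *: fourier (-1) f.

Lemma fouZ s (a : C) f u : fou s (a *: f) u = a * fou s f u.
Proof.
rewrite /fou -cintegralZ; last exact: fou_integrable.
by congr cintegral; apply/funext => z; rewrite val_scale mulrA.
Qed.

Lemma val_Fp f u : val (Fp f) u = (P^-1)%:C%C * fou 1 f u.
Proof. by rewrite val_scale val_fourier// one_sqr. Qed.

Lemma val_Fm f u : val (Fm f) u = (P^-1)%:C%C * fou (-1) f u.
Proof. by rewrite val_scale val_fourier// oneN_sqr. Qed.

Lemma Fp_Fm f : Fp (Fm f) = f.
Proof.
apply: val_inj; apply/funext => u; rewrite val_Fp /Fm fouZ.
have := fourier_inversion f u oneN_sqr; rewrite opprK => ->.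
by rewrite !mulrA -!realcM sqrt2pi_inv mul1r.
Qed.

Lemma Fm_Fp f : Fm (Fp f) = f.
Proof.
apply: val_inj; apply/funext => u; rewrite val_Fm /Fp fouZ.
rewrite fourier_inversion ?one_sqr//.
by rewrite !mulrA -!realcM sqrt2pi_inv mul1r.
Qed.

Lemma Wbarinv_fourier f : Wbarinv f = Fp (rot f).
Proof.
rewrite /Wbarinv (_ : (fun u => _) = val (Fp (rot f))); last first.
  apply/funext => u; rewrite val_Fp; congr (_ * _); congr cintegral.
  by apply/funext => z; rewrite val_rot mul1r.
by apply: val_inj; rewrite val_toS2//; exact: S2P.
Qed.

Definition Wbar f : S2 R := rot (Fm f).

Lemma WbarK : cancel Wbar Wbarinv.
Proof. by move=> f; rewrite Wbarinv_fourier /Wbar rotK Fp_Fm. Qed.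

Lemma WbarinvK : cancel Wbarinv Wbar.
Proof. by move=> f; rewrite Wbarinv_fourier /Wbar Fm_Fp rotK. Qed.

(** Changing the sign of p turns the transform with sign 1 into the one with sign -1, which is
    [Wbar] read through [rotation]. All transforms arising from the twisted product are converted by
    this identity. *)
Lemma fou_oneE f q p : fou 1 f (q, p) = P%:C%C * val (Wbar f) (rotation (q, - p)).
Proof.
rewrite /Wbar val_rot rotationK val_Fm mulrA -realcM divff ?gt_eqF ?sqrt2pi_gt0// mul1r.
by congr cintegral; apply/funext => z; rewrite mul1r mulN1r opprK.
Qed.

Lemma cintegrable_swap (k : R * R -> C) A B : cmeasurable2 k ->
  (forall x y, normc (k (x, y)) <= A * wt x * (B * wt y)) ->
  cintegrable mu (fun y => cintegral mu (fun x => k (x, y))).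
Proof.
move=> mk kM.
have mk' : cmeasurable2 (fun u => k (u.2, u.1)).
  by apply: cmeasurable_comp mk _; apply: measurable_fun_pair;
    [exact: measurable_snd|exact: measurable_fst].
apply: (cintegrable_fubini1 mk' (integrable_wtZ B) (integrable_wtZ A)) => x y.
by rewrite mulrC.
Qed.

Lemma cintegral_swap2 (k : R * R -> C) M : cmeasurable2 k ->
  (forall x y, normc (k (x, y)) <= M * wt x * wt y) ->
  cintegral mu2 k = cintegral mu (fun x => cintegral mu (fun y => k (x, y))) /\
  cintegral mu (fun x => cintegral mu (fun y => k (x, y))) =
  cintegral mu (fun y => cintegral mu (fun x => k (x, y))).
Proof.
move=> mk kM; split.
  exact: (cfubini1 mk (integrable_wtZ M) integrable_wt kM).
exact: (cfubini mk (integrable_wtZ M) integrable_wt kM).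
Qed.

(** With [rotation_shear']: the second coordinate of the point for g equals the first coordinate of
    the point for f. This common value is the variable z of the kernel composition, and the two
    outer coordinates are those of [rotation (q, t)]. *)
Lemma rotation_shear q q1 t :
  rotation (q1, - (q - (q1 + t))) = (Num.sqrt 2 * q1 + (t - q) / Num.sqrt 2, (q - t) / Num.sqrt
      2).
Proof.
have n0 : Num.sqrt 2 != 0 :> R by rewrite gt_eqF// sqrt2_gt0.
have s2 := @sqrt2_sqr R.
rewrite /rotation/=; congr pair; apply: (mulIf n0); rewrite ?mulrDl !divfK//; last by ring.
by rewrite mulrAC -expr2 s2; ring.
Qed.

Lemma rotation_shear' q q1 t :
  rotation (q1 + t, - (q1 - q)) = ((q + t) / Num.sqrt 2, Num.sqrt 2 * q1 + (t - q) / Num.sqrt 2).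
Proof.
have n0 : Num.sqrt 2 != 0 :> R by rewrite gt_eqF// sqrt2_gt0.
have s2 := @sqrt2_sqr R.
rewrite /rotation/=; congr pair; apply: (mulIf n0); rewrite ?mulrDl !divfK//; first by ring.
by rewrite mulrAC -expr2 s2; ring.
Qed.

Lemma wt12_norm_ge0 f : 0 <= wt12_norm f.
Proof. by rewrite !addr_ge0 ?snorm2_ge0. Qed.

(** The phase is affine in the momentum p2 of w = (q2, p2), with slope v.1 - q, so the p2-integral
    is a partial transform of g. *)
Lemma twisted_inner f g q p v :
  cintegral mu2 (fun w => val f v * val g w * expi (symp (q, p) v + symp v w + symp w (q, p)))
  = val f v * cintegral mu (fun q2 => expi (v.2 * (q - q2)) * expi (p * (q2 - v.1)) *
     fou 1 g (q2, v.1 - q)).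
Proof.
pose k (w : R * R) := val f v * val g w * expi (symp (q, p) v + symp v w + symp w (q, p)).
have kE q2 p2 : k (q2, p2) = val f v * (expi (v.2 * (q - q2)) * expi (p * (q2 - v.1))) *
    (val g (q2, p2) * expi (1 * (v.1 - q) * p2)).
  rewrite /k (_ : symp (q, p) v + symp v (q2, p2) + symp (q2, p2) (q, p) =
    v.2 * (q - q2) + p * (q2 - v.1) + 1 * (v.1 - q) * p2); last by rewrite /symp/=; ring.
  by rewrite !expiD -!mulrA; congr (_ * _); rewrite mulrCA; congr (_ * _); rewrite mulrCA.
have mk : cmeasurable2 k.
  apply: cmeasurableM; first by apply: cmeasurableM; [exact: cmeasurable_cst|exact:
      cmeasurable_S2].
  apply: cmeasurable_expi; rewrite /symp; apply: measurable_funD.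
    by apply: measurable_funD => //; apply: measurable_funB;
      apply: measurable_funM => //; exact: measurable_snd.
  by apply: measurable_funB; apply: measurable_funM => //; exact: measurable_snd.
have kM x y : normc (k (x, y)) <= normc (val f v) * wt12_norm g * wt x * wt y.
  rewrite /k normcM normc_expi mulr1 normcM -!mulrA ler_wpM2l ?normc_ge0//.
  exact: (S2_wt12 g (x, y)).
rewrite (cintegral_swap2 mk kM).1.
have fou1b q2 : normc (fou 1 g (q2, v.1 - q)) <= wt1_norm (fourier 1 g) * wt q2.
  by have := S2_wt1 (fourier 1 g) (q2, v.1 - q); rewrite val_fourier ?one_sqr.
rewrite -cintegralZ; last first.
  apply: (cintegrable_wt (M := wt1_norm (fourier 1 g))).
    apply: cmeasurableM.
      apply: cmeasurableM; apply: cmeasurable_expi; apply: measurable_funM => //;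
      exact: measurable_funB.
    by have := S2_cmeasurable_l (fourier 1 g) (v.1 - q); rewrite val_fourier ?one_sqr.
  by move=> q2; rewrite normcM normcM !normc_expi !mul1r.
congr cintegral; apply/funext => q2.
under eq_fun do rewrite kE.
by rewrite cintegralZ ?mulrA//; exact: fou_integrable.
Qed.

Lemma k2_algebra (A B c X a e : R) : X * a = 1 ->
  A * (2 * c * 2) * B * a * e = A * (2 * X * e * (2 * c * a)) * (B * a).
Proof.
move=> Xa; transitivity (A * (2 * c * 2) * B * (X * a) * a * e).
  by rewrite Xa mulr1.
by ring.
Qed.

Lemma mul_perm4 (a b e r : C) : e * (r * a * (r * b)) = r * r * e * (a * b).
Proof. by ring. Qed.

Lemma mul_perm6 (A B a b : R) : A * B * (a * a) * (b * b) = A * (a * b) * (B * (b * a)).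
Proof. by ring. Qed.

Lemma wt_le1 x : wt x <= 1.
Proof. by rewrite /wt invf_le1 ?oneD_gt0// lerDl sqr_ge0. Qed.

(* Peetre's inequality *)
Lemma wt_add x y : wt (x + y) <= 2 * (1 + x ^+ 2) * wt y.
Proof.
rewrite /wt ler_pdivlMr ?oneD_gt0// mulrC ler_pdivrMr ?oneD_gt0//.
rewrite [in leLHS](_ : y = (x + y) - x); last by rewrite addrC addKr.
move: (x + y) => s; have := sqr_ge0 (s + x); have := sqr_ge0 (x * s).
by rewrite exprMn; nra.
Qed.

Lemma cintegrable_cmeasurable d (T : measurableType d) (m : {measure set T -> \bar R})
  (f : T -> C) : cintegrable m f -> cmeasurable f.
Proof.
by move=> [f1 f2]; split; apply/measurable_EFinP; [exact: measurable_int f1|exact: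
    measurable_int f2].
Qed.

(** * Evaluation of the fourfold integral at a point (q, p) *)

Section twisted_product.
Variables (f g : S2 R) (q p : R).
Let g1 := wt1_norm (fourier 1 g).
Let kap (v : R * R) q2 : C := expi (v.2 * (q - q2)) * expi (p * (q2 - v.1)) *
  fou 1 g (q2, v.1 - q).
Let k (v : R * R) := val f v * cintegral mu (kap v).

Let kap_le v q2 : normc (kap v q2) <= g1 * wt q2.
Proof.
rewrite /kap normcM normcM !normc_expi !mul1r.
by have := S2_wt1 (fourier 1 g) (q2, v.1 - q); rewrite val_fourier ?one_sqr.
Qed.

Let fou_m h : cmeasurable2 (fou 1 h).
Proof. by rewrite -val_fourier ?one_sqr//; exact: cmeasurable_S2. Qed.

Let kap_m : @cmeasurable R _ (Rm * Rm * Rm)%type (fun vq => kap vq.1 vq.2).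
Proof.
have m1 : measurable_fun setT (fun x : Rm * Rm * Rm => x.1.1) by exact: measurableT_comp
    measurable_fst measurable_fst.
have m2 : measurable_fun setT (fun x : Rm * Rm * Rm => x.1.2) by exact: measurableT_comp
    measurable_snd measurable_fst.
have m3 : measurable_fun setT (fun x : Rm * Rm * Rm => x.2) by exact: measurable_snd.
apply: cmeasurableM.
  by apply: cmeasurableM; apply: cmeasurable_expi; apply: measurable_funM => //;
    exact: measurable_funB.
apply: cmeasurable_comp (fou_m g) _; apply: measurable_fun_pair => //.
exact: measurable_funB.
Qed.

Let kap_mr v : cmeasurable1 (kap v).
Proof. exact: cmeasurable_comp kap_m (pair1_measurable v). Qed.

Let kap_i v : cintegrable mu (kap v).
Proof. exact: cintegrable_wt (kap_mr v) (kap_le v). Qed.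

Let k_m : cmeasurable2 k.
Proof.
have H : cmeasurable2 (fun v => cintegral mu (fun q2 => val f v * kap v q2)).
  (* Only measurability is at stake, so v may be integrated against 0. *)
  pose m0 : {sigma_finite_measure set (Rm * Rm)%type -> \bar R} := mzero.
  apply: (@cintegrable_cmeasurable _ _ m0).
  apply: (@cintegrable_fubini1 _ _ _ _ _ m0 mu (fun vq => val f vq.1 * kap vq.1 vq.2)
    (fun v => snorm2 (0, 0, [::])%N f) (fun x => g1 * wt x)).
  - apply: cmeasurableM => //; exact: cmeasurable_comp (cmeasurable_S2 f) measurable_fst.
  - apply/integrableP; split; first exact: measurable_cst.
    by rewrite integral_measure_zero.
  - exact: integrable_wtZ.
  - move=> x y /=; rewrite normcM ler_pM ?normc_ge0//; exact: S2_le.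
congr cmeasurable : H; apply/funext => v; rewrite /k cintegralZ//.
Qed.

Let k_le x y : normc (k (x, y)) <= wt12_norm f * (2 * wtI * g1) * wt x * wt y.
Proof.
rewrite /k normcM [leRHS](_ : _ = wt12_norm f * (wt x * wt y) * (2 * wtI * g1)).
  rewrite ler_pM ?normc_ge0//; first exact: (S2_wt12 f (x, y)).
  by apply: cintegral_wt => // z; exact: kap_le.
by move: (wt x) (wt y) wtI => a b c; ring.
Qed.

(** The integrand left after both momentum integrals, in the variables q1 and t = q2 - q1. The
    remaining phase depends on t alone, which frees q1 to become the composition variable. *)
Let k2 (u : R * R) : C := expi (p * u.2) * (fou 1 g (u.1 + u.2, u.1 - q) *
  fou 1 f (u.1, q - (u.1 + u.2))).

Let integrate_p1 q1 : cintegral mu (fun p1 => k (q1, p1)) =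
  cintegral mu (fun t => k2 (q1, t)).
Proof.
pose K (u : R * R) := val f (q1, u.1) * kap (q1, u.1) u.2.
have mK : cmeasurable2 K.
  apply: cmeasurableM.
    exact: cmeasurable_comp (S2_cmeasurable_r f q1) measurable_fst.
  apply: (cmeasurable_comp (h := fun u : Rm * Rm => ((q1, u.1), u.2)) kap_m).
  by apply: measurable_fun_pair; [exact: measurable_fun_pair|exact: measurable_snd].
have KM x y : normc (K (x, y)) <= wt2_norm f * wt x * (g1 * wt y).
  by rewrite /K normcM ler_pM ?normc_ge0//; exact: (S2_wt2 f (q1, x)).
transitivity (cintegral mu (fun p1 => cintegral mu (fun q2 => K (p1, q2)))).
  congr cintegral; apply/funext => p1.
  by rewrite -[RHS]/(cintegral mu (fun q2 => val f (q1, p1) * kap (q1, p1) q2)) cintegralZ.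
rewrite (cfubini mK (integrable_wtZ _) (integrable_wtZ _) KM).
pose L q2 := expi (p * (q2 - q1)) * (fou 1 g (q2, q1 - q) * fou 1 f (q1, q - q2)).
have -> : (fun q2 => cintegral mu (fun p1 => K (p1, q2))) = L.
  apply/funext => q2; rewrite /L mulrA /fou -cintegralZ; last exact: fou_integrable.
  congr cintegral; apply/funext => p1; rewrite /K /kap /= -/(fou 1 g (q2, q1 - q)).
  rewrite (_ : 1 * (q - q2) * p1 = p1 * (q - q2)); last by ring.
  move: (fou _ _ _) (val f _) (expi _) (expi _) => a b c e; ring.
rewrite -(@cintegral_translation _ L q1).
  congr cintegral; apply/funext => t; rewrite /L /k2 /= addrK [q1 + t]addrC.
  by [].
apply: (cintegrable_wt (M := g1 * snorm2 (0, 0, [::])%N (fourier 1 f))).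
  apply: cmeasurableM.
    by apply: cmeasurable_expi; apply: measurable_funM => //; exact: measurable_funB.
  apply: cmeasurableM.
    exact: cmeasurable_comp (fou_m g) (pair2_measurable _).
  apply: cmeasurable_comp (fou_m f) _; apply: measurable_fun_pair => //.
  exact: measurable_funB.
move=> z; rewrite normcM normc_expi mul1r normcM mulrAC ler_pM ?normc_ge0//.
  by have := S2_wt1 (fourier 1 g) (z, q1 - q); rewrite val_fourier ?one_sqr.
by have := S2_le (fourier 1 f) (q1, q - z); rewrite val_fourier ?one_sqr.
Qed.

Let k2_m : cmeasurable2 k2.
Proof.
have m1 : measurable_fun setT (fun x : Rm * Rm => x.1) by exact: measurable_fst.
have m2 : measurable_fun setT (fun x : Rm * Rm => x.2) by exact: measurable_snd.
have m12 : measurable_fun setT (fun x : Rm * Rm => x.1 + x.2) by exact: measurable_funD.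
apply: cmeasurableM.
  by apply: cmeasurable_expi; exact: measurable_funM.
apply: cmeasurableM.
  apply: cmeasurable_comp (fou_m g) _; apply: measurable_fun_pair => //.
  exact: measurable_funB.
apply: cmeasurable_comp (fou_m f) _; apply: measurable_fun_pair => //.
exact: measurable_funB.
Qed.

Let k2_le : exists M, forall x t, normc (k2 (x, t)) <= M * wt x * wt t.
Proof.
(* The transform of g decays in x + t and in x - q. By Peetre's inequality the first gives [wt t] at
   the cost of 2 (1 + x^2), the second gives [wt x] at the cost of 2 (1 + q^2) and repays 1 + x^2;
   the transform of f supplies a further [wt x]. *)
exists (wt12_norm (fourier 1 g) * (2 * (1 + q ^+ 2) * 2) * wt1_norm (fourier 1 f)) => x t.
rewrite /k2 /= normcM normc_expi mul1r normcM.
rewrite [leRHS](_ : _ = (wt12_norm (fourier 1 g) * (2 * (1 + x ^+ 2) * wt t * (2 * (1 + q ^+ 2)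
    * wt x)))
   * (wt1_norm (fourier 1 f) * wt x)); last first.
  have w1 : (1 + x ^+ 2) * wt x = 1 by rewrite /wt mulfV// gt_eqF// oneD_gt0.
  exact: k2_algebra.
rewrite ler_pM ?normc_ge0//.
  have := S2_wt12 (fourier 1 g) (x + t, x - q); rewrite val_fourier ?one_sqr//= => H.
  rewrite (le_trans H)// ler_wpM2l ?wt12_norm_ge0//.
  rewrite ler_pM ?(ltW (wt_gt0 _)) ?wt_add//.
  have := wt_add (- q) x; rewrite sqrrN addrC; exact.
by have := S2_wt1 (fourier 1 f) (x, q - (x + t)); rewrite val_fourier ?one_sqr.
Qed.

Let k2_rotation q1 t : k2 (q1, t) = (P * P)%:C%C * expi (p * t) *
  (val (Wbar g) ((q + t) / Num.sqrt 2, Num.sqrt 2 * q1 + (t - q) / Num.sqrt 2) *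
   val (Wbar f) (Num.sqrt 2 * q1 + (t - q) / Num.sqrt 2, (q - t) / Num.sqrt 2)).
Proof.
by rewrite /k2 /= !fou_oneE rotation_shear rotation_shear' realcM; exact: mul_perm4.
Qed.

(** The substitution z = sqrt 2 q1 + (t - q) / sqrt 2 produces the factor 1 / sqrt 2 and turns the
    q1-integral into a composition of kernels. *)
Let integrate_q1 t : cintegral mu (fun q1 => k2 (q1, t)) =
  (P * P * (Num.sqrt 2)^-1)%:C%C * (val (comp (Wbar g) (Wbar f)) (rotation (q, t)) * expi (p *
      t)).
Proof.
under eq_fun do rewrite k2_rotation.
have s2 := @sqrt2_gt0 R.
pose F z := val (Wbar g) ((q + t) / Num.sqrt 2, z) * val (Wbar f) (z, (q - t) / Num.sqrt 2).
have Fi : cintegrable mu F by exact: kcomp_integrable.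
have Z := cintegralZ ((P * P)%:C%C * expi (p * t))
  (cintegrable_affine ((t - q) / Num.sqrt 2) s2 Fi).
rewrite [LHS]Z cintegral_affine// val_comp [in RHS]realcM.
rewrite -[cintegral mu F]/(kcomp (Wbar g) (Wbar f) (rotation (q, t))).
by rewrite mulrACA; congr (_ * _); exact: mulrC.
Qed.

Lemma twisted_fun : (((4 * pi ^+ 2)^-1)%:C)%C *
  cintegral mu2 (fun v => cintegral mu2 (fun w =>
    val f v * val g w * expi (symp (q, p) v + symp v w + symp w (q, p)))) =
  val (((2 * Num.sqrt pi)^-1)%:C%C *: Wbarinv (comp (Wbar g) (Wbar f))) (q, p).
Proof.
under eq_fun do rewrite twisted_inner.
rewrite -[cintegral mu2 _]/(cintegral mu2 k) (cintegral_swap2 k_m k_le).1.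
under eq_fun do rewrite integrate_p1.
have [M HM] := k2_le; rewrite (cintegral_swap2 k2_m HM).2.
under eq_fun do rewrite integrate_q1.
have I1 : (fun t => val (comp (Wbar g) (Wbar f)) (rotation (q, t)) * expi (p * t)) =
  (fun z => val (rot (comp (Wbar g) (Wbar f))) (q, z) * expi (1 * p * z)).
  by apply/funext => z; rewrite val_rot mul1r.
rewrite cintegralZ; last by rewrite I1; exact: fou_integrable.
rewrite I1 -[cintegral mu _]/(fou 1 (rot (comp (Wbar g) (Wbar f))) (q, p)).
rewrite val_scale Wbarinv_fourier val_Fp !mulrA -!realcM; congr (_%:C%C * _).
have p0 : 0 < pi :> R by exact: pi_gt0.
rewrite sqrtrM//.
have s2 := @sqrt2_gt0 R; have ss := @sqrt2_sqr R.
have sp : 0 < Num.sqrt pi :> R by rewrite sqrtr_gt0.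
have sps : Num.sqrt pi ^+ 2 = pi :> R by rewrite sqr_sqrtr// ltW.
(* Both sides equal 1 / (2 sqrt 2 pi). Everything is rewritten in a = sqrt 2 and b = sqrt pi so that
   [field] applies. *)
rewrite (_ : 4 * pi * pi = 4 * (Num.sqrt pi ^+ 2 * Num.sqrt pi ^+ 2)); last by rewrite sps mulrA.
move: s2 ss sp {sps p0}; move: (Num.sqrt 2) (Num.sqrt pi) => a b a0 a2 b0.
have an : a != 0 by rewrite gt_eqF.
have bn : b != 0 by rewrite gt_eqF.
rewrite -[in LHS](_ : a ^+ 2 * a ^+ 2 = 4); last by rewrite a2; ring.
rewrite -[in RHS]a2; field; rewrite ?an ?bn//.
Qed.

End twisted_product.

Lemma twistedE f g :
  twisted f g = ((2 * Num.sqrt pi)^-1)%:C%C *: Wbarinv (comp (Wbar g) (Wbar f)).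
Proof.
rewrite /twisted (_ : (fun u => _) = val (((2 * Num.sqrt pi)^-1)%:C%C *:
  Wbarinv (comp (Wbar g) (Wbar f)))); last first.
  by apply/funext => -[q p]; exact: twisted_fun.
by apply: val_inj; rewrite val_toS2//; exact: S2P.
Qed.

(** The reflection is reached by two one-dimensional substitutions: with x = (q + t) / sqrt 2 the
    second coordinate is sqrt 2 q - x, and the Jacobians sqrt 2 and 1 / sqrt 2 cancel. The doubled
    weight in x pays for Peetre's inequality in the intermediate variables. *)
Lemma cintegral_rotation (k : R * R -> C) M : cmeasurable2 k ->
  (forall x y, normc (k (x, y)) <= M * (wt x * wt x) * wt y) ->
  cintegral mu (fun q => cintegral mu (fun t => k (rotation (q, t))))
  = cintegral mu (fun x => cintegral mu (fun y => k (x, y))).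
Proof.
move=> mk kM; have s2 := @sqrt2_gt0 R; have s20 : Num.sqrt 2 != 0 :> R by rewrite gt_eqF.
have M0 : 0 <= M.
  have := le_trans (normc_ge0 _) (kM 0 0).
  by rewrite pmulr_lge0 ?wt_gt0// pmulr_lge0 ?mulr_gt0 ?wt_gt0.
pose j (u : R * R) := k (u.2, Num.sqrt 2 * u.1 - u.2).
have jm : cmeasurable2 j.
  apply: cmeasurable_comp mk _; apply: measurable_fun_pair; first exact: measurable_snd.
  by apply: measurable_funB; [exact: measurable_funM|exact: measurable_snd].
have jle q x : normc (j (q, x)) <= 2 * M * wt q * wt x.
  rewrite (le_trans (kM _ _))//.
  have w := wt_add (- x) (Num.sqrt 2 * q); rewrite sqrrN addrC in w.
  rewrite (le_trans (ler_wpM2l _ w)) ?mulr_ge0 ?(ltW (wt_gt0 _))//.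
  have w1 : (1 + x ^+ 2) * wt x = 1 by rewrite /wt mulfV// gt_eqF// oneD_gt0.
  have -> : M * (wt x * wt x) * (2 * (1 + x ^+ 2) * wt (Num.sqrt 2 * q)) =
    2 * M * wt (Num.sqrt 2 * q) * ((1 + x ^+ 2) * wt x) * wt x.
    by move: (wt x) (wt _) => a b; ring.
  rewrite w1 mulr1 ler_wpM2r ?(ltW (wt_gt0 _))// ler_wpM2l ?mulr_ge0//.
  by rewrite /wt lef_pV2 ?posrE ?oneD_gt0// lerD2l exprMn sqrt2_sqr ler_peMl ?sqr_ge0// ler1n.
have ki x : cintegrable mu (fun y => k (x, y)).
  apply: cintegrable_wt (fun y => kM x y).
  exact: cmeasurable_comp mk (pair1_measurable x).
have inner q : cintegral mu (fun t => k (rotation (q, t))) =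
    (Num.sqrt 2)%:C%C * cintegral mu (fun x => j (q, x)).
  have := @cintegral_affine _ (fun x => j (q, x)) (Num.sqrt 2)^-1 (q / Num.sqrt 2).
  rewrite invrK => <-.
  - congr cintegral; apply/funext => t; rewrite /j /rotation /=.
    congr (k (_, _)); first by rewrite addrC mulrDl [_ * t]mulrC.
    apply: (mulIf s20); rewrite divfK// mulrBl mulrDl divfK// [_^-1 * t]mulrC divfK//.
    by rewrite mulrAC -expr2 sqrt2_sqr; ring.
  - by rewrite invr_gt0.
  - apply: cintegrable_wt (fun x => jle q x).
    exact: cmeasurable_comp jm (pair1_measurable q).
under eq_fun do rewrite inner.
rewrite cintegralZ; last first.
  exact: (cintegrable_fubini1 jm (integrable_wtZ (2 * M)) integrable_wt jle).
rewrite (cintegral_swap2 jm jle).2 -cintegralZ; last first.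
  by apply: (cintegrable_swap (A := 2 * M) (B := 1) jm) => x y; rewrite mul1r.
congr cintegral; apply/funext => x.
have A := @cintegral_affine _ (fun y => k (x, y)) (Num.sqrt 2) (- x) s2 (ki x).
transitivity ((Num.sqrt 2)%:C%C * (((Num.sqrt 2)^-1)%:C%C * cintegral mu (fun y => k (x, y)))).
  by congr (_ * _); exact: A.
by rewrite mulrA -realcM divff// mul1r.
Qed.

(** On each line q = const, f is written as a transform, which Fubini moves onto h. The sign change
    in [fou_oneE] swaps the two rotated coordinates, so the pairing becomes the trace of the
    composition of the two kernels. *)
Lemma pairing2E f h : pairing2 f h = ((2 * pi)^-1)%:C%C *
  cintegral mu (fun x => cintegral mu (fun y => val (Wbar f) (y, x) * val (Wbar h) (x, y))).
Proof.
rewrite /pairing2; congr (_ * _).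
pose k (u : R * R) := val f u * val h u.
have mk : cmeasurable2 k by apply: cmeasurableM; exact: cmeasurable_S2.
have kM x y : normc (k (x, y)) <= wt12_norm f * snorm2 (0, 0, [::])%N h * wt x * wt y.
  rewrite /k normcM [leRHS](_ : _ = wt12_norm f * (wt x * wt y) * snorm2 (0, 0, [::])%N h).
    by rewrite ler_pM ?normc_ge0//; [exact: (S2_wt12 f (x, y))|exact: S2_le].
  by move: (wt x) (wt y) => a b; ring.
rewrite (cintegral_swap2 mk kM).1.
pose Q (u : R * R) := val (Wbar f) u * val (Wbar h) (u.2, u.1).
have mQ : cmeasurable2 Q.
  apply: cmeasurableM; first exact: cmeasurable_S2.
  by apply: cmeasurable_comp (cmeasurable_S2 _) _; apply: measurable_fun_pair; [exact:
      measurable_snd|exact: measurable_fst].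
pose MQ := wt12_norm (Wbar f) * wt12_norm (Wbar h).
have QM x y : normc (Q (x, y)) <= MQ * (wt x * wt x) * (wt y * wt y).
  rewrite /Q normcM [leRHS](_ : _ = wt12_norm (Wbar f) * (wt x * wt y) *
     (wt12_norm (Wbar h) * (wt y * wt x))).
    by rewrite ler_pM ?normc_ge0//; exact: S2_wt12.
  exact: mul_perm6.
have MQ0 : 0 <= MQ by rewrite mulr_ge0 ?wt12_norm_ge0.
have W x := ltW (wt_gt0 x).
have QM1 x y : normc (Q (x, y)) <= MQ * (wt x * wt x) * wt y.
  rewrite (le_trans (QM x y))// ler_wpM2l//; last by rewrite ler_piMl ?wt_le1.
  by apply: mulr_ge0 => //; exact: mulr_ge0.
have QM2 x y : normc (Q (x, y)) <= MQ * wt x * wt y.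
  rewrite (le_trans (QM1 x y))// ler_wpM2r ?(ltW (wt_gt0 _))// ler_wpM2l//.
  by rewrite ler_piMl ?wt_le1.
transitivity (cintegral mu (fun q => cintegral mu (fun t => Q (rotation (q, t))))).
  congr cintegral; apply/funext => q.
  pose K (u : R * R) := val (Wbar f) (rotation (q, u.2)) * expi (u.1 * u.2) * val h (q, u.1).
  have mW : cmeasurable1 (fun t => val (Wbar f) (rotation (q, t))).
    by have := S2_cmeasurable_r (rot (Wbar f)) q; rewrite val_rot.
  have mK : cmeasurable2 K.
    apply: cmeasurableM; last exact: cmeasurable_comp (S2_cmeasurable_r h q) measurable_fst.
    apply: cmeasurableM; first exact: cmeasurable_comp mW measurable_snd.
    by apply: cmeasurable_expi; apply: measurable_funM; [exact: measurable_fst|exact: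
        measurable_snd].
  have KM x t : normc (K (x, t)) <= wt2_norm h * wt x * (wt2_norm (rot (Wbar f)) * wt t).
    rewrite /K normcM normcM normc_expi mulr1 mulrC ler_pM ?normc_ge0//.
      exact: (S2_wt2 h (q, x)).
    by have := S2_wt2 (rot (Wbar f)) (q, t); rewrite val_rot.
  transitivity ((P^-1)%:C%C * cintegral mu (fun p => cintegral mu (fun t => K (p, t)))).
    rewrite -cintegralZ; last first.
      exact: (cintegrable_fubini1 mK (integrable_wtZ _) (integrable_wtZ _) KM).
    congr cintegral; apply/funext => p; rewrite /k -{1}[f]WbarK Wbarinv_fourier val_Fp.
    rewrite -mulrA; congr (_ * _); rewrite mulrC -cintegralZ; last exact: fou_integrable.
    congr cintegral; apply/funext => t; rewrite /K /= mul1r val_rot.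
    by rewrite mulrC.
  rewrite (cfubini mK (integrable_wtZ _) (integrable_wtZ _) KM) -cintegralZ; last exact:
      cintegrable_swap mK KM.
  congr cintegral; apply/funext => t.
  have hi := fou_integrable 1 h q t.
  have Z := cintegralZ (val (Wbar f) (rotation (q, t))) hi.
  rewrite /Q /K /=; transitivity ((P^-1)%:C%C * (val (Wbar f) (rotation (q, t)) * fou 1 h (q,
      t))).
    congr (_ * _); rewrite /fou -Z; congr cintegral; apply/funext => z.
    by rewrite mul1r -mulrA [z * t]mulrC; congr (_ * _); exact: mulrC.
  rewrite [LHS]mulrCA; congr (_ * _); rewrite fou_oneE mulrA -realcM mulVf ?gt_eqF
      ?sqrt2pi_gt0// mul1r.
  by rewrite /rotation /= opprK.
rewrite (cintegral_rotation mQ QM1) (cintegral_swap2 mQ QM2).2.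
by [].
Qed.

End moyal_factorization.

(** * Uniform boundedness and the closed graph theorem *)

Section seminorms.
Context {R : realType} {E : lmodType R[i]}.
Local Notation C := R[i].

Definition is_seminorm (q : E -> R) : Prop :=
  (forall x y, q (x + y) <= q x + q y) /\
  (forall (a : C) x, q (a *: x) = normc a * q x).

Section one_seminorm.
Variables (q : E -> R) (qS : is_seminorm q).

Lemma is_seminorm0 : q 0 = 0.
Proof. by rewrite -[0](scale0r 0) qS.2 normc0 mul0r. Qed.

Lemma is_seminormN x : q (- x) = q x.
Proof. by rewrite -scaleN1r qS.2 normcN normc1 mul1r. Qed.

Lemma is_seminorm_ge0 x : 0 <= q x.
Proof.
have := qS.1 x (- x); rewrite subrr is_seminorm0 is_seminormN -mulr2n.
by rewrite pmulrn_lge0.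
Qed.

Lemma is_seminormB x y : q (x - y) <= q x + q y.
Proof. by rewrite -(is_seminormN y) qS.1. Qed.

End one_seminorm.

Lemma is_seminorm_sum (I : Type) (s : seq I) (q : I -> E -> R) :
  (forall i, is_seminorm (q i)) -> is_seminorm (fun x => \sum_(i <- s) q i x).
Proof.
move=> qS; split=> [x y|a x].
  by rewrite -big_split/=; apply: ler_sum => i _; exact: (qS i).1.
by rewrite mulr_sumr; apply: eq_bigr => i _; rewrite (qS i).2.
Qed.

(** For seminorms this is continuity in the topology defined by [p], expressed by inequalities so
    that it can be composed and added without any topology. *)
Definition dominated (I : Type) (p : I -> E -> R) (q : E -> R) : Prop :=
  exists s c, 0 <= c /\ forall x, q x <= c * \sum_(i <- s) p i x.

Section dominated.
Variables (I : Type) (p : I -> E -> R) (pS : forall i, is_seminorm (p i)).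

Let sum_ge0 s x : 0 <= \sum_(i <- s) p i x.
Proof. by rewrite sumr_ge0// => i _; exact: is_seminorm_ge0. Qed.

Lemma dominated_self i : dominated p (p i).
Proof. by exists [:: i], 1; split=> // x; rewrite big_seq1 mul1r. Qed.

Lemma dominated_le q r : (forall x, r x <= q x) -> dominated p q -> dominated p r.
Proof. by move=> rq [s [c [c0 H]]]; exists s, c; split=> // x; exact: le_trans (H x). Qed.

Lemma dominatedD q r : dominated p q -> dominated p r -> dominated p (fun x => q x + r x).
Proof.
move=> [s [c [c0 H]]] [t [d [d0 G]]]; exists (s ++ t), (c + d); split; first exact: addr_ge0.
move=> x; rewrite big_cat/= (le_trans (lerD (H x) (G x)))//.
rewrite mulrDr !mulrDl -[leLHS]addr0.
have := mulr_ge0 d0 (sum_ge0 s x); have := mulr_ge0 c0 (sum_ge0 t x).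
move: (c * _) (d * _) (c * _) (d * _) => a b e f; lra.
Qed.

Lemma dominatedZ a q : 0 <= a -> dominated p q -> dominated p (fun x => a * q x).
Proof.
move=> a0 [s [c [c0 H]]]; exists s, (a * c); split=> [|x]; first exact: mulr_ge0.
by rewrite -mulrA ler_wpM2l.
Qed.

Lemma dominated_sum (J : Type) (s : seq J) (q : J -> E -> R) :
  (forall j, dominated p (q j)) -> dominated p (fun x => \sum_(j <- s) q j x).
Proof.
move=> qd; elim: s => [|j s IH].
  by exists [::], 0; split=> // x; rewrite !big_nil mulr0.
by apply: dominated_le (dominatedD (qd j) IH) => x; rewrite big_cons.
Qed.

End dominated.

Definition seminorm_complete (I : Type) (p : I -> E -> R) : Prop :=
  forall u : nat -> E,
  (forall i e, 0 < e -> exists N, forall m n, (N <= m)%N -> (N <= n)%N ->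
    p i (u m - u n) <= e) ->
  exists x, forall i e, 0 < e -> exists N, forall n, (N <= n)%N -> p i (u n - x) <= e.

End seminorms.

Lemma dominated_comp (R : realType) (E F : lmodType R[i]) (I J : Type)
  (p : I -> E -> R) (q : J -> F -> R) (r : F -> R) (M : E -> F) :
  (forall i, is_seminorm (p i)) -> (forall j, dominated p (q j \o M)) ->
  dominated q r -> dominated p (r \o M).
Proof.
move=> pS Md [s [c [c0 H]]].
apply: dominated_le (dominatedZ c0 (dominated_sum pS s Md)) => x; exact: H.
Qed.

Section linear_maps.
Context {R : realType} {E F : lmodType R[i]}.

Lemma lin_map0 (M : E -> F) : (forall a x y, M (a *: x + y) = a *: M x + M y) -> M 0 = 0.
Proof. by move=> ML; have := ML (-1) 0 0; rewrite scaler0 addr0 scaleN1r addNr. Qed.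

Lemma lin_mapZ (M : E -> F) : (forall a x y, M (a *: x + y) = a *: M x + M y) ->
  forall a x, M (a *: x) = a *: M x.
Proof. by move=> ML a x; rewrite -[a *: x]addr0 ML lin_map0// addr0. Qed.

Lemma lin_mapB (M : E -> F) : (forall a x y, M (a *: x + y) = a *: M x + M y) ->
  forall x y, M (x - y) = M x - M y.
Proof. by move=> ML x y; rewrite addrC -scaleN1r ML scaleN1r addrC. Qed.

Lemma lin_formZ (l : E -> R[i]) : (forall a x y, l (a *: x + y) = a * l x + l y) ->
  forall a x, l (a *: x) = a * l x.
Proof.
move=> ll a x; have l0 : l 0 = 0 by have := ll (-1) 0 0; rewrite scaler0 addr0 mulN1r addNr.
by rewrite -[a *: x]addr0 ll l0 addr0.
Qed.

End linear_maps.

Section uniform_boundedness.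
Context {R : realType} {E : lmodType R[i]} {I : countType}.
Variables (p : I -> E -> R) (pS : forall i, is_seminorm (p i)).

(** The countable family is enumerated, codes without an index contributing 0, so that the partial
    sums [psum] form an increasing sequence defining the same topology. *)
Let term (k : nat) (x : E) : R := if unpickle k is Some i then p i x else 0.

Let psum n x := \sum_(k <- iota 0 n) term k x.

Let termS k : is_seminorm (term k).
Proof.
rewrite /term; case: (unpickle k) => [i|]; first exact: pS.
by split=> [x y|a x]; rewrite ?addr0 ?mulr0.
Qed.

Let psumS n : is_seminorm (psum n). Proof. exact: is_seminorm_sum. Qed.

Let psum_le m n x : (m <= n)%N -> psum m x <= psum n x.
Proof.
move=> mn; rewrite /psum -(subnKC mn) iotaD big_cat/= lerDl sumr_ge0// => i _.
exact: is_seminorm_ge0.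
Qed.

Let p_psum i x : p i x <= psum (pickle i).+1 x.
Proof.
rewrite /psum -addn1 iotaD big_cat/= big_seq1 add0n /term pickleK lerDr.
by rewrite sumr_ge0// => j _; exact: is_seminorm_ge0 (termS j) x.
Qed.

Let dominated_psum q : dominated p q -> exists n c, 0 <= c /\ forall x, q x <= c * psum n x.
Proof.
move=> [s [c [c0 H]]]; suff [n [d [d0 G]]] : exists n d, 0 <= d /\ forall x, \sum_(i <- s) p i
    x <= d * psum n x.
  exists n, (c * d); split=> [|x]; first exact: mulr_ge0.
  by rewrite (le_trans (H x))// -mulrA ler_wpM2l.
elim: s {c c0 H} => [|i s [n [d [d0 G]]]].
  by exists 0, 0; split=> // x; rewrite big_nil mul0r.
exists (maxn n (pickle i).+1), (1 + d); split=> [|x]; first by rewrite addr_ge0.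
rewrite big_cons mulrDl mul1r lerD//.
  by rewrite (le_trans (p_psum i x))// psum_le// leq_maxr.
by rewrite (le_trans (G x))// ler_wpM2l// psum_le// leq_maxl.
Qed.

Let psum_dominated n : dominated p (psum n).
Proof.
apply: dominated_sum => // k; rewrite /term; case: (unpickle k) => [i|].
  exact: dominated_self.
by exists [::], 0; split=> // x; rewrite mul0r.
Qed.

Variables (A : Type) (q : A -> E -> R).
Hypotheses (pC : seminorm_complete p) (qS : forall a, is_seminorm (q a)).
Hypotheses (qp : forall a, dominated p (q a)).
Hypothesis qb : forall x, exists M, forall a, q a x <= M.

Let unbounded n : (~ exists c, 0 <= c /\ forall a x, q a x <= c * psum n x) ->
  forall e M, 0 < e -> exists a x, psum n x <= e /\ M < q a x.
Proof.
move=> H e M e0; apply: contrapT => K; apply: H; exists (`|M| / e).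
split=> [|a x]; first by rewrite divr_ge0// ltW.
have B y : psum n y <= e -> q a y <= M.
  by move=> ye; rewrite leNgt; apply/negP => My; apply: K; exists a, y.
have t_norm (t : R) : 0 <= t -> normc t%:C%C = t by move=> t0; rewrite normc_real ger0_norm.
(* Where [psum n] vanishes, all multiples of x are admissible, so a positive [q a x] could be scaled
   beyond M; elsewhere x is rescaled to [psum n x = e]. *)
have := is_seminorm_ge0 (psumS n) x; rewrite le_eqVlt => /predU1P[x0|x0].
  rewrite -x0 mulr0; rewrite leNgt; apply/negP => qx.
  have t0 : 0 <= (`|M| + 1) / q a x by rewrite divr_ge0// ltW.
  have := B (((`|M| + 1) / q a x)%:C%C *: x).
  rewrite (qS a).2 (psumS n).2 -x0 mulr0 => /(_ (ltW e0)).
  by rewrite t_norm// divfK ?gt_eqF// leNgt ltr_pwDr// ler_norm.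
have t0 : 0 <= e / psum n x by rewrite divr_ge0// ltW.
have := B ((e / psum n x)%:C%C *: x).
rewrite (qS a).2 (psumS n).2 t_norm// divfK ?gt_eqF// => /(_ (lexx _)).
rewrite mulrAC ler_pdivrMr// => h; rewrite mulrAC ler_pdivlMr// mulrC (le_trans h)//.
by rewrite ler_wpM2r ?ler_norm// ltW.
Qed.

(* Gliding hump: if no bound is uniform, choose increments y_k, small for more
   and more seminorms, such that some q_a is at least k on x_k = y_0 + ... + y_k
   and on all its later perturbations; the limit x of x_k contradicts the
   pointwise bound. A state is (x_k, m_k, e_k): later increments must satisfy
   psum m_k y <= e_k. *)
Lemma uniform_boundedness : exists s c, 0 <= c /\
  forall a x, q a x <= c * \sum_(i <- s) p i x.
Proof.
suff [n [c [c0 H]]] : exists n c, 0 <= c /\ forall a x, q a x <= c * psum n x.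
  have [s [d [d0 G]]] := psum_dominated n; exists s, (c * d).
  by split=> [|a x]; [exact: mulr_ge0|rewrite (le_trans (H a x))// -mulrA ler_wpM2l].
apply: contrapT => H.
have unb n := unbounded (fun h => H (ex_intro _ n h)).
pose st := (E * nat * R)%type.
(* The tolerances at least halve at each step, so all later increments together stay within twice
   the current tolerance: hence [2 * s'.2]. *)
pose step k (s s' : st) := [/\ psum s.1.2 (s'.1.1 - s.1.1) <= s.2, (s.1.2 < s'.1.2)%N,
  0 < s'.2 <= s.2 / 2 & exists a, forall z, psum s'.1.2 z <= 2 * s'.2 -> k%:R <= q a (s'.1.1 +
      z)].
have stepE (ks : nat * st) : exists s', 0 < ks.2.2 -> step ks.1 ks.2 s'.
  case: ks => k [[x m] e] /=; have [M xM] := qb x.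
  have [e0|e0] := ltP 0 e; last by exists (x, m, e).
  have [a [y [ye yM]]] := unb m e (k%:R + M + 1) e0.
  have [n [c [c0 qn]]] := dominated_psum (qp a).
  (* The new tolerance forces [q a z <= 1] for every later perturbation z. As [q a y] exceeds k + M
     + 1 and [q a x] is at most M, the value at x + y + z stays above k. *)
  exists (x + y, (maxn m n).+1, Order.min (e / 2) (2 * (c + 1))^-1) => _; split=> /=.
  - by rewrite addrC addrA addNr add0r.
  - by rewrite ltnS leq_maxl.
  - by rewrite lt_min divr_gt0//= invr_gt0 mulr_gt0 ?ltr_wpDl//= ge_min lexx.
  exists a => z zn.
  have qz : q a z <= 1.
    rewrite (le_trans (qn z))// (@le_trans _ _ (c * (2 * (2 * (c + 1))^-1)))//.
      rewrite ler_wpM2l// (le_trans _ (le_trans zn _))//.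
        by rewrite psum_le// (leq_trans (leq_maxr m n)).
      by rewrite ler_wpM2l// ge_min lexx orbT.
    by rewrite invfM mulVKf// ler_pdivrMr ?ltr_wpDl// mul1r lerDl.
  have := (qS a).1 (x + y + z) (- (x + z)).
  rewrite (is_seminormN (qS a)) [_ - (x + z)](_ : _ = y); last first.
    by rewrite opprD addrACA subrr addr0 addrAC subrr add0r.
  have := (qS a).1 x z; have := xM a; lra.
have [F HF] := choice stepE.
pose u := fix u k : st := if k is k'.+1 then F (k', u k') else (0, 0%N, 1).
have u0 k : 0 < (u k).2.
  by elim: k => [//|k IH] /=; have [_ _ /andP[]] := HF (k, u k) IH.
have us k : step k (u k) (u k.+1) by exact: HF (k, u k) (u0 k).
have um j k : (j <= k)%N -> ((u j).1.2 <= (u k).1.2)%N.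
  move=> /subnKC <-; elim: (k - j)%N => [|l IH]; first by rewrite addn0.
  by rewrite addnS (leq_trans IH)// ltnW//; have [] := us (j + l)%N.
have uk k : (k <= (u k).1.2)%N.
  by elim: k => // k IH; rewrite (leq_ltn_trans IH)//; have [] := us k.
have ue k : (u k).2 <= (2 ^+ k)^-1.
  elim: k => [|k IH]; first by rewrite expr0 invr1.
  have [_ _ /andP[_ h] _] := us k; apply: le_trans h _.
  by rewrite exprSr invfM mulrC [leRHS]mulrC ler_wpM2l.
(* Geometric series in telescoped form: halving means that each tolerance e_j is at most 2 e_j - 2
   e_(j+1). *)
have tail k j : psum (u k).1.2 ((u (k + j)%N).1.1 - (u k).1.1) <= 2 * (u k).2 - 2 * (u (k +
    j)%N).2.
  elim: j => [|j IH]; first by rewrite addn0 !subrr (is_seminorm0 (psumS _)).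
  have [h1 _ /andP[_ h2] _] := us (k + j)%N.
  have := (psumS (u k).1.2).1 ((u (k + j).+1).1.1 - (u (k + j)%N).1.1) ((u (k + j)%N).1.1 - (u
      k).1.1).
  rewrite addrA subrK addnS; have := psum_le ((u (k + j).+1).1.1 - (u (k + j)%N).1.1) (um _ _
      (leq_addr j k)).
  move: h1 h2 IH; set P1 := psum _ _; set P2 := psum _ _; set P3 := psum _ _; set P4 := psum _
      _; lra.
have tail2 k j : (k <= j)%N -> psum (u k).1.2 ((u j).1.1 - (u k).1.1) <= 2 * (u k).2.
  by move=> /subnKC <-; rewrite (le_trans (tail k _))// gerBl mulr_ge0// ltW.
have [x xE] : exists x, forall i e, 0 < e -> exists N, forall n, (N <= n)%N ->
    p i ((fun n => (u n).1.1) n - x) <= e.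
  apply: pC => i e e0.
  have [N0 HN0] : exists N, 4 / e <= 2 ^+ N.
    exists (Num.truncn (4 / e)).+1; rewrite (le_trans (ltW (truncnS_gt _)))//.
    by rewrite -natrX ler_nat ltnW// ltn_expl.
  pose N := maxn N0 (pickle i).+1; exists N => m n Nm Nn.
  have e4 : 4 * (u N).2 <= e.
    rewrite mulrC -ler_pdivlMr// (le_trans (ue N))// -[leRHS]invrK invf_div.
    rewrite lef_pV2 ?posrE ?exprn_gt0 ?divr_gt0// (le_trans HN0)// ler_eXn2l ?ltr1n//.
    by rewrite leq_maxl.
  have -> : (u m).1.1 - (u n).1.1 = ((u m).1.1 - (u N).1.1) - ((u n).1.1 - (u N).1.1).
    by rewrite opprB addrA subrK.
  have K j : (N <= j)%N -> p i ((u j).1.1 - (u N).1.1) <= 2 * (u N).2.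
    move=> Nj; rewrite (le_trans (p_psum i _))// (le_trans _ (tail2 _ _ Nj))//.
    by rewrite psum_le// (leq_trans _ (uk N))// leq_maxr.
  have := is_seminormB (pS i) ((u m).1.1 - (u N).1.1) ((u n).1.1 - (u N).1.1).
  have := K m Nm; have := K n Nn; lra.
have xP m e : 0 < e -> exists N, forall n, (N <= n)%N -> psum m ((u n).1.1 - x) <= e.
  elim: m e => [|m IH] e e0; first by exists 0%N => n _; rewrite /psum big_nil ltW.
  have e2 : 0 < e / 2 by rewrite divr_gt0.
  have [N HN] := IH _ e2.
  have [N' HN'] : exists N, forall n, (N <= n)%N -> term m ((u n).1.1 - x) <= e / 2.
    rewrite /term; case: (unpickle m) => [i|]; first exact: xE.
    by exists 0%N => n _; exact: ltW.
  exists (maxn N N') => n; rewrite geq_max => /andP[n1 n2].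
  rewrite /psum -addn1 iotaD big_cat/= big_seq1 add0n [leRHS](splitr e) lerD//.
    exact: HN.
  exact: HN'.
have xk k : psum (u k).1.2 (x - (u k).1.1) <= 2 * (u k).2.
  apply/ler_addgt0Pl => e e0; have [N HN] := xP (u k).1.2 e e0.
  rewrite (_ : x - _ = ((u (maxn N k)).1.1 - (u k).1.1) - ((u (maxn N k)).1.1 - x)); last first.
    by rewrite opprB [RHS]addrC addrA subrK.
  rewrite (le_trans (is_seminormB (psumS _) _ _))// addrC lerD//.
    by apply: HN; rewrite leq_maxl.
  by apply: tail2; rewrite leq_maxr.
have [M xM] := qb x.
have [_ _ _ [a]] := us (Num.truncn `|M|).+1.
move=> /(_ _ (xk _)); rewrite addrC subrK => /le_trans/(_ (xM a)).
by rewrite leNgt (le_lt_trans (ler_norm M))// truncnS_gt.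
Qed.

End uniform_boundedness.

Section complex_limits.
Context {R : realType}.
Local Notation C := R[i].
Implicit Types (z w : nat -> C).

Definition tends z (l : C) : Prop :=
  forall e, 0 < e -> exists N, forall n, (N <= n)%N -> normc (z n - l) <= e.

Lemma tends_le z l M N : tends z l -> (forall n, (N <= n)%N -> normc (z n) <= M) -> normc l <= M.
Proof.
move=> zl zM; apply/ler_addgt0Pl => e e0; have [N' H] := zl e e0.
rewrite -[l](subKr (z (maxn N N'))) (le_trans (le_normcB _ _))// addrC lerD//.
  by rewrite H// leq_maxr.
by rewrite zM// leq_maxl.
Qed.

Lemma tends_lin (a b : C) z w l k : tends z l -> tends w k ->
  tends (fun n => a * z n + b * w n) (a * l + b * k).
Proof.
move=> zl wk e e0; set c := normc a + normc b + 1.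
have c0 : 0 < c by rewrite ltr_wpDl// addr_ge0 ?normc_ge0.
have [N HN] := zl (e / c) (divr_gt0 e0 c0); have [N' HN'] := wk (e / c) (divr_gt0 e0 c0).
exists (maxn N N') => n; rewrite geq_max => /andP[n1 n2].
rewrite (_ : _ - _ = a * (z n - l) + b * (w n - k)); last first.
  by rewrite opprD addrACA !mulrBr.
rewrite (le_trans (le_normcD _ _))// !normcM (@le_trans _ _ (normc a * (e / c) + normc b * (e /
    c)))//.
  by rewrite lerD// ler_wpM2l ?normc_ge0 ?HN ?HN'.
rewrite -mulrDl -[leRHS](@divfK _ c) ?gt_eqF// mulrC ler_pM2l ?divr_gt0//.
by rewrite /c lerDl.
Qed.

Lemma tends_cst l : tends (fun=> l) l.
Proof. by move=> e e0; exists 0%N => n _; rewrite subrr normc0 ltW. Qed.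

Lemma real_cauchy (z : nat -> R) : (forall e, 0 < e -> exists N, forall m n,
    (N <= m)%N -> (N <= n)%N -> `|z m - z n| <= e) ->
  exists l : R, forall e, 0 < e -> exists N, forall n, (N <= n)%N -> `|z n - l| <= e.
Proof.
move=> zC; have : cauchy (z @ \oo).
  apply/cauchy_ballP => e e0; have [N HN] := zC (e / 2) (divr_gt0 e0 (ltr0Sn _ 1)).
  exists ([set x | exists2 n, (N <= n)%N & x = z n], [set x | exists2 n, (N <= n)%N & x = z n]).
    by split; exists N => // n /= Nn; exists n.
  move=> [x y] /= [[m Nm ->] [n Nn ->]]; rewrite -ball_normE/=.
  by rewrite (le_lt_trans (HN m n Nm Nn))// ltr_pdivrMr// mulr_natr mulr2n ltrDl.
move/cauchy_cvg/cvg_ex => [l /cvgrPdist_le zl]; exists l => e /zl[N _ HN].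
by exists N => n Nn; rewrite distrC; exact: HN.
Qed.

Lemma complex_cauchy z : (forall e, 0 < e -> exists N, forall m n,
    (N <= m)%N -> (N <= n)%N -> normc (z m - z n) <= e) -> exists l, tends z l.
Proof.
move=> zC.
have [a aE] : exists l : R, forall e, 0 < e -> exists N, forall n, (N <= n)%N ->
    `|complex.Re (z n) - l| <= e.
  apply: real_cauchy => e /zC[N HN]; exists N => m n Nm Nn.
  by rewrite -ReB (le_trans (Re_le_normc _))// HN.
have [b bE] : exists l : R, forall e, 0 < e -> exists N, forall n, (N <= n)%N ->
    `|complex.Im (z n) - l| <= e.
  apply: real_cauchy => e /zC[N HN]; exists N => m n Nm Nn.
  by rewrite -ImB (le_trans (Im_le_normc _))// HN.
exists (Complex a b) => e e0; have e2 : 0 < e / 2 by rewrite divr_gt0.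
have [N HN] := aE _ e2; have [N' HN'] := bE _ e2.
exists (maxn N N') => n; rewrite geq_max => /andP[n1 n2].
by rewrite (le_trans (normc_le _))// ReB ImB [leRHS](splitr e) lerD// ?HN ?HN'.
Qed.

End complex_limits.

(** * Completeness of the Schwartz spaces *)

Section completeness.
Context {R : realType}.
Local Notation C := R[i].

Lemma snorm1_seminorm km : is_seminorm (@snorm1 R km).
Proof. by split; [exact: snorm1D|move=> a x; exact: snorm1Z]. Qed.

Lemma snorm2_seminorm kls : is_seminorm (@snorm2 R kls).
Proof. by split; [exact: snorm2D|move=> a x; exact: snorm2Z]. Qed.

Lemma iter_cderive_lin (a : C) (f g : S1 R) m x : iter m cderive (val (a *: f + g)) x =
  a * iter m cderive (val f) x + iter m cderive (val g) x.
Proof. by rewrite -[val _]/(a *: val f + val g) (iter_cderiveD _ _ (S1P f).1 (S1P g).1). Qed.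

Lemma pderives_lin (a : C) (f g : S2 R) s u : pderives s (val (a *: f + g)) u =
  a * pderives s (val f) u + pderives s (val g) u.
Proof. by rewrite -[val _]/(a *: val f + val g) (pderivesD _ _ (S2P f).1 (S2P g).1). Qed.

Lemma iter_cderiveB (f g : S1 R) m x : iter m cderive (val (f - g)) x =
  iter m cderive (val f) x - iter m cderive (val g) x.
Proof. by rewrite -scaleN1r addrC iter_cderive_lin mulN1r addrC. Qed.

Lemma pderivesB (f g : S2 R) s u : pderives s (val (f - g)) u =
  pderives s (val f) u - pderives s (val g) u.
Proof. by rewrite -scaleN1r addrC pderives_lin mulN1r addrC. Qed.

Lemma cauchy_bounded (E : lmodType C) (q : E -> R) (u : nat -> E) : is_seminorm q ->
  (forall e, 0 < e -> exists N, forall m n, (N <= m)%N -> (N <= n)%N -> q (u m - u n) <= e) ->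
  exists N M, forall n, (N <= n)%N -> q (u n) <= M.
Proof.
move=> qS /(_ 1 ltr01)[N HN]; exists N, (1 + q (u N)) => n Nn.
by rewrite -[u n](subrK (u N)) (le_trans (qS.1 _ _))// lerD2r HN.
Qed.

(** All derivatives converge pointwise. Cauchy sequences are bounded in each seminorm from some rank
    on, so decay and Taylor bounds hold uniformly along the sequence and pass to the limits. *)
Lemma S1_complete : seminorm_complete (@snorm1 R).
Proof.
move=> u uC.
have /choice[g gE] (mx : nat * R) : exists l,
    tends (fun n => iter mx.1 cderive (val (u n)) mx.2) l.
  case: mx => m x /=; apply: complex_cauchy => e /(uC (0, m)%N)[N HN].
  exists N => i j Ni Nj; rewrite -iter_cderiveB (le_trans _ (HN i j Ni Nj))//.
  by have := S1_bound (u i - u j) 0 m x; rewrite expr0 mul1r.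
have gb k m : exists M, forall x, normc ((x ^+ k)%:C%C * g (m, x)) <= M.
  have [N [M HM]] := cauchy_bounded (snorm1_seminorm _) (uC (k, m)).
  exists M => x.
  have := tends_lin (x ^+ k)%:C%C 0 (gE (m, x)) (tends_cst 0); rewrite mulr0 addr0.
  move=> /(@tends_le _ _ _ _ N); apply => n; rewrite addr0 => Nn.
  exact: le_trans (S1_bound _ _ _ _) (HM _ Nn).
(* The quadratic remainder, bounded through the seminorm of order m + 2, identifies consecutive
   limits as a function and its derivative. *)
have gd m x : cderivable (fun x => g (m, x)) x /\ cderive (fun x => g (m, x)) x = g (m.+1, x).
  have [N [M HM]] := cauchy_bounded (snorm1_seminorm _) (uC (0, m.+2)%N).
  apply: (@cderive_quadratic _ _ _ _ (4 * M)) => t.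
  have H := tends_lin 1 (- 1) (gE (m, x + t)) (gE (m, x)).
  have := tends_lin 1 (- t%:C%C) H (gE (m.+1, x)); rewrite !mul1r mulN1r mulNr.
  move=> /(@tends_le _ _ _ _ N); apply => n Nn; rewrite !mul1r mulN1r mulNr.
  by rewrite (le_trans (S1_taylor _ _ _ _))// ler_wpM2r ?sqr_ge0// ler_wpM2l// HM.
have gS : schwartz1 (fun x => g (0%N, x)).
  apply: (@schwartz1_coind _ [set f | exists m, f = fun x => g (m, x)]); last by exists 0%N.
    by move=> _ [m ->] k; exact: gb.
  by move=> _ [m ->]; exists (fun x => g (m.+1, x)) => //; exists m.+1.
have gm m : iter m cderive (val (toS1 (fun x => g (0%N, x)))) = fun x => g (m, x).
  rewrite val_toS1//; elim: m => //= m ->; apply/funext => x; exact: (gd m x).2.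
exists (toS1 (fun x => g (0%N, x))) => -[k m] e /(uC (k, m))[N HN]; exists N => n Nn.
apply: supnorm_le => x; rewrite /weighted1 /= iter_cderiveB gm mulrBr.
have := tends_lin ((x ^+ k)%:C%C * iter m cderive (val (u n)) x) (- (x ^+ k)%:C%C) (tends_cst
    1) (gE (m, x)).
rewrite mulr1 mulNr => /(@tends_le _ _ _ _ N); apply => j Nj; rewrite mulNr -mulrBr
    -iter_cderiveB.
by rewrite (le_trans (S1_bound _ _ _ _))// HN.
Qed.

Lemma S2_complete : seminorm_complete (@snorm2 R).
Proof.
move=> u uC.
have /choice[g gE] (sx : seq bool * (R * R)) : exists l,
    tends (fun n => pderives sx.1 (val (u n)) sx.2) l.
  case: sx => s x /=; apply: complex_cauchy => e /(uC (0, 0, s)%N)[N HN].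
  exists N => i j Ni Nj; rewrite -pderivesB (le_trans _ (HN i j Ni Nj))//.
  by have := S2_bound (u i - u j) 0 0 s x; rewrite !expr0 mul1r mul1r.
have gb k l s : exists M, forall x, normc ((x.1 ^+ k * x.2 ^+ l)%:C%C * g (s, x)) <= M.
  have [N [M HM]] := cauchy_bounded (snorm2_seminorm _) (uC (k, l, s)).
  exists M => x.
  have := tends_lin (x.1 ^+ k * x.2 ^+ l)%:C%C 0 (gE (s, x)) (tends_cst 0); rewrite mulr0 addr0.
  move=> /(@tends_le _ _ _ _ N); apply => n; rewrite addr0 => Nn.
  exact: le_trans (S2_bound _ _ _ _ _) (HM _ Nn).
have gd s d x : pderivable d (fun x => g (s, x)) x /\ pderive d (fun x => g (s, x)) x = g (d ::
    s, x).
  have [N [M HM]] := cauchy_bounded (snorm2_seminorm _) (uC (weightN d 0, d :: d :: s)%N).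
  apply: (@pderive_quadratic _ _ _ _ _ (4 * M)) => t.
  have H := tends_lin 1 (- 1) (gE (s, shift d x t)) (gE (s, x)).
  have := tends_lin 1 (- t%:C%C) H (gE (d :: s, x)); rewrite !mul1r mulN1r mulNr.
  move=> /(@tends_le _ _ _ _ N); apply => n Nn; rewrite !mul1r mulN1r mulNr.
  have := S2_taylor (u n) d 0 s x t; rewrite expr0 mul1r => /le_trans; apply.
  by rewrite ler_wpM2r ?sqr_ge0// ler_wpM2l// HM.
have gS : schwartz2 (fun x => g ([::], x)).
  apply: (@schwartz2_coind _ [set f | exists s, f = fun x => g (s, x)]); last by exists [::].
    by move=> _ [s ->] k l; exact: gb.
  by move=> _ [s ->] d; exists (fun x => g (d :: s, x)) => //; exists (d :: s).
have gm s : pderives s (val (toS2 (fun x => g ([::], x)))) = fun x => g (s, x).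
  rewrite val_toS2//; elim: s => //= d s ->; apply/funext => x; exact: (gd s d x).2.
exists (toS2 (fun x => g ([::], x))) => -[[k l] s] e /(uC (k, l, s))[N HN]; exists N => n Nn.
apply: supnorm_le => x; rewrite /weighted2 /= pderivesB gm mulrBr.
have := tends_lin ((x.1 ^+ k * x.2 ^+ l)%:C%C * pderives s (val (u n)) x) (- (x.1 ^+ k * x.2 ^+
    l)%:C%C) (tends_cst 1) (gE (s, x)).
rewrite mulr1 mulNr => /(@tends_le _ _ _ _ N); apply => j Nj; rewrite mulNr -mulrBr -pderivesB.
by rewrite (le_trans (S2_bound _ _ _ _ _))// HN.
Qed.

End completeness.

(** * Continuity of linear maps into Schwartz spaces *)

Section closed_graph.
Context {R : realType} {E : lmodType R[i]} {I : countType}.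
Local Notation C := R[i].
Local Notation mu := (@lebesgue_measure R).
Variables (p : I -> E -> R) (pS : forall i, is_seminorm (p i)).
Hypothesis pC : seminorm_complete p.

Lemma normc_lin_seminorm (l : E -> C) : (forall a x y, l (a *: x + y) = a * l x + l y) ->
  is_seminorm (fun x => normc (l x)).
Proof.
move=> ll; have l0 : l 0 = 0 by have := ll (-1) 0 0; rewrite scaler0 addr0 mulN1r addNr.
split=> [x y|a x]; first by rewrite -[x]scale1r ll mul1r scale1r le_normcD.
by rewrite -[a *: x]addr0 ll l0 addr0 normcM.
Qed.

(** The form in which uniform boundedness is used: r is continuous as soon as it is controlled by a
    family of seminorms that are continuous one by one and bounded at each vector. *)
Lemma dominated_family (T : Type) (q : T -> E -> R) (r : E -> R) :
  (forall a, is_seminorm (q a)) -> (forall a, dominated p (q a)) ->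
  (forall x, exists M, forall a, q a x <= M) ->
  (forall x M, (forall a, q a x <= M) -> r x <= M) -> dominated p r.
Proof.
move=> qS qp qb qr; have [s [c [c0 H]]] := uniform_boundedness pS pC qS qp qb.
by exists s, c; split=> // x; apply: qr => a; exact: H.
Qed.

Lemma le_epsilon_mul (a b K : R) : 0 <= K -> (forall e, 0 < e -> a <= b + K * e) -> a <= b.
Proof.
move=> K0 H; have K1 : 0 < K + 1 by rewrite ltr_wpDl.
apply/ler_addgt0Pl => e e0; rewrite addrC (le_trans (H (e / (K + 1)) (divr_gt0 e0 K1)))//.
by rewrite lerD2l mulrA ler_pdivrMr// mulrC ler_wpM2l ?(ltW e0)// lerDl.
Qed.

Lemma quotient_split (r e a d : C) : r * e = 1 -> d = r * a - r * (a - e * d).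
Proof. by move=> re; rewrite (mulrBr r a (e * d)) mulrA re mul1r subKr. Qed.

Section schwartz1_target.
Variable M : E -> S1 R.
Hypothesis ML : forall a x y, M (a *: x + y) = a *: M x + M y.

Let D m x (phi : E) : C := iter m cderive (val (M phi)) x.

Let D_lin m x a phi psi : D m x (a *: phi + psi) = a * D m x phi + D m x psi.
Proof. by rewrite /D ML iter_cderive_lin. Qed.

Hypothesis Mp : forall x, dominated p (fun phi => normc (val (M phi) x)).

Let dominated_D m x : dominated p (fun phi => normc (D m x phi)).
Proof.
elim: m x => [|m IH] x; first exact: Mp.
(* Evaluation of the next derivative is a limit of difference quotients, which for a fixed phi are
   bounded because M phi is a Schwartz function. *)
apply: (@dominated_family _ (fun t phi => normc ((t^-1)%:C%C * (D m (x + t) phi - D m x phi)))).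
- move=> t; apply: normc_lin_seminorm => a phi psi; rewrite !D_lin.
  by move: (D _ _ _) (D _ _ _) (D _ _ _) (D _ _ _) => ? ? ? ?; ring.
- move=> t; apply: (dominated_le (q := fun phi => `|t^-1| * (normc (D m (x + t) phi) + normc (D
    m x phi)))).
    by move=> phi; rewrite normcMr ler_wpM2l// le_normcB.
  by apply: dominatedZ => //; exact: dominatedD.
- move=> phi; exists (2 * snorm1 (0, m.+1)%N (M phi)) => t; rewrite normcMr.
  have B : 0 <= 2 * snorm1 (0, m.+1)%N (M phi) by rewrite mulr_ge0// snorm1_ge0.
  (* At t = 0 the quotient is 0 by the convention on inverses, so the index may range over all
     reals. *)
  have [->|t0] := eqVneq t 0; first by rewrite invr0 normr0 mul0r.
  rewrite normfV ler_pdivrMl ?normr_gt0// mulrC (le_trans (S1_lipschitz _ _ _ _))//.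
  by rewrite addrC addKr.
- move=> phi A qA; apply: (@le_epsilon_mul _ _ (4 * snorm1 (0, m.+2)%N (M phi))).
    by rewrite mulr_ge0// snorm1_ge0.
  move=> e e0; have ee : (e^-1)%:C%C * e%:C%C = 1 :> C by rewrite -realcM mulVf// gt_eqF.
  rewrite (_ : D m.+1 x phi = (e^-1)%:C%C * (D m (x + e) phi - D m x phi) -
     (e^-1)%:C%C * (D m (x + e) phi - D m x phi - e%:C%C * D m.+1 x phi)); last first.
    exact: quotient_split.
  rewrite (le_trans (le_normcB _ _))// lerD//.
  rewrite normcMr gtr0_norm ?invr_gt0// ler_pdivrMl//.
  by rewrite (le_trans (S1_taylor _ _ _ _))// expr2 mulrA mulrC.
Qed.

Lemma closed_graph1 km : dominated p (snorm1 km \o M).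
Proof.
case: km => k m.
apply: (@dominated_family _ (fun x phi => normc ((x ^+ k)%:C%C * D m x phi))).
- move=> x; apply: normc_lin_seminorm => a phi psi; rewrite D_lin.
  by move: (D _ _ _) (D _ _ _) => ? ?; ring.
- move=> x; apply: (dominated_le (q := fun phi => `|x ^+ k| * normc (D m x phi))).
    by move=> phi; rewrite normcMr.
  exact: dominatedZ (normr_ge0 _) (dominated_D m x).
- by move=> phi; exists (snorm1 (k, m) (M phi)) => x; exact: S1_bound.
- by move=> phi A qA; exact: supnorm_le.
Qed.

End schwartz1_target.

(** Point evaluations are limits of pairings with [delta_S1 e y], so continuity against every test
    function already gives continuity at every point, which [closed_graph1] upgrades. *)
Lemma closed_graph1_weak (M : E -> S1 R) :
  (forall a x y, M (a *: x + y) = a *: M x + M y) ->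
  (forall psi : S1 R, dominated p (fun phi => normc (cintegral mu (fun x => val (M phi) x * val
      psi x)))) ->
  forall km, dominated p (snorm1 km \o M).
Proof.
move=> ML Mp; apply: closed_graph1 => // y.
have [K K0 HK] := @delta_S1_approx R.
(* The error of the approximation is linear in e; cutting off at e = 1 keeps the family bounded at
   each phi. *)
pose J e phi := if 0 < e <= 1 then cintegral mu (fun x => val (M phi) x * val (delta_S1 e y) x)
    else 0.
have K1 phi : 0 <= K * snorm1 (0, 1)%N (M phi) by rewrite mulr_ge0// snorm1_ge0.
apply: (@dominated_family _ (fun e phi => normc (J e phi))).
- move=> e; apply: normc_lin_seminorm => a phi psi; rewrite /J; case: ifP => _; last by rewrite
    mulr0 addr0.
  rewrite ML.
  have mi f : cintegrable mu (fun x => val (M f) x * val (delta_S1 e y) x).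
    exact: S1_mul_integrable.
  rewrite -(cintegral_lin a (mi phi) (mi psi)); congr cintegral; apply/funext => x.
  by rewrite -[val _ x]/(a * val (M phi) x + val (M psi) x) mulrDl mulrA.
- move=> e; case: (boolP (0 < e <= 1)) => h.
    by apply: dominated_le (Mp (delta_S1 e y)) => phi; rewrite /J h.
  by exists [::], 0; split=> // x; rewrite /J (negbTE h) normc0 mul0r.
- move=> phi; exists (normc (val (M phi) y) + K * snorm1 (0, 1)%N (M phi)) => e.
  rewrite /J; case: ifPn => [/andP[e0 e1]|_]; last by rewrite normc0 addr_ge0 ?normc_ge0.
  rewrite -[X in normc X](subrK (val (M phi) y)) (le_trans (le_normcD _ _))// addrC lerD2l.
  by rewrite (le_trans (HK _ _ _ e0))// ler_piMr.
- move=> phi A qA; apply: (@le_epsilon_mul _ _ (K * snorm1 (0, 1)%N (M phi))) => // e e0.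
  have [e1|e1] := leP e 1.
    have := qA e; have := HK (M phi) y e e0; rewrite /J e0 e1/=.
    set J1 := cintegral _ _ => h1 h2.
    rewrite -[val _ y](subKr J1) (le_trans (le_normcB _ _))// lerD//.
  have := qA 1; have := HK (M phi) y 1 ltr01; rewrite /J ltr01 lexx/=.
  set J1 := cintegral _ _ => h1 h2.
  rewrite -[val _ y](subKr J1) (le_trans (le_normcB _ _))// lerD// (le_trans h1)//.
  by rewrite ler_wpM2l// ltW.
Qed.

Lemma closed_graph2 (M : E -> S2 R) :
  (forall a x y, M (a *: x + y) = a *: M x + M y) ->
  (forall u, dominated p (fun phi => normc (val (M phi) u))) ->
  forall kls, dominated p (snorm2 kls \o M).
Proof.
move=> ML Mp; pose D s u phi := pderives s (val (M phi)) u.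
have D_lin s u a phi psi : D s u (a *: phi + psi) = a * D s u phi + D s u psi.
  by rewrite /D ML pderives_lin.
have Dp s u : dominated p (fun phi => normc (D s u phi)).
  elim: s u => [|d s IH] u; first exact: Mp.
  apply: (@dominated_family _ (fun t phi => normc ((t^-1)%:C%C * (D s (shift d u t) phi - D s u
      phi)))).
  - move=> t; apply: normc_lin_seminorm => a phi psi; rewrite !D_lin.
    by move: (D _ _ _) (D _ _ _) (D _ _ _) (D _ _ _) => ? ? ? ?; ring.
  - move=> t; apply: (dominated_le (q := fun phi => `|t^-1| * (normc (D s (shift d u t) phi) +
      normc (D s u phi)))).
      by move=> phi; rewrite normcMr ler_wpM2l// le_normcB.
    by apply: dominatedZ => //; exact: dominatedD.
  - move=> phi; exists (2 * snorm2 (weightN d 0, d :: s)%N (M phi)) => t; rewrite normcMr.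
    have B : 0 <= 2 * snorm2 (weightN d 0, d :: s)%N (M phi) by rewrite mulr_ge0// snorm2_ge0.
    have [->|t0] := eqVneq t 0; first by rewrite invr0 normr0 mul0r.
    rewrite normfV ler_pdivrMl ?normr_gt0// mulrC.
    by have := S2_lipschitz (M phi) d 0 s u t; rewrite expr0 mul1r.
  - move=> phi A qA; apply: (@le_epsilon_mul _ _ (4 * snorm2 (weightN d 0, d :: d :: s)%N (M
      phi))).
      by rewrite mulr_ge0// snorm2_ge0.
    move=> e e0; have ee : (e^-1)%:C%C * e%:C%C = 1 :> C by rewrite -realcM mulVf// gt_eqF.
    rewrite (_ : D (d :: s) u phi = (e^-1)%:C%C * (D s (shift d u e) phi - D s u phi) -
       (e^-1)%:C%C * (D s (shift d u e) phi - D s u phi - e%:C%C * D (d :: s) u phi)); last first.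
      exact: quotient_split.
    rewrite (le_trans (le_normcB _ _))// lerD//.
    rewrite normcMr gtr0_norm ?invr_gt0// ler_pdivrMl//.
    have := S2_taylor (M phi) d 0 s u e; rewrite expr0 mul1r => /le_trans; apply.
    by rewrite expr2 mulrA mulrC.
move=> [[k l] s].
apply: (@dominated_family _ (fun u phi => normc ((u.1 ^+ k * u.2 ^+ l)%:C%C * D s u phi))).
- move=> u; apply: normc_lin_seminorm => a phi psi; rewrite D_lin.
  by move: (D _ _ _) (D _ _ _) => ? ?; ring.
- move=> u; apply: (dominated_le (q := fun phi => `|u.1 ^+ k * u.2 ^+ l| * normc (D s u phi))).
    by move=> phi; rewrite normcMr.
  exact: dominatedZ (normr_ge0 _) (Dp s u).
- by move=> phi; exists (snorm2 (k, l, s) (M phi)) => u; exact: S2_bound.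
- by move=> phi A qA; exact: supnorm_le.
Qed.

End closed_graph.

(** * The operators of a left multiplier *)

Section continuous_operations.
Context {R : realType}.
Local Notation C := R[i].
Local Notation mu := (@lebesgue_measure R).
Local Notation sn1 := (@snorm1 R).
Local Notation sn2 := (@snorm2 R).
Implicit Types (f g h F G H : S2 R) (phi psi theta : S1 R).

Lemma S1_val_lin (a : C) phi psi x : val (a *: phi + psi) x = a * val phi x + val psi x.
Proof. by []. Qed.

Lemma S2_val_lin (a : C) f g u : val (a *: f + g) u = a * val f u + val g u.
Proof. by []. Qed.

Lemma rot_lin (a : C) f g : rot (a *: f + g) = a *: rot f + rot g.
Proof. by apply: val_inj; apply/funext => u; rewrite (S2_val_lin a (rot f) (rot g)) !val_rot. Qed.

Lemma mulrDr_CA (p a x y : C) : p * (a * x + y) = a * (p * x) + p * y.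
Proof. by rewrite mulrDr mulrCA. Qed.

Lemma Fp_lin (a : C) f g : Fp (a *: f + g) = a *: Fp f + Fp g.
Proof.
apply: val_inj; apply/funext => u; apply: (etrans (val_Fp _ u)); rewrite fou_lin mulrDr_CA.
exact: esym (congr2 (fun x y => a * x + y) (val_Fp f u) (val_Fp g u)).
Qed.

Lemma Fm_lin (a : C) f g : Fm (a *: f + g) = a *: Fm f + Fm g.
Proof.
apply: val_inj; apply/funext => u; apply: (etrans (val_Fm _ u)); rewrite fou_lin mulrDr_CA.
exact: esym (congr2 (fun x y => a * x + y) (val_Fm f u) (val_Fm g u)).
Qed.

Lemma Wbarinv_lin (a : C) f g : Wbarinv (a *: f + g) = a *: Wbarinv f + Wbarinv g.
Proof. by rewrite !Wbarinv_fourier rot_lin Fp_lin. Qed.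

Lemma Wbar_lin (a : C) f g : Wbar (a *: f + g) = a *: Wbar f + Wbar g.
Proof. by rewrite /Wbar Fm_lin rot_lin. Qed.

Lemma dominated_fou s u : dominated sn2 (fun f => normc (fou s f u)).
Proof.
apply: dominated_le (fun f => fou_le s f u) _.
apply: (dominatedZ (p := sn2)); first by rewrite mulr_ge0// wtI_ge0.
by apply: (dominatedD (p := sn2) snorm2_seminorm); exact: dominated_self.
Qed.

(** Here, and for the maps that follow, [closed_graph2] or [closed_graph1] reduces all seminorms of
    the image to a bound on its point values. *)
Lemma dominated_rot kls : dominated sn2 (sn2 kls \o (@rot R)).
Proof.
apply: (closed_graph2 snorm2_seminorm (@S2_complete R) rot_lin) => u.
exists [:: (0, 0, [::])%N], 1; split=> // f.
by rewrite big_seq1 mul1r val_rot S2_le.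
Qed.

Lemma dominated_Wbar kls : dominated sn2 (sn2 kls \o (@Wbar R)).
Proof.
apply: (closed_graph2 snorm2_seminorm (@S2_complete R) Wbar_lin) => u.
apply: (dominated_le (q := fun f => (Num.sqrt (2 * pi))^-1 * normc (fou (-1) f (rotation u)))).
  by move=> f; rewrite val_rot val_Fm normcMr ger0_norm// invr_ge0.
by apply: dominatedZ (dominated_fou _ _); rewrite invr_ge0.
Qed.

Lemma dominated_Wbarinv kls : dominated sn2 (sn2 kls \o (@Wbarinv R)).
Proof.
apply: (closed_graph2 snorm2_seminorm (@S2_complete R) Wbarinv_lin) => u.
apply: (dominated_le (q := fun f => (Num.sqrt (2 * pi))^-1 * normc (fou 1 (rot f) u))).
  by move=> f; rewrite Wbarinv_fourier val_Fp normcMr ger0_norm// invr_ge0.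
apply: dominatedZ; first by rewrite invr_ge0.
exact: (dominated_comp snorm2_seminorm dominated_rot (dominated_fou 1 u)).
Qed.

Lemma slice_lin y (a : C) f g : slice (a *: f + g) y = a *: slice f y + slice g y.
Proof. by apply: val_inj; apply/funext => u; rewrite (S1_val_lin a (slice f y) (slice g y))
    !val_slice. Qed.

Lemma snorm1_slice k m f y : sn1 (k, m) (slice f y) <= sn2 (0, k, nseq m true)%N f.
Proof.
apply: supnorm_le => x; rewrite /weighted1 /= val_slice iter_cderive_slice.
by have := S2_bound f 0 k (nseq m true) (y, x); rewrite expr0 mul1r.
Qed.

Lemma dominated_slice y km : dominated sn2 (fun f => sn1 km (slice f y)).
Proof.
case: km => k m; exists [:: (0, k, nseq m true)%N], 1; split=> // f.
by rewrite big_seq1 mul1r snorm1_slice.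
Qed.

Lemma tensor_linr psi (a : C) (f g : S1 R) : tensor psi (a *: f + g) = a *: tensor psi f +
    tensor psi g.
Proof.
apply: val_inj; apply/funext => u.
rewrite (S2_val_lin a (tensor psi f) (tensor psi g)) !val_tensor.
by rewrite S1_val_lin mulrDr mulrCA.
Qed.

Lemma dominated_tensorr psi kls : dominated sn1 (sn2 kls \o tensor psi).
Proof.
apply: (closed_graph2 snorm1_seminorm (@S1_complete R) (tensor_linr psi)) => u.
exists [:: (0, 0)%N], (normc (val psi u.1)); split=> [|phi]; first exact: normc_ge0.
by rewrite big_seq1 val_tensor normcM ler_wpM2l ?normc_ge0 ?S1_le.
Qed.

Local Notation chi := (gS1 2^-1 0 : S1 R).

(* As chi(0) = 1, this is the function x |-> \int theta(z) F(z, x) dz. *)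
Definition contract (theta : S1 R) F : S1 R := slice (comp (tensor chi theta) F) 0.

Lemma val_contract theta F :
  val (contract theta F) = fun x => cintegral mu (fun z => val theta z * val F (z, x)).
Proof.
rewrite val_slice val_comp; apply/funext => x; congr cintegral; apply/funext => z.
rewrite val_tensor /= val_gS1 ?half_gt0// /gaussian subrr expr0n mulr0 oppr0 expR0.
by rewrite mul1r.
Qed.

Lemma contract_integrable theta F x : cintegrable mu (fun z => val theta z * val F (z, x)).
Proof.
have := kcomp_integrable (tensor chi theta) F 0 x.
congr cintegrable; apply/funext => z.
rewrite val_tensor /= val_gS1 ?half_gt0// /gaussian subrr expr0n mulr0 oppr0 expR0.
by rewrite mul1r.
Qed.

Lemma contract_lin theta (a : C) F G :
  contract theta (a *: F + G) = a *: contract theta F + contract theta G.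
Proof.
apply: val_inj; apply/funext => x.
transitivity (a * val (contract theta F) x + val (contract theta G) x); last by [].
transitivity (a * cintegral mu (fun z => val theta z * val F (z, x)) +
    cintegral mu (fun z => val theta z * val G (z, x))); last first.
  by congr (_ * _ + _); rewrite val_contract.
rewrite val_contract.
rewrite -(cintegral_lin a (contract_integrable theta F x) (contract_integrable theta G x)).
by congr cintegral; apply/funext => z; rewrite S2_val_lin mulrDr mulrCA.
Qed.

Lemma dominated_contract theta km : dominated sn2 (sn1 km \o contract theta).
Proof.
apply: (closed_graph1 snorm2_seminorm (@S2_complete R) (contract_lin theta)) => x.
pose M := snorm1 (0, 0)%N theta + snorm1 (2, 0)%N theta.
have M0 : 0 <= M by rewrite addr_ge0 ?snorm1_ge0.
exists [:: (0, 0, [::])%N], (2 * wtI * M); split; first by rewrite mulr_ge0 ?mulr_ge0 ?wtI_ge0.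
move=> F; rewrite big_seq1 val_contract -!mulrA.
rewrite [leRHS]mulrA; apply: cintegral_wt.
  apply: cmeasurableM; first exact: cmeasurable_S1.
  exact: S2_cmeasurable_l.
move=> z; rewrite normcM mulrAC ler_pM ?normc_ge0 ?S2_le//; exact: S1_wt.
Qed.

Lemma contract_tensor theta psi phi :
  contract theta (tensor psi phi) = cintegral mu (fun z => val theta z * val psi z) *: phi.
Proof.
apply: val_inj; apply/funext => x; rewrite val_contract.
rewrite -[RHS]/(cintegral mu (fun z => val theta z * val psi z) * val phi x) mulrC -cintegralZ;
    last exact: S1_mul_integrable.
by congr cintegral; apply/funext => z; rewrite val_tensor/= mulrA mulrC.
Qed.

(** Composition with a rank-one kernel stays of rank one; this is how contractions enter when the
    multiplier identity is tested on tensors. *)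
Lemma comp_tensor psi theta F : comp (tensor psi theta) F = tensor psi (contract theta F).
Proof.
apply: val_inj; apply/funext => u; rewrite val_comp [in RHS]val_tensor val_contract /kcomp.
rewrite -cintegralZ; last exact: contract_integrable.
by congr cintegral; apply/funext => z; rewrite val_tensor /= mulrA.
Qed.

Lemma pderives_kcomp H F m :
  pderives (nseq m true) (kcomp H F) = kcomp H (iter m (D2 true) F).
Proof.
by elim: m => //= m ->; apply/funext => u; exact: (kcomp_pderive2 _ _ u).2.
Qed.

Lemma kcomp_weight H F k u : (u.2 ^+ k)%:C%C * kcomp H F u = kcomp H (iter k (mulX true) F) u.
Proof.
elim: k => [|k IH]; first by rewrite expr0 mul1r.
by rewrite exprS realcM -mulrA IH iterS kcomp_mulXr.
Qed.

(** Weight and derivative act on the variable that is not contracted, so one kernel F' absorbs them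
    for slices and contractions alike, and every seminorm of their difference becomes a supremum. *)
Lemma contract_weighted F k m : exists F' : S2 R, forall x,
  (forall y, (x ^+ k)%:C%C * iter m cderive (val (slice F y)) x = val F' (y, x)) /\
  (forall theta, (x ^+ k)%:C%C * iter m cderive (val (contract theta F)) x =
     val (contract theta F') x).
Proof.
exists (iter k (mulX true) (iter m (D2 true) F)) => x; split=> [y|theta].
  have -> : iter m cderive (val (slice F y)) x = val (iter m (D2 true) F) (y, x).
    rewrite val_slice iter_cderive_slice; move: (y, x) => {x y} u.
    by elim: m u => //= m IH u; rewrite val_D2; congr (pderive _ _ u); apply/funext.
  elim: k => [|k IH]; first by rewrite expr0 mul1r.
  by rewrite exprS realcM -mulrA IH iterS val_mulX.
transitivity ((x ^+ k)%:C%C * pderives (nseq m true) (kcomp (tensor chi theta) F) (0, x)).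
  congr (_ * _); rewrite /contract val_slice iter_cderive_slice.
  by rewrite (val_comp (tensor chi theta) F).
rewrite pderives_kcomp (kcomp_weight _ _ k (0, x)).
by rewrite -val_comp -[RHS]/(val (slice _ 0) x) val_slice.
Qed.

(** The Lipschitz constant of F' in its first variable is uniform in x, and so is the error of
    [delta_approx]; hence the same linear rate holds for the supremum over x. *)
Lemma contract_delta F y km : exists2 K, 0 <= K & forall e, 0 < e ->
  sn1 km (contract (delta_S1 e y) F - slice F y) <= K * e.
Proof.
case: km => k m; have [K K0 HK] := @delta_approx R.
have [F' HF] := contract_weighted F k m.
pose L : R := 2 * sn2 (weightN false 0, [:: false])%N F'.
have L0 : 0 <= L by rewrite mulr_ge0// snorm2_ge0.
exists (K * L) => [|e e0]; first exact: mulr_ge0.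
apply: supnorm_le => x; have [Hs Hc] := HF x.
have -> : weighted1 (k, m) (val (contract (delta_S1 e y) F - slice F y)) x =
    val (contract (delta_S1 e y) F') x - val F' (y, x).
  by rewrite /weighted1 iter_cderiveB mulrBr; congr (_ - _); [exact: Hc|exact: Hs].
rewrite (_ : val (contract (delta_S1 e y) F') x =
    cintegral mu (fun z => val (delta_S1 e y) z * val F' (z, x))); last by rewrite val_contract.
apply: (HK (fun z => val F' (z, x)) y L (sn2 (0, 0, [::])%N F') e) => //.
- exact: S2_cmeasurable_l.
- by move=> z; exact: S2_le.
- move=> z; have := S2_lipschitz F' false 0 [::] (y, x) (z - y).
  by rewrite expr0 mul1r /shift /line /= [y + _]addrC subrK.
Qed.

End continuous_operations.

(** * From a left multiplier to its two operators *)

Section left_multiplier.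
Context {R : realType}.
Local Notation C := R[i].
Local Notation mu := (@lebesgue_measure R).
Local Notation sn1 := (@snorm1 R).
Local Notation sn2 := (@snorm2 R).
Implicit Types (f g h F G H : S2 R) (phi psi theta : S1 R).
Local Notation chi := (gS1 2^-1 0 : S1 R).
Local Notation P := (Num.sqrt pi : R).

Lemma sqrtpi_gt0 : 0 < P. Proof. by rewrite sqrtr_gt0 pi_gt0. Qed.

(** The square of [chi] is exp(-z^2). The value is again sqrt(pi), here as the squared norm of
    [chi], whereas in [mateE] it is the quotient 2 pi / (2 sqrt pi). *)
Lemma integral_chi_sqr : cintegral mu (fun z => val chi z * val chi z) = P%:C%C.
Proof.
have s2 := @sqrt2_gt0 R; have gi := @gS1_integrable R 2^-1 0 half_gt0.
have := cintegral_affine 0 s2 gi; rewrite gaussian_half_integral.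
rewrite sqrtrM// realcM mulrA -realcM mulVf ?gt_eqF// mul1r => <-.
congr cintegral; apply/funext => z; rewrite val_gS1 ?half_gt0// -realcM; congr (_%:C%C).
rewrite /gaussian -expRD addr0 !subr0 exprMn sqrt2_sqr; congr expR.
by rewrite mulKf// -opprD -mulrDl -[2^-1]mul1r -splitr mul1r.
Qed.

Section mates.
Variables (T : S2 R -> C) (f g : S2 R).
Hypothesis fg : forall h, T (twisted f h) = pairing2 g h.
Hypothesis TL : forall (a : C) f g, T (a *: f + g) = a * T f + T g.

(** The test function is [Wbarinv H]: [twistedE] turns the left side into a composition and
    [pairing2E] the right side into a trace. *)
Lemma mateE H : P%:C%C * T (Wbarinv (comp H (Wbar f))) =
  cintegral mu (fun x => cintegral mu (fun y => val (Wbar g) (y, x) * val H (x, y))).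
Proof.
have TZ := lin_formZ TL.
have := fg (Wbarinv H); rewrite twistedE pairing2E WbarinvK TZ.
set X := T _; set Y := cintegral _ _.
have p0 : (2 * pi : R) != 0 by rewrite gt_eqF// mulr_gt0// pi_gt0.
move=> /(congr1 (fun z => (2 * pi)%:C%C * z)); rewrite !mulrA -!realcM mulfV// mul1r.
have -> : 2 * pi * (2 * P)^-1 = P; last by [].
by rewrite invfM mulrACA mulfV// mul1r -{1}(sqr_sqrtr (pi_ge0 R)) expr2 mulfK// gt_eqF//
    sqrtpi_gt0.
Qed.

(** Taking H of rank one separates the test function psi from the average against theta. Any
    operator representing T must therefore send the average of V f to that of V g. *)
Lemma mate_contract psi theta :
  P%:C%C * T (Wbarinv (tensor psi (contract theta (Wbar f)))) =
  cintegral mu (fun x => val (contract theta (Wbar g)) x * val psi x).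
Proof.
rewrite -comp_tensor mateE; congr cintegral; apply/funext => x.
rewrite val_contract mulrC -cintegralZ; last exact: contract_integrable.
congr cintegral; apply/funext => y; rewrite val_tensor /=.
by rewrite mulrC -mulrA.
Qed.

End mates.

Variable T : S2 R -> C.
Hypothesis TL : forall (a : C) f g, T (a *: f + g) = a * T f + T g.
Hypothesis Tp : dominated sn2 (fun f => normc (T f)).
Hypothesis TM : forall f, exists g, forall h, T (twisted f h) = pairing2 g h.

(** The defining property of [ZW] with both normalizations, 1 / sqrt 2 and 1 / sqrt(2 pi), collected
    into [P]; A is a bare function, whose linearity and continuity are then consequences. *)
Definition represents (A : S1 R -> S1 R) : Prop := forall phi psi,
  P%:C%C * T (Wbarinv (tensor psi phi)) = cintegral mu (fun x => val (A phi) x * val psi x).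

Lemma Wtensor_lin psi (a : C) phi phi' : T (Wbarinv (tensor psi (a *: phi + phi'))) =
  a * T (Wbarinv (tensor psi phi)) + T (Wbarinv (tensor psi phi')).
Proof. by rewrite tensor_linr Wbarinv_lin TL. Qed.

Lemma represents_lin A : represents A ->
  forall (a : C) phi psi, A (a *: phi + psi) = a *: A phi + A psi.
Proof.
move=> AT a phi psi; apply: S1_dual_separates => theta; rewrite -AT.
transitivity (a * cintegral mu (fun x => val (A phi) x * val theta x) +
   cintegral mu (fun x => val (A psi) x * val theta x)).
  apply: etrans (congr2 (fun u v => a * u + v) (AT phi theta) (AT psi theta)).
  apply: (etrans (congr1 (fun z => P%:C%C * z) (Wtensor_lin theta a phi psi))).
  exact: mulrDr_CA.
rewrite -(cintegral_lin a (S1_mul_integrable _ _) (S1_mul_integrable _ _)).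
by congr cintegral; apply/funext => x; rewrite S1_val_lin mulrDl mulrA.
Qed.

(** For a fixed psi the pairing with A phi is T applied to a continuous image of phi, hence
    continuous; the weak closed graph theorem does the rest. *)
Lemma represents_dominated A : represents A -> forall km, dominated sn1 (sn1 km \o A).
Proof.
move=> AT; apply: (closed_graph1_weak snorm1_seminorm (@S1_complete R) (represents_lin AT)) =>
    psi.
have D : dominated sn1 (fun phi => normc (T (Wbarinv (tensor psi phi)))).
  apply: (dominated_comp (M := tensor psi) (r := fun F => normc (T (Wbarinv F))) snorm1_seminorm).
    exact: dominated_tensorr.
  exact: (dominated_comp (M := @Wbarinv R) (r := fun f => normc (T f)) snorm2_seminorm
      dominated_Wbarinv Tp).
apply: dominated_le (dominatedZ (ltW sqrtpi_gt0) D) => phi.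
by rewrite -AT normcMr gtr0_norm ?sqrtpi_gt0.
Qed.

Lemma represents_exists : exists A, represents A.
Proof.
have /choice[g gE] phi : exists g, forall h,
    T (twisted (Wbarinv (tensor chi phi)) h) = pairing2 g h by exact: TM.
(* The mate of chi (x) phi, averaged against [chi], is A applied to P phi, since averaging chi (x)
   phi gives P phi. The mates g are chosen without any linearity. *)
exists (fun phi => (P%:C%C)^-1 *: contract chi (Wbar (g phi))) => phi psi.
have := mate_contract (gE phi) TL psi chi.
have n0 : (P%:C%C : C) != 0 by rewrite (inj_eq (@complexI R) _ 0) gt_eqF// sqrtpi_gt0.
rewrite WbarinvK contract_tensor integral_chi_sqr => E.
have -> : T (Wbarinv (tensor psi phi)) = (P%:C%C)^-1 * T (Wbarinv (tensor psi (P%:C%C *: phi))).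
  have TZ := @lin_formZ _ _ (fun phi => T (Wbarinv (tensor psi phi))) (Wtensor_lin psi) P%:C%C
      phi.
  by apply: etrans (congr1 (fun z => (P%:C%C)^-1 * z) (esym TZ)); rewrite mulKf.
rewrite mulrCA E -cintegralZ; last exact: S1_mul_integrable.
by congr cintegral; apply/funext => x; rewrite mulrA.
Qed.

Lemma represents_mate A f g theta : represents A ->
  (forall h, T (twisted f h) = pairing2 g h) ->
  A (contract theta (Wbar f)) = contract theta (Wbar g).
Proof.
by move=> AT fg; apply: S1_dual_separates => psi; rewrite -AT; exact: mate_contract.
Qed.

(** With theta = [delta_S1 e y] both contractions tend to slices at y, the one of F in every
    seminorm; finitely many of these control A, so both errors are linear in e. *)
Lemma represents_slice A f g : represents A ->
  (forall h, T (twisted f h) = pairing2 g h) ->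
  forall y x, val (Wbar g) (y, x) = val (A (slice (Wbar f) y)) x.
Proof.
move=> AT fg y x; set F := Wbar f; set G := Wbar g.
have AC theta : A (contract theta F) = contract theta G by exact: represents_mate.
have [s [c [c0 Hc]]] := represents_dominated AT (0, 0)%N.
have [K K0 HK] : exists2 K, 0 <= K & forall e, 0 < e ->
    \sum_(i <- s) sn1 i (contract (delta_S1 e y) F - slice F y) <= K * e.
  elim: s {Hc} => [|i s [K K0 HK]]; first by exists 0 => // e _; rewrite big_nil mul0r.
  have [K' K'0 HK'] := contract_delta F y i.
  exists (K' + K) => [|e e0]; first exact: addr_ge0.
  by rewrite big_cons mulrDl lerD ?HK ?HK'.
have [L L0 HL] := contract_delta G y (0, 0)%N.
apply/eqP; rewrite -subr_eq0; apply/eqP.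
apply: (@normc_eq0_linear _ _ (c * K + L)) => e e0 _.
pose d := delta_S1 e y.
have -> : val G (y, x) - val (A (slice F y)) x =
    val (A (contract d F - slice F y)) x - val (contract d G - slice G y) x.
  have -> : A (contract d F - slice F y) = contract d G - A (slice F y).
    by rewrite (lin_mapB (represents_lin AT)) AC.
  transitivity ((val (contract d G) x - val (A (slice F y)) x) - (val (contract d G) x - val
      (slice G y) x)) => //.
  by rewrite opprB [RHS]addrC subrKA val_slice.
rewrite (le_trans (le_normcB _ _))// mulrDl lerD//.
  rewrite (le_trans (S1_le _ _))// (le_trans (Hc _))// -mulrA ler_wpM2l//; exact: HK.
by rewrite (le_trans (S1_le _ _))//; exact: HL.
Qed.

Lemma represents_contract A g phi : represents A ->
  (forall h, T (twisted (Wbarinv (tensor chi phi)) h) = pairing2 g h) ->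
  A phi = (P^-1)%:C%C *: contract chi (Wbar g).
Proof.
move=> AT /(represents_mate chi AT); rewrite WbarinvK contract_tensor integral_chi_sqr => <-.
rewrite (lin_mapZ (represents_lin AT)) scalerA -realcM mulVf ?scale1r//.
by rewrite gt_eqF// sqrtpi_gt0.
Qed.

(** The mates form a function by choice alone. In Wigner coordinates its point values are A applied
    to slices, which yields linearity and, by [closed_graph2], continuity. *)
Lemma left_multiplier_exists A : represents A -> exists L : S2 R -> S2 R,
  [/\ forall (a : C) f g, L (a *: f + g) = a *: L f + L g,
      forall kls, dominated sn2 (sn2 kls \o L) &
      forall f h, T (twisted f h) = pairing2 (L f) h].
Proof.
move=> AT; have [L LE] := choice TM; exists L.
have S f u : val (Wbar (L f)) u = val (A (slice (Wbar f) u.1)) u.2.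
  by case: u => y x; exact: represents_slice (LE f) y x.
have WL (a : C) f g : Wbar (L (a *: f + g)) = a *: Wbar (L f) + Wbar (L g).
  apply: val_inj; apply/funext => u; apply: (etrans (S _ u)).
  rewrite Wbar_lin slice_lin (represents_lin AT).
  exact: esym (congr2 (fun x y => a * x + y) (S f u) (S g u)).
split=> // [a f g|kls].
  by apply: (can_inj (@WbarK R)); rewrite WL Wbar_lin.
have WD : forall kls, dominated sn2 (sn2 kls \o (fun f => Wbar (L f))).
  apply: (closed_graph2 snorm2_seminorm (@S2_complete R) WL) => u.
  apply: (dominated_le (q := (fun phi => sn1 (0, 0)%N (A phi)) \o (fun f => slice (Wbar f) u.1))).
    by move=> f; rewrite S; exact: S1_le.
  apply: (dominated_comp (q := sn1) snorm2_seminorm); last exact: represents_dominated.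
  move=> km; apply: (dominated_comp (M := @Wbar R) (r := fun F => sn1 km (slice F u.1))
      snorm2_seminorm).
    exact: dominated_Wbar.
  exact: dominated_slice.
apply: (dominated_le (q := (sn2 kls \o @Wbarinv R) \o (fun f => Wbar (L f)))).
  by move=> f; rewrite /= WbarK.
exact: (dominated_comp snorm2_seminorm WD (dominated_Wbarinv kls)).
Qed.

End left_multiplier.

(** * Derivatives of an operator applied slicewise *)

Section mixed_derivatives.
Context {R : realType}.
Local Notation C := R[i].
Local Notation sn1 := (@snorm1 R).
Local Notation sn2 := (@snorm2 R).
Implicit Types (F G : S2 R) (phi psi : S1 R).

Lemma D2_mulX_comm F : D2 false (mulX true F) = mulX true (D2 false F).
Proof.
apply: val_inj; apply/funext => u; rewrite val_D2 !val_mulX val_D2.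
exact: (cderiveZl (u.2)%:C%C (S2_pderivable F false u)).2.
Qed.

Lemma D2Z d (a : C) F : D2 d (a *: F) = a *: D2 d F.
Proof.
apply: val_inj; apply/funext => u; rewrite val_D2 -[RHS]/(a * val (D2 d F) u) val_D2.
rewrite !pderiveE; apply: (cderiveZl a _).2; rewrite -pderivableE.
exact: S2_pderivable.
Qed.

(* On the Fourier side, the second derivative is a multiplication. *)
Lemma D2_comm F : D2 true (D2 false F) = D2 false (D2 true F).
Proof.
have [h hE] : exists h : S2 R, val F = fou 1 h.
  exists ((Num.sqrt (2 * pi))^-1%:C%C *: Fm F).
  by rewrite -{1}[F]Fp_Fm; apply/funext => u; rewrite fouZ val_Fp.
pose c : C := 'i%C * 1%:C%C.
have D1 (G g : S2 R) : val G = fou 1 g -> val (D2 false G) = fou 1 (D2 false g).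
  by move=> GE; rewrite val_D2 GE; apply/funext => u; exact: (fou_pderive1 1 g u).2.
have DX (G g : S2 R) : val G = fou 1 g -> val (D2 true G) = fou 1 (c *: mulX true g).
  by move=> GE; rewrite val_D2 GE; apply/funext => u; exact: (fou_pderive2 1 g u).2.
apply: val_inj; apply: (etrans (DX _ _ (D1 _ _ hE))); symmetry.
by apply: (etrans (D1 _ _ (DX _ _ hE))); rewrite D2Z D2_mulX_comm.
Qed.

Lemma pderives_D2 F m : pderives (nseq m true) (val (D2 false F)) =
  pderive false (pderives (nseq m true) (val F)).
Proof.
elim: m => [|m IH]; first by rewrite val_D2.
have [g gE] := S2_pderives F (nseq m true).
transitivity (pderive true (pderives (nseq m true) (val (D2 false F)))) => //.
by rewrite IH -[RHS]/(pderive false (pderive true (pderives _ _))) -gE -!val_D2 D2_comm.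
Qed.

(** The curve y |-> [slice F y] is differentiable in S1 with a quadratic remainder in each seminorm.
    The commutation of the partial derivatives enters through [pderives_D2]. *)
Lemma slice_taylor F k m y t :
  sn1 (k, m) (slice F (y + t) - slice F y - t%:C%C *: slice (D2 false F) y)
  <= 4 * sn2 (weightN false k, [:: false, false & nseq m true]) F * t ^+ 2.
Proof.
apply: supnorm_le => x; rewrite /weighted1 !iter_cderiveB.
have Z : iter m cderive (val (t%:C%C *: slice (D2 false F) y)) x =
    t%:C%C * pderives [:: false & nseq m true] (val F) (y, x).
  rewrite (lin_formZ (l := fun phi => iter m cderive (val phi) x)).
    by rewrite val_slice iter_cderive_slice pderives_D2.
  by move=> a phi psi; exact: iter_cderive_lin.
rewrite Z !val_slice !iter_cderive_slice.
exact: (S2_taylor F false k (nseq m true) (y, x) t).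
Qed.

(** Derivatives in y pass through A onto the kernel, derivatives in x stay outside, so only the two
    letter counts of the word matter and not its order. *)
Lemma slice_operator_pderives (A : S1 R -> S1 R) F G :
  (forall (a : C) phi psi, A (a *: phi + psi) = a *: A phi + A psi) ->
  (forall km, dominated sn1 (sn1 km \o A)) ->
  (forall y x, val G (y, x) = val (A (slice F y)) x) ->
  forall w y x, pderives w (val G) (y, x) = iter (count id w) cderive
    (val (A (slice (iter (count negb w) (D2 false) F) y))) x.
Proof.
move=> AL Ap GF; elim=> [|d w IH] y x; first exact: GF.
case: d.
  have IHx : (fun t => pderives w (val G) (y, t)) = iter (count id w) cderive
      (val (A (slice (iter (count negb w) (D2 false) F) y))) by apply/funext => t; exact: IH.
  by rewrite /= add0n -[LHS]/(cderive (fun t => pderives w (val G) (y, t)) x) IHx.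
set b := count id w; set Fa := iter (count negb w) (D2 false) F.
have [s [c [c0 Hc]]] := Ap (0, b)%N.
(* A is controlled by finitely many seminorms, on each of which the slices have a quadratic
   remainder; the sum of the constants bounds the remainder after A. *)
have [K HK] : exists K, forall t, \sum_(i <- s)
    sn1 i (slice Fa (y + t) - slice Fa y - t%:C%C *: slice (D2 false Fa) y) <= K * t ^+ 2.
  elim: s {Hc} => [|[k m] s [K HK]]; first by exists 0 => t; rewrite big_nil mul0r.
  exists (4 * sn2 (weightN false k, [:: false, false & nseq m true]) Fa + K) => t.
  by rewrite big_cons mulrDl lerD// slice_taylor.
apply: (@pderive_quadratic _ false (pderives w (val G)) (y, x) _ (c * K) _).2 => t.
rewrite /shift /line /= !IH -/b -/Fa -mulrA.
have -> : iter b cderive (val (A (slice Fa (y + t)))) x - iter b cderive (val (A (slice Fa y))) x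
    - t%:C%C * iter b cderive (val (A (slice (D2 false Fa) y))) x =
    iter b cderive (val (A (slice Fa (y + t) - slice Fa y - t%:C%C *: slice (D2 false Fa) y))) x.
  rewrite !(lin_mapB AL) (lin_mapZ AL) !iter_cderiveB.
  congr (_ - _); symmetry.
  by apply: (lin_formZ (l := fun phi => iter b cderive (val phi) x)) => a phi psi; exact:
      iter_cderive_lin.
have := S1_bound (A (slice Fa (y + t) - slice Fa y - t%:C%C *: slice (D2 false Fa) y)) 0 b x.
rewrite expr0 mul1r => /le_trans; apply; apply: (le_trans (Hc _)).
by rewrite ler_wpM2l.
Qed.

(* The seminorms of G are read off the operator on a bounded subset of S1. *)
Lemma snorm2_slice_operator (A : S1 R -> S1 R) F G k l w M :
  (forall (a : C) phi psi, A (a *: phi + psi) = a *: A phi + A psi) ->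
  (forall km, dominated sn1 (sn1 km \o A)) ->
  (forall y x, val G (y, x) = val (A (slice F y)) x) ->
  (forall y, sn1 (l, count id w) (A ((y ^+ k)%:C%C *:
    slice (iter (count negb w) (D2 false) F) y)) <= M) ->
  sn2 (k, l, w) G <= M.
Proof.
move=> AL Ap GF AM; apply: supnorm_le => -[y x]; rewrite /weighted2 /=.
rewrite (slice_operator_pderives AL Ap GF); apply: le_trans (AM y).
rewrite (lin_mapZ AL) snorm1Z normc_real realcM -mulrA normcMr ler_wpM2l//; exact: S1_bound.
Qed.

Lemma iter_D2E F n : val (iter n (D2 false) F) = pderives (nseq n false) (val F).
Proof. by elim: n => //= n IH; rewrite val_D2 IH. Qed.

(** The bound is uniform in y: this is what makes the weighted slices of a bounded set of kernels a
    bounded set in S1. *)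
Lemma snorm1_weighted_slice F k n l m y :
  sn1 (l, m) ((y ^+ k)%:C%C *: slice (iter n (D2 false) F) y) <=
  sn2 (k, l, nseq m true ++ nseq n false) F.
Proof.
apply: supnorm_le => x; rewrite /weighted1 /=.
rewrite (lin_formZ (l := fun phi => iter m cderive (val phi) x)); last first.
  by move=> a phi psi; exact: iter_cderive_lin.
rewrite val_slice iter_cderive_slice iter_D2E mulrA -realcM mulrC [x ^+ l * _]mulrC mulrC.
rewrite -[pderives (nseq m true) _]/(foldr _ _ _) -foldr_cat.
exact: (S2_bound F k l _ (y, x)).
Qed.

End mixed_derivatives.

(** * The topologies *)

Section seminorm_topology.
Context {R : realType}.
Local Notation C := R[i].

Section domination_bounds.
Context {E : lmodType C} {I : eqType}.
Variables (p : I -> E -> R) (pS : forall i, is_seminorm (p i)).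

Lemma dominated_small (q : E -> R) (e : R) : dominated p q -> 0 < e ->
  exists (s : seq I) (d : R), 0 < d /\ forall x, (forall i, i \in s -> p i x < d) -> q x < e.
Proof.
move=> [s [c [c0 H]]] e0; pose N : R := c * (size s)%:R + 1.
have N0 : 0 < N by rewrite ltr_wpDl// mulr_ge0.
exists s, (e / N); split=> [|x xs]; first exact: divr_gt0.
have S : \sum_(i <- s) p i x <= (size s)%:R * (e / N).
  rewrite big_seq -sum1_size natr_sum mulr_suml [leRHS]big_seq.
  by apply: ler_sum => i si; rewrite mul1r ltW// xs.
rewrite (le_lt_trans (H x))// (le_lt_trans (ler_wpM2l c0 S))//.
by rewrite !mulrA ltr_pdivrMr// [ltLHS]mulrC ltr_pM2l// /N ltrDl.
Qed.

Definition seminorm_bounded (B : set E) : Prop := forall i, exists M, forall x, B x -> p i x <= M.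

Lemma seminorm_bounded_seq (B : set E) (s : seq I) : seminorm_bounded B ->
  exists2 M, 0 <= M & forall x, B x -> forall i, i \in s -> p i x <= M.
Proof.
move=> Bb; elim: s => [|j s [M M0 HM]]; first by exists 0.
have [N HN] := Bb j; exists (`|N| + M) => [|x Bx i]; first by rewrite addr_ge0.
rewrite inE => /predU1P[->|si].
  by rewrite (le_trans (HN x Bx))// (le_trans (ler_norm N))// lerDl.
by rewrite (le_trans (HM x Bx i si))// lerDr.
Qed.

Lemma dominated_bounded (q : E -> R) (B : set E) : dominated p q -> seminorm_bounded B ->
  exists M, forall x, B x -> q x <= M.
Proof.
move=> [s [c [c0 H]]] /(seminorm_bounded_seq s)[M M0 HM]; exists (c * ((size s)%:R * M)) => x Bx.
rewrite (le_trans (H x))// ler_wpM2l// big_seq -sum1_size natr_sum mulr_suml [leRHS]big_seq.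
by apply: ler_sum => i si; rewrite mul1r HM.
Qed.

End domination_bounds.

Definition seminorm_nbhs (E : tvsType C) (I : eqType) (p : I -> E -> R) : Prop :=
  forall (x : E) (U : set E), nbhs x U <-> exists (s : seq I) (e : R), 0 < e /\
    forall y, (forall i, i \in s -> p i (y - x) < e) -> U y.

Definition seminorm_entourage (E : tvsType C) (I : eqType) (p : I -> E -> R) : Prop :=
  forall A : set (E * E), entourage A <-> exists (s : seq I) (e : R), 0 < e /\
    forall x y, (forall i, i \in s -> p i (y - x) < e) -> A (x, y).

Lemma seminorm_entourage_nbhs (E : tvsType C) (I : eqType) (p : I -> E -> R) :
  seminorm_entourage p -> seminorm_nbhs p.
Proof.
move=> pE x U; rewrite -nbhs_entourageE; split=> [[A /pE[s [e [e0 sA]]] AU]|[s [e [e0 sU]]]].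
  by exists s, e; split=> // y H; apply: AU; apply/xsectionP; exact: sA.
exists [set xy | forall i, i \in s -> p i (xy.2 - xy.1) < e].
  by apply/pE; exists s, e.
by move=> y /xsectionP; exact: sU.
Qed.

(** Holds by unfolding the entourages from which the uniform structure of [S1] is built. *)
Lemma S1_entourage : seminorm_entourage (@snorm1 R).
Proof. by move=> A; split=> -[s [e [e0 sA]]]; exists s, e. Qed.

Lemma S2_entourage : seminorm_entourage (@snorm2 R).
Proof. by move=> A; split=> -[s [e [e0 sA]]]; exists s, e. Qed.

Lemma regular_nbhs : @seminorm_nbhs C^o unit (fun=> @normc R).
Proof.
move=> x U; split=> [/nbhs_ballP[e /= e0 eU]|[s [e [e0 sU]]]].
  have [eR e0' eE] : exists2 r : R, 0 < r & e = r%:C%C.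
    move: e0; rewrite ltcE => /andP[/eqP ei er]; exists (complex.Re e) => //.
    by case: e ei er {eU} => a b /= ->.
  exists [:: tt], eR; split=> // y /(_ tt); rewrite inE => /(_ isT) yx; apply: eU.
  rewrite -ball_normE /= distrC eE.
  by rewrite -[`|_|]/((normc (y - x))%:C%C) ltcR.
apply/nbhs_ballP; exists (e%:C)%C => /=; first by rewrite ltcR.
move=> y; rewrite -ball_normE /= distrC => H; apply: sU => i _.
by rewrite -ltcR; exact: H.
Qed.

Section linear_continuity.
Context {E F : tvsType C} {I J : eqType}.
Variables (p : I -> E -> R) (q : J -> F -> R).
Hypotheses (pS : forall i, is_seminorm (p i)) (qS : forall j, is_seminorm (q j)).
Hypotheses (pE : seminorm_nbhs p) (qF : seminorm_nbhs q).
Variable f : E -> F.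
Hypothesis fL : forall (a : C) x y, f (a *: x + y) = a *: f x + f y.

Lemma continuous_dominated : continuous f -> forall j, dominated p (q j \o f).
Proof.
move=> fc j; have f0 := lin_map0 fL.
have /pE[s [e [e0 sU]]] : nbhs (0 : E) (f @^-1` [set z | q j z < 1]).
  apply: fc; rewrite f0; apply/qF; exists [:: j], 1; split=> // y /(_ j (mem_head _ _)).
  by rewrite subr0.
exists s, (2 / e); split=> [|x]; first by rewrite divr_ge0// ltW.
set r := \sum_(i <- s) p i x.
have r0 : 0 <= r by rewrite sumr_ge0// => i _; exact: is_seminorm_ge0.
(* The vector x is scaled by e / 2 / (r + d) into the neighborhood; the auxiliary d > 0 covers the
   case r = 0 and is then sent to 0. *)
apply: (@le_epsilon_mul _ _ _ (2 / e)); first by rewrite divr_ge0// ltW.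
move=> d d0; rewrite -mulrDr /=.
have rd : 0 < r + d by rewrite ltr_wpDl.
have t0 : 0 < e / 2 / (r + d) by rewrite !divr_gt0.
have nt : normc (e / 2 / (r + d))%:C%C = e / 2 / (r + d) by rewrite normc_real gtr0_norm.
have := sU ((e / 2 / (r + d))%:C%C *: x).
rewrite /= (lin_mapZ fL) (qS j).2 nt => h.
have {h} : e / 2 / (r + d) * q j (f x) < 1.
  apply: h => i si; rewrite subr0 (pS i).2 nt.
  have pr : p i x <= r.
    rewrite /r (big_rem i si)/= lerDl sumr_ge0// => k _; exact: is_seminorm_ge0.
  rewrite mulrAC ltr_pdivrMr// (@le_lt_trans _ _ (e / 2 * (r + d)))//.
    by rewrite ler_wpM2l ?divr_ge0 ?(ltW e0)// (le_trans pr)// lerDl ltW.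
  by rewrite ltr_pM2r// ltr_pdivrMr// mulr_natr mulr2n ltrDl.
rewrite -ltr_pdivlMl// mulr1 => /ltW /le_trans; apply.
by rewrite !invfM !invrK [e^-1 * 2]mulrC.
Qed.

Lemma dominated_continuous : (forall j, dominated p (q j \o f)) -> continuous f.
Proof.
move=> fd x U /qF[s [e [e0 sU]]]; apply/pE.
suff [t [d [d0 H]]] : exists (t : seq I) (d : R), 0 < d /\ forall y, (forall i, i \in t -> p i
    y < d) ->
    forall j, j \in s -> q j (f y) < e.
  exists t, d; split=> // y ys; apply: sU => j js.
  by rewrite -(lin_mapB fL); exact: H.
elim: s {sU} => [|j s [t [d [d0 H]]]]; first by exists [::], 1.
have [t' [d' [d'0 H']]] := dominated_small (fd j) e0.
exists (t' ++ t), (Order.min d' d); split; first by rewrite lt_min d'0.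
move=> y ys k; rewrite inE => /predU1P[->|].
  by apply: H' => i it; have := ys i; rewrite mem_cat it lt_min => /(_ isT)/andP[].
by apply: H => i it; have := ys i; rewrite mem_cat it orbT lt_min => /(_ isT)/andP[].
Qed.

End linear_continuity.

Lemma tvs_boundedP (E : tvsType C) (I : eqType) (p : I -> E -> R) (B : set E) :
  (forall i, is_seminorm (p i)) -> seminorm_nbhs p ->
  tvs_bounded B <-> seminorm_bounded p B.
Proof.
move=> pS pE; split=> [Bb i|Bb U /pE[s [e [e0 sU]]]].
  have /Bb[r r0 /(_ r)] : nbhs (0 : E) [set x | p i x < 1].
    apply/pE; exists [:: i], 1; split=> // y /(_ i (mem_head _ _)).
    by rewrite subr0.
  rewrite (ger0_norm (ltW r0)) => /(_ (lexx r)) Br; exists (normc r) => x /Br[y /= y1 <-].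
  by rewrite (pS i).2 ler_piMr ?normc_ge0// ltW.
have [M M0 HM] := seminorm_bounded_seq s Bb.
(* The added 1 keeps the radius positive when M = 0 and makes M e / (M + 1) strictly smaller than
   e. *)
have r0 : 0 < (M + 1) / e by rewrite divr_gt0// ltr_wpDl.
exists ((M + 1) / e)%:C%C => [|a]; first by rewrite ltcR.
rewrite -[`|a|]/((normc a)%:C%C) lecR => ra x Bx.
have na0 : 0 < normc a := lt_le_trans r0 ra.
have a0 : a != 0 by apply: contraTneq na0 => ->; rewrite normc0 ltxx.
exists (a^-1 *: x); last by rewrite scalerA mulfV// scale1r.
apply: sU => i si; rewrite subr0 (pS i).2 normcV mulrC ltr_pdivrMr// mulrC.
rewrite (le_lt_trans (HM x Bx i si))// -ltr_pdivrMr// (lt_le_trans _ ra)//.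
by rewrite ltr_pM2r ?invr_gt0// ltrDl.
Qed.

End seminorm_topology.

(** * Comparison of topologies of bounded convergence *)

Section bounded_convergence_topology.
Context {R : realType}.
Local Notation C := R[i].

Lemma Lb_near (X : choiceType) (E F : tvsType C) (f : X -> Lb E F) (x : X)
  (B : set E) (A : set (F * F)) : tvs_bounded B -> entourage A ->
  nbhs (x : initial_topology f)
    [set y | forall b, B b -> A ((val (f x) : E -> F) b, (val (f y) : E -> F) b)].
Proof.
move=> Bb entA.
have fc : continuous (f : initial_topology f -> Lb E F) by exact: initial_continuous.
have vc : continuous (set_val : Lb E F -> {family tvs_bounded, E -> F}).
  exact: (@initial_continuous _ _ set_val).
by have /vc/fc := @fam_nbhs _ _ _ _ _ (set_val (f x)) entA Bb.
Qed.

Lemma Lb_continuous (X : topologicalType) (E F : tvsType C) (f : X -> Lb E F) :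
  (forall x (B : set E) (A : set (F * F)), tvs_bounded B -> entourage A ->
    nbhs x [set y | forall b, B b -> A ((val (f x) : E -> F) b, (val (f y) : E -> F) b)]) ->
  continuous f.
Proof.
move=> H; apply: (@continuous_comp_initial _ _ _ set_val f) => x.
apply/fam_cvgP => B Bb U /uniform_nbhs[A [entA AU]].
apply: filterS (H x B A Bb entA) => y yA; exact: AU.
Qed.

(** The comparison is reduced to one bounded set B' and one seminorm of the target: differences of g
    on B' must be small when differences of f are small on a suitable bounded B. The choice of B may
    not depend on the points x and y. *)
Lemma open_initial_subset (X : choiceType) (E F E' F' : tvsType C) (I J : eqType)
  (p : I -> F -> R) (q : J -> F' -> R) (f : X -> Lb E F) (g : X -> Lb E' F') :
  seminorm_entourage p -> seminorm_entourage q ->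
  (forall (B' : set E') j (e : R), tvs_bounded B' -> 0 < e -> exists (B : set E) (s : seq I) (d
      : R),
    [/\ tvs_bounded B, 0 < d & forall x y,
      (forall b, B b -> forall i, i \in s -> p i ((val (f y) : E -> F) b - (val (f x) : E -> F)
          b) < d) ->
      forall b, B' b -> q j ((val (g y) : E' -> F') b - (val (g x) : E' -> F') b) < e]) ->
  @open (initial_topology g) `<=` @open (initial_topology f).
Proof.
move=> pE qE H; suff gc : continuous (g : initial_topology f -> Lb E' F').
  move=> _ [D oD <-]; exact: (open_comp _ oD).
apply: Lb_continuous => x B' A' B'b /qE[t [e [e0 tA]]].
have K j : nbhs (x : initial_topology f) [set y | forall b, B' b ->
    q j ((val (g y) : E' -> F') b - (val (g x) : E' -> F') b) < e].
  have [B [s [d [Bb d0 sd]]]] := H B' j e B'b e0.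
  have entA : entourage [set zw : F * F | forall i, i \in s -> p i (zw.2 - zw.1) < d].
    by apply/pE; exists s, d.
  by apply: filterS (Lb_near f x Bb entA) => y yB; exact: sd.
suff : nbhs (x : initial_topology f) [set y | forall j, j \in t -> forall b, B' b ->
    q j ((val (g y) : E' -> F') b - (val (g x) : E' -> F') b) < e].
  by apply: filterS => y yt b Bb; apply: tA => j jt; exact: yt.
elim: t {tA} => [|j t IH]; first exact: filterS filterT.
apply: filterS2 (K j) IH => y yj yt k; rewrite inE => /predU1P[->//|]; exact: yt.
Qed.

End bounded_convergence_topology.

Section topologies.
Context {R : realType}.
Local Notation C := R[i].
Local Notation sn1 := (@snorm1 R).
Local Notation sn2 := (@snorm2 R).
Local Notation S1 := (S1 R).
Local Notation S2 := (S2 R).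
Local Notation chi := (gS1 2^-1 0 : S1).
Local Notation P := (Num.sqrt pi : R).

Definition fun_of (E F : tvsType C) (A : Lb E F) : E -> F := val A.

Lemma fun_of_lin (E F : tvsType C) (A : Lb E F) (a : C) x y :
  fun_of A (a *: x + y) = a *: fun_of A x + fun_of A y.
Proof. exact: (set_mem (valP A)).1. Qed.

Lemma fun_of_continuous (E F : tvsType C) (A : Lb E F) : continuous (fun_of A).
Proof. exact: (set_mem (valP A)).2. Qed.

Lemma fun_of_exists (E F : tvsType C) (f : E -> F) :
  (forall (a : C) x y, f (a *: x + y) = a *: f x + f y) -> continuous f ->
  exists A : Lb E F, fun_of A = f.
Proof.
move=> fL fc; have fLb : (f : {family tvs_bounded, E -> F}) \in Lb E F by rewrite inE; split.
by exists (SigSub fLb).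
Qed.

Let nbhs1 := seminorm_entourage_nbhs (@S1_entourage R).
Let nbhs2 := seminorm_entourage_nbhs (@S2_entourage R).

Lemma fun_of_dominated1 (A : Lb S1 S1) km : dominated sn1 (sn1 km \o fun_of A).
Proof.
exact: (continuous_dominated snorm1_seminorm snorm1_seminorm nbhs1 nbhs1 (fun_of_lin A)
  (@fun_of_continuous _ _ A)).
Qed.

Lemma dual2_dominated (T : @dual2 R) : dominated sn2 (fun f => normc (fun_of T f : C)).
Proof.
have nS : forall i : unit, @is_seminorm R C^o (@normc R).
  by move=> _; split=> [x y|a x]; [exact: le_normcD|exact: normcM].
exact: (continuous_dominated snorm2_seminorm nS nbhs2 (@regular_nbhs R) (fun_of_lin T)
  (@fun_of_continuous _ _ T) tt).
Qed.

Section one_multiplier.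
Variable T : M_L R.
Let t : S2 -> C := fun_of (val T).

Lemma M_L_lin (a : C) f g : t (a *: f + g) = a * t f + t g.
Proof. exact: (fun_of_lin (val T) a f g). Qed.

Lemma M_L_twisted f : exists g, forall h, t (twisted f h) = pairing2 g h.
Proof. exact: (set_mem (valP T)). Qed.

(** Only the scalars differ: sqrt(2 pi) = sqrt 2 [P]. *)
Lemma representsZ (A : S1 -> S1) : represents t A <->
  forall phi psi, Z (W_dual (val T)) phi psi = pairing1 (A phi) psi.
Proof.
have s2 : (Num.sqrt 2 : R) != 0 by rewrite gt_eqF// sqrt2_gt0.
have p0 : P != 0 by rewrite gt_eqF// sqrtpi_gt0.
have K (x y : C) : P%:C%C * x = y <-> ((Num.sqrt 2)^-1)%:C%C * x = ((Num.sqrt (2 *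
    pi))^-1)%:C%C * y.
  rewrite sqrtrM// invfM realcM; split=> [<-|/(congr1 (fun z => (Num.sqrt 2 * P)%:C%C * z))].
    by rewrite -mulrA [X in _ = _ * X]mulrA -realcM mulVf// mul1r.
  rewrite !mulrA -!realcM mulrAC divff// mul1r.
  by rewrite divff// mul1r.
by split=> H phi psi; apply/K; exact: H.
Qed.

Lemma ZW_represents : represents t (fun_of (ZW T)).
Proof.
apply/representsZ => phi psi.
suff [A AE] : exists A : Lb S1 S1, forall phi psi,
    Z (W_dual (val T)) phi psi = pairing1 (val A phi) psi.
  exact: (@xgetPex _ (Lb0 S1 S1) [set A | forall phi psi,
    Z (W_dual (val T)) phi psi = pairing1 (val A phi) psi] (ex_intro _ A AE) phi psi).
have [A AT] := represents_exists M_L_lin M_L_twisted.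
have AL := represents_lin M_L_lin AT.
have Ad := represents_dominated M_L_lin (dual2_dominated (val T)) AT.
have [B BE] := fun_of_exists AL (dominated_continuous nbhs1 nbhs1 AL Ad).
exists B => phi' psi'; rewrite -[val B]/(fun_of B) BE.
by move/representsZ: AT; apply.
Qed.

Lemma Lmul_pairing f h : t (twisted f h) = pairing2 (fun_of (Lmul T) f) h.
Proof.
suff [A AE] : exists A : Lb S2 S2, forall f h, twisted_dual (val T) f h = pairing2 (val A f) h.
  exact: (@xgetPex _ (Lb0 S2 S2) [set A | forall f h,
    twisted_dual (val T) f h = pairing2 (val A f) h] (ex_intro _ A AE) f h).
have [L [LL Ld LE]] := left_multiplier_exists M_L_lin (dual2_dominated (val T)) M_L_twisted
    ZW_represents.
have [B BE] := fun_of_exists LL (dominated_continuous nbhs2 nbhs2 LL Ld).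
by exists B => f' h'; rewrite -[val B]/(fun_of B) BE -LE.
Qed.

Lemma ZW_Lmul phi : fun_of (ZW T) phi =
  (P^-1)%:C%C *: contract chi (Wbar (fun_of (Lmul T) (Wbarinv (tensor chi phi)))).
Proof. exact: (represents_contract M_L_lin ZW_represents (Lmul_pairing _)). Qed.

Lemma Lmul_ZW f y x : val (Wbar (fun_of (Lmul T) f)) (y, x) =
  val (fun_of (ZW T) (slice (Wbar f) y)) x.
Proof.
exact: (represents_slice M_L_lin (dual2_dominated (val T)) ZW_represents (Lmul_pairing f)).
Qed.

End one_multiplier.

(** [ZW_Lmul] reads [ZW] = N o [Lmul] o K with continuous linear maps N and K independent of the
    multiplier, so the bounded set is K(B'). *)
Lemma T1_subset_T2 : T1 R `<=` T2 R.
Proof.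
apply: (open_initial_subset (@S2_entourage R) (@S1_entourage R)) => B' j e.
move=> /(tvs_boundedP _ snorm1_seminorm nbhs1) B'b e0.
pose N (F : S2) : S1 := (P^-1)%:C%C *: contract chi (Wbar F).
pose K phi : S2 := Wbarinv (tensor chi phi).
have Nd : dominated sn2 (sn1 j \o N).
  apply: (dominated_le (q := fun F => P^-1 * sn1 j (contract chi (Wbar F)))).
    by move=> F; rewrite /= snorm1Z normc_real ger0_norm// invr_ge0 ltW// sqrtpi_gt0.
  apply: dominatedZ; first by rewrite invr_ge0 ltW// sqrtpi_gt0.
  exact: (dominated_comp snorm2_seminorm (@dominated_Wbar R) (dominated_contract chi j)).
have [s [d [d0 sd]]] := dominated_small Nd e0.
exists (K @` B'), s, d; split=> //.
  apply/(tvs_boundedP _ snorm2_seminorm nbhs2) => kls.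
  have Kd : dominated sn1 (sn2 kls \o K).
    exact: (dominated_comp snorm1_seminorm (dominated_tensorr chi) (dominated_Wbarinv kls)).
  have [M HM] := dominated_bounded Kd B'b.
  by exists M => _ [phi Bphi <-]; exact: HM.
move=> x y H phi Bphi.
have NB F G : N (F - G) = N F - N G.
  by rewrite /N (lin_mapB (@Wbar_lin R)) (lin_mapB (contract_lin chi)) scalerBr.
have -> : val (ZW y) phi - val (ZW x) phi =
    N (fun_of (Lmul y) (K phi) - fun_of (Lmul x) (K phi)).
  by rewrite NB -[val (ZW y)]/(fun_of (ZW y)) -[val (ZW x)]/(fun_of (ZW x)) !ZW_Lmul.
by apply: sd => i si; apply: H => //; exists phi.
Qed.

Lemma T2_subset_T1 : T2 R `<=` T1 R.
Proof.
apply: (open_initial_subset (@S1_entourage R) (@S2_entourage R)) => B' j e.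
move=> /(tvs_boundedP _ snorm2_seminorm nbhs2) B'b e0.
have [s [d [d0 sd]]] := dominated_small (dominated_Wbarinv j) e0.
pose V (k n : nat) (yF : R * S2) : S1 := (yF.1 ^+ k)%:C%C *: slice (iter n (D2 false) (Wbar
    yF.2)) yF.1.
(* Only the indices (k, l, w) in the finite list [s] are used: k and the derivatives in y shape the
   elements of B, while l and the derivatives in x remain as seminorms in [s']. *)
pose B := [set phi | exists2 i : nat * nat * seq bool, i \in s & exists y F, B' F /\
  phi = V i.1.1 (count negb i.2) (y, F)].
pose s' := [seq (i.1.2, count id i.2) | i : nat * nat * seq bool <- s].
(* The supremum over y preserves only a weak inequality; halving d restores the strict one. *)
exists B, s', (d / 2); split; [|by rewrite divr_gt0|].
  apply/(tvs_boundedP _ snorm1_seminorm nbhs1) => -[l m].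
  have Bs : exists M, forall i, i \in s -> forall y F, B' F ->
      sn1 (l, m) (V i.1.1 (count negb i.2) (y, F)) <= M.
    elim: (s) => [|i s0 [M HM]]; first by exists 0.
    have [M' HM'] := dominated_bounded
      (dominated_Wbar (i.1.1, l, nseq m true ++ nseq (count negb i.2) false)) B'b.
    exists (`|M'| + `|M|) => k; rewrite inE => /predU1P[->|ks] y F BF.
      rewrite (le_trans (snorm1_weighted_slice _ _ _ _ _ _))// (le_trans (HM' F BF))//.
      by rewrite (le_trans (ler_norm M'))// lerDl.
    by rewrite (le_trans (HM k ks y F BF))// (le_trans (ler_norm M))// lerDr.
  have [M HM] := Bs; exists M => _ [i si [y [F [BF ->]]]]; exact: HM.
move=> x y H f B'f.
set G := Wbar (fun_of (Lmul y) f - fun_of (Lmul x) f).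
(* The slice formula is linear in the multiplier, so it holds for this difference and for the kernel
   G of the difference of the two values of [Lmul]. *)
pose A phi := fun_of (ZW y) phi - fun_of (ZW x) phi.
have -> : val (Lmul y) f - val (Lmul x) f = Wbarinv G by rewrite /G WbarK.
have AL (a : C) phi psi : A (a *: phi + psi) = a *: A phi + A psi.
  by rewrite /A !fun_of_lin scalerBr opprD addrACA.
have Ad km : dominated sn1 (sn1 km \o A).
  apply: (dominated_le (q := fun phi => sn1 km (fun_of (ZW y) phi) + sn1 km (fun_of (ZW x) phi))).
    by move=> phi; exact: (is_seminormB (snorm1_seminorm km)).
  by apply: (dominatedD snorm1_seminorm); exact: fun_of_dominated1.
have GA v z : val G (v, z) = val (A (slice (Wbar f) v)) z.
  rewrite /G (lin_mapB (@Wbar_lin R)).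
  exact: (congr2 (fun a b => a - b) (Lmul_ZW y f v z) (Lmul_ZW x f v z)).
apply: sd => -[[k l] w] si.
apply: (@le_lt_trans _ _ (d / 2)); last by rewrite ltr_pdivrMr// mulr_natr mulr2n ltrDl.
apply: (snorm2_slice_operator AL Ad GA) => v; apply: ltW.
have Bv : B (V k (count negb w) (v, f)) by exists (k, l, w) => //; exists v, f.
apply: (H _ Bv (l, count id w)).
by apply/mapP; exists (k, l, w).
Qed.

End topologies.

Theorem theorem3 (R : realType) : T1 R = T2 R.
Proof. by apply/seteqP; split; [exact: T1_subset_T2|exact: T2_subset_T1]. Qed.
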